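(* Let $\Gamma$ be a (discrete) group and let $C$ be a $C^{*}$-algebra. (1) Let $\delta$ be a counital partial coaction of $C_0(\Gamma)$ on $C$. Then the projections $p_g:=\mathrm{ev}_g\triangleright 1_C$ ($g\in\Gamma$) are central, and together with the maps $\theta_g\colon p_{g^{-1}}C\to p_gC$ given by $\theta_g(c):=\mathrm{ev}_g\triangleright c$ they form a disconnected partial action of $\Gamma$ on $C$. (2) Let $((p_g)_{g\in\Gamma},(\theta_g)_{g\in\Gamma})$ be a disconnected partial action of $\Gamma$ on $C$. Then the map $\delta\colon C\to C_b(\Gamma;C)\hookrightarrow M(C\otimes C_0(\Gamma))$ defined by $$(\delta(c))(g):=\theta_g(p_{g^{-1}}c)\qquad(c\in C,\ g\in\Gamma)$$ is a counital partial coaction of $C_0(\Gamma)$ on $C$.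
   Context: Tensor products of $C^{*}$-algebras are minimal; $M(C)$ is the multiplier algebra with unit $1_C$. $C_0(\Gamma)$ is the $C^{*}$-bialgebra with comultiplication $\Delta(f)(g,h)=f(gh)$ and counit $\varepsilon$ given by evaluation at the unit $e\in\Gamma$. $C_b(\Gamma;C)$ is the $C^{*}$-algebra of norm-bounded $C$-valued functions on $\Gamma$, identified canonically with a subalgebra of $M(C\otimes C_0(\Gamma))$. $\mathrm{ev}_g\in C_0(\Gamma)^{*}$ is evaluation at $g$. A $*$-homomorphism $\pi\colon B\to M(C)$ is strict if it is strictly continuous on the unit ball; it then extends to $M(B)$. A partial coaction of $(A,\Delta)$ (here $A=C_0(\Gamma)$) on $C$ is a strict $*$-homomorphism $\delta\colon C\to M(C\otimes A)$ with $\delta(C)(1_C\otimes A)\subseteq C\otimes A$ and $(\delta\otimes\mathrm{id}_A)\delta(c)=(\delta(1_C)\otimes 1_A)(\mathrm{id}_C\otimes\Delta)\delta(c)$ for all $c\in C$. It is counital if $(\mathrm{id}_C\otimes\varepsilon)\circ\delta=\mathrm{id}$. For $\omega\in A^{*}$ and $T\in M(C)$, $\omega\triangleright T:=(\mathrm{id}_C\otimes\omega)\delta(T)\in M(C)$. A partial action of $\Gamma$ on $C$ is a family $(D_g)_{g\in\Gamma}$ of closed ideals of $C$ with isomorphisms $\theta_g\colon D_{g^{-1}}\to D_g$ such that $D_e=C$, $\theta_e=\mathrm{id}_C$, and $\theta_{g^{-1}}\theta_g\theta_h=\theta_{g^{-1}}\theta_{gh}$ and $\theta_g\theta_h\theta_{h^{-1}}=\theta_{gh}\theta_{h^{-1}}$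 for all $g,h\in\Gamma$ as partially defined maps. A disconnected partial action of $\Gamma$ on $C$ is a family $(p_g)_{g\in\Gamma}$ of central projections in $M(C)$ with isomorphisms $\theta_g\colon p_{g^{-1}}C\to p_gC$ such that $((p_gC)_g,(\theta_g)_g)$ is a partial action. *)

(* Defs.v *)
From HB Require Import structures.
From mathcomp Require Import all_boot all_order all_algebra.
From mathcomp Require Import complex.
From mathcomp Require Import all_classical all_reals.
From mathcomp Require Import topology normedtype.

Set Implicit Arguments.
Unset Strict Implicit.
Unset Printing Implicit Defensive.

Import Order.TTheory GRing.Theory Num.Theory.
Import numFieldNormedType.Exports.

Local Open Scope classical_set_scope.
Local Open Scope ring_scope.

Reserved Notation "x ⋅ y" (at level 40, left associativity).

(* Possibly non-unital *-algebras over K. *)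
HB.mixin Record isStarAlgebra (K : numClosedFieldType) V
    & GRing.Lmodule K V := {
  smul : V -> V -> V;
  star : V -> V;
  smulA : forall x y z, smul x (smul y z) = smul (smul x y) z;
  smulDl : forall (a : K) x y z,
    smul (a *: x + y) z = a *: smul x z + smul y z;
  smulDr : forall (a : K) x y z,
    smul z (a *: x + y) = a *: smul z x + smul z y;
  star_semilinear : forall (a : K) x y,
    star (a *: x + y) = Num.conj a *: star x + star y;
  star_smul : forall x y, star (smul x y) = smul (star y) (star x);
  starK : forall x, star (star x) = x
}.

#[short(type="starAlgType")]
HB.structure Definition StarAlgebra (K : numClosedFieldType) :=
  {V of GRing.Lmodule K V & isStarAlgebra K V}.

Notation "x ⋅ y" := (smul x y) : ring_scope.

HB.mixin Record isCStarAlgebra (R : realType) V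
    & StarAlgebra R[i] V & CompleteNormedModule R[i] V := {
  norm_smul_le : forall x y : V, `|x ⋅ y| <= `|x| * `|y|;
  norm_star_smul : forall x : V, `|star x ⋅ x| = `|x| ^+ 2
}.

#[short(type="cstarType")]
HB.structure Definition CStarAlgebra (R : realType) :=
  {V of StarAlgebra R[i] V & CompleteNormedModule R[i] V & isCStarAlgebra R V}.

Definition starhom (K : numClosedFieldType) (V W : starAlgType K)
    (f : V -> W) : Prop :=
  [/\ linear f, forall x y, f (x ⋅ y) = f x ⋅ f y
    & forall x, f (star x) = star (f x)].

Section Multipliers.
Context {R : realType}.

(* The multiplier algebra M(A), as double centralizers:
   mulL T x = T x and mulR T x = x T. *)
Record multiplier (A : cstarType R) := Multiplier {
  mulL : A -> A;
  mulR : A -> A;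
  mulL_linear : linear mulL;
  mulR_linear : linear mulR;
  mulL_bounded : exists M : R[i], forall x, `|mulL x| <= M * `|x|;
  mulR_bounded : exists M : R[i], forall x, `|mulR x| <= M * `|x|;
  mulL_smul : forall x y, mulL (x ⋅ y) = mulL x ⋅ y;
  mulR_smul : forall x y, mulR (x ⋅ y) = x ⋅ mulR y;
  mulRL : forall x y, mulR x ⋅ y = x ⋅ mulL y
}.

HB.instance Definition _ (A : cstarType R) := gen_eqMixin (multiplier A).
HB.instance Definition _ (A : cstarType R) := gen_choiceMixin (multiplier A).

Lemma multiplierP (A : cstarType R) (S T : multiplier A) :
  mulL S =1 mulL T -> mulR S =1 mulR T -> S = T.
Proof.
case: S T => l r l1 r1 bl br ll rr lr [l' r' l1' r1' bl' br' ll' rr' lr'] /=.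
move=> /funext e /funext e'; subst l' r'.
congr Multiplier; exact: Prop_irrelevance.
Qed.

Section Operations.
Variable A : cstarType R.
Implicit Types (x y z : A) (S T : multiplier A) (a : R[i]).

Lemma smul0l z : 0 ⋅ z = 0.
Proof.
by have := smulDl 1 0 0 z; rewrite !scale1r addr0 => /eqP;
   rewrite -subr_eq0 opprD addNKr oppr_eq0 => /eqP.
Qed.

Lemma smul0r z : z ⋅ 0 = 0.
Proof.
by have := smulDr 1 0 0 z; rewrite !scale1r addr0 => /eqP;
   rewrite -subr_eq0 opprD addNKr oppr_eq0 => /eqP.
Qed.

Lemma star0 : star (0 : A) = 0.
Proof.
by have := star_semilinear 1 (0 : A) 0; rewrite rmorph1 !scale1r addr0 => /eqP;
   rewrite -subr_eq0 opprD addNKr oppr_eq0 => /eqP.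
Qed.

Let norm_star_le x : `|x| <= `|star x|.
Proof.
have [->|x0] := eqVneq x 0; first by rewrite normr0.
rewrite -(ler_pM2r (_ : 0 < `|x|)) ?normr_gt0//.
by rewrite -expr2 -norm_star_smul norm_smul_le.
Qed.

Lemma norm_star x : `|star x| = `|x|.
Proof.
by apply/eqP; rewrite eq_le norm_star_le andbT -{2}(starK x) norm_star_le.
Qed.

Program Definition mzero : multiplier A :=
  @Multiplier A (fun=> 0) (fun=> 0) _ _ _ _ _ _ _.
Next Obligation. by move=> a x y; rewrite scaler0 addr0. Qed.
Next Obligation. by move=> a x y; rewrite scaler0 addr0. Qed.
Next Obligation. by exists 0 => x; rewrite normr0 mul0r. Qed.
Next Obligation. by exists 0 => x; rewrite normr0 mul0r. Qed.
Next Obligation. by move=> * /=; rewrite smul0l. Qed.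
Next Obligation. by move=> * /=; rewrite smul0r. Qed.
Next Obligation. by move=> * /=; rewrite smul0l smul0r. Qed.

Program Definition mlin (a : R[i]) S T : multiplier A :=
  @Multiplier A (fun x => a *: mulL S x + mulL T x)
                (fun x => a *: mulR S x + mulR T x) _ _ _ _ _ _ _.
Next Obligation.
move=> a S T b x y; rewrite !mulL_linear !scalerDr !scalerA (mulrC a b) -!addrA.
by congr (_ + _); rewrite addrCA.
Qed.
Next Obligation.
move=> a S T b x y; rewrite !mulR_linear !scalerDr !scalerA (mulrC a b) -!addrA.
by congr (_ + _); rewrite addrCA.
Qed.
Next Obligation.
move=> a S T.
have [M HM] := mulL_bounded S; have [N HN] := mulL_bounded T.
exists (`|a| * M + N) => x; rewrite mulrDl (le_trans (ler_normD _ _))//.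
by rewrite lerD// normrZ -mulrA ler_wpM2l.
Qed.
Next Obligation.
move=> a S T.
have [M HM] := mulR_bounded S; have [N HN] := mulR_bounded T.
exists (`|a| * M + N) => x; rewrite mulrDl (le_trans (ler_normD _ _))//.
by rewrite lerD// normrZ -mulrA ler_wpM2l.
Qed.
Next Obligation. by move=> * /=; rewrite smulDl !mulL_smul. Qed.
Next Obligation. by move=> * /=; rewrite smulDr !mulR_smul. Qed.
Next Obligation. by move=> * /=; rewrite smulDl smulDr !mulRL. Qed.

Program Definition mone : multiplier A :=
  @Multiplier A id id _ _ _ _ _ _ _.
Next Obligation. by []. Qed.
Next Obligation. by []. Qed.
Next Obligation. by exists 1 => x; rewrite mul1r. Qed.
Next Obligation. by exists 1 => x; rewrite mul1r. Qed.
Next Obligation. by []. Qed.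
Next Obligation. by []. Qed.
Next Obligation. by []. Qed.

Let bounded_comp (f g : A -> A) :
  (exists M : R[i], forall x, `|f x| <= M * `|x|) ->
  (exists M : R[i], forall x, `|g x| <= M * `|x|) ->
  exists M : R[i], forall x, `|f (g x)| <= M * `|x|.
Proof.
move=> [M HM] [N HN].
have M1 x : `|f x| <= `|M| * `|x|.
  have := HM x; have [->|x0] := eqVneq x 0; first by rewrite normr0 !mulr0.
  move=> h; rewrite -[`|x|]normr_id -normrM.
  by rewrite (le_trans h)// real_ler_norm// ger0_real// (le_trans _ h).
exists (`|M| * N) => x; rewrite (le_trans (M1 _))// -mulrA.
by rewrite ler_wpM2l.
Qed.

Program Definition mmul S T : multiplier A :=
  @Multiplier A (fun x => mulL S (mulL T x)) (fun x => mulR T (mulR S x))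
    _ _ _ _ _ _ _.
Next Obligation. by move=> S T a x y /=; rewrite !mulL_linear. Qed.
Next Obligation. by move=> S T a x y /=; rewrite !mulR_linear. Qed.
Next Obligation.
by move=> S T; exact: (bounded_comp (mulL_bounded S) (mulL_bounded T)).
Qed.
Next Obligation.
by move=> S T; exact: (bounded_comp (mulR_bounded T) (mulR_bounded S)).
Qed.
Next Obligation. by move=> * /=; rewrite !mulL_smul. Qed.
Next Obligation. by move=> * /=; rewrite !mulR_smul. Qed.
Next Obligation. by move=> * /=; rewrite !mulRL. Qed.

Program Definition mstar S : multiplier A :=
  @Multiplier A (fun x => star (mulR S (star x)))
                (fun x => star (mulL S (star x))) _ _ _ _ _ _ _.
Next Obligation.
by move=> S a x y; rewrite star_semilinear mulR_linear star_semilinear conjCK.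
Qed.
Next Obligation.
by move=> S a x y; rewrite star_semilinear mulL_linear star_semilinear conjCK.
Qed.
Next Obligation.
move=> S.
have [M HM] := mulR_bounded S; exists M => x.
by rewrite norm_star -(norm_star x).
Qed.
Next Obligation.
move=> S.
have [M HM] := mulL_bounded S; exists M => x.
by rewrite norm_star -(norm_star x).
Qed.
Next Obligation. by move=> * /=; rewrite star_smul mulR_smul star_smul starK. Qed.
Next Obligation. by move=> * /=; rewrite star_smul mulL_smul star_smul starK. Qed.
Next Obligation.
by move=> S x y; rewrite -[y in LHS]starK -star_smul -mulRL star_smul starK.
Qed.

Program Definition embM (a : A) : multiplier A :=
  @Multiplier A (fun x => a ⋅ x) (fun x => x ⋅ a) _ _ _ _ _ _ _.
Next Obligation. by move=> a b x y; rewrite smulDr. Qed.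
Next Obligation. by move=> a b x y; rewrite smulDl. Qed.
Next Obligation. by move=> a; exists `|a| => x; rewrite norm_smul_le. Qed.
Next Obligation. by move=> a; exists `|a| => x; rewrite mulrC norm_smul_le. Qed.
Next Obligation. by move=> * /=; rewrite smulA. Qed.
Next Obligation. by move=> * /=; rewrite smulA. Qed.
Next Obligation. by move=> * /=; rewrite smulA. Qed.

Let madd S T := mlin 1 S T.
Let mopp S := mlin (-1) S mzero.
Let mscale a S := mlin a S mzero.

Let maddA : associative madd.
Proof. by move=> S T U; apply: multiplierP => x /=; rewrite !scale1r addrA. Qed.
Let maddC : commutative madd.
Proof. by move=> S T; apply: multiplierP => x /=; rewrite !scale1r addrC. Qed.
Let madd0 : left_id mzero madd.
Proof. by move=> S; apply: multiplierP => x /=; rewrite scaler0 add0r. Qed.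
Let maddN : left_inverse mzero mopp madd.
Proof.
by move=> S; apply: multiplierP => x /=;
  rewrite !scale1r addr0 scaleN1r addNr.
Qed.

HB.instance Definition _ :=
  GRing.isZmodule.Build (multiplier A) maddA maddC madd0 maddN.

Let mscaleA a b S : mscale a (mscale b S) = mscale (a * b) S.
Proof. by apply: multiplierP => x /=; rewrite !addr0 scalerA. Qed.
Let mscale1 : left_id 1 mscale.
Proof. by move=> S; apply: multiplierP => x /=; rewrite addr0 scale1r. Qed.
Let mscaleDr : right_distributive mscale +%R.
Proof.
by move=> a S T; apply: multiplierP => x /=; rewrite !addr0 !scale1r scalerDr.
Qed.
Let mscaleDl S : {morph mscale^~ S : a b / a + b}.
Proof.
by move=> a b; apply: multiplierP => x /=; rewrite !addr0 !scale1r scalerDl.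
Qed.

HB.instance Definition _ := GRing.Zmodule_isLmodule.Build R[i] (multiplier A)
  mscaleA mscale1 mscaleDr mscaleDl.

Lemma mlinE a S T : a *: S + T = mlin a S T.
Proof. by apply: multiplierP => x /=; rewrite scale1r addr0. Qed.

Let mmulA S T U : mmul S (mmul T U) = mmul (mmul S T) U.
Proof. exact: multiplierP. Qed.
Let mmulDl a S T U : mmul (a *: S + T) U = a *: mmul S U + mmul T U.
Proof. by rewrite !mlinE; apply: multiplierP => x //=; rewrite mulR_linear. Qed.
Let mmulDr a S T U : mmul U (a *: S + T) = a *: mmul U S + mmul U T.
Proof. by rewrite !mlinE; apply: multiplierP => x //=; rewrite mulL_linear. Qed.
Let mstar_semilinear a S T :
  mstar (a *: S + T) = Num.conj a *: mstar S + mstar T.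
Proof.
by rewrite !mlinE; apply: multiplierP => x /=; rewrite star_semilinear.
Qed.
Let mstar_mul S T : mstar (mmul S T) = mmul (mstar T) (mstar S).
Proof. by apply: multiplierP => x /=; rewrite !starK. Qed.
Let mstarK S : mstar (mstar S) = S.
Proof. by apply: multiplierP => x /=; rewrite !starK. Qed.

HB.instance Definition _ := isStarAlgebra.Build R[i] (multiplier A)
  mmulA mmulDl mmulDr mstar_semilinear mstar_mul mstarK.

End Operations.
End Multipliers.

Arguments mzero {R A}.
Arguments mone {R A}.
Arguments mlin {R A} a S T.
Arguments mmul {R A} S T.
Arguments mstar {R A} S.
Arguments embM {R A} a.

(* C_0(X) for a discrete space X: all complex functions vanishing at infinity,
   with pointwise operations and the supremum norm. *)
Section C0.
Variables (R : realType) (X : Type).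

Definition c0_pred : {pred X -> R[i]} := fun f =>
  `[< forall e : R[i], 0 < e -> finite_set [set x | e <= `|f x|] >].

Let c0_submod : submod_closed c0_pred.
Proof.
split=> [|a f g /asboolP f0 /asboolP g0]; apply/asboolP => e e0.
  apply: (sub_finite_set _ (finite_set0 X)) => x /=.
  by rewrite normr0 (lt_geF e0).
have a1 : 0 < `|a| + 1 by rewrite ltr_wpDl.
apply: (@sub_finite_set _ _ ([set x | e / 2 / (`|a| + 1) <= `|f x|] `|`
    [set x | e / 2 <= `|g x|])); last first.
  by rewrite finite_setU; split; [apply: f0; rewrite !divr_gt0|
                                  apply: g0; rewrite divr_gt0].
move=> x /= ex; have [gx|gx] := boolP (e / 2 <= `|g x|); [by right|left].
have gx' : `|g x| < e / 2.
  by rewrite real_ltNge ?normr_real// gtr0_real// divr_gt0.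
rewrite ler_pdivrMr//; apply: le_trans (_ : `|f x| * `|a| <= _); last first.
  by rewrite ler_wpM2l// lerDl.
rewrite [leRHS]mulrC -normrM -(lerD2r (e / 2)) -splitr (le_trans ex)//.
by rewrite (le_trans (ler_normD _ _))// lerD2l ltW.
Qed.

HB.instance Definition _ := GRing.isSubmodClosed.Build R[i] (X -> R[i]) c0_pred
  c0_submod.

Record C0 := MkC0 { c0_fun :> X -> R[i]; c0_funP : c0_fun \in c0_pred }.

HB.instance Definition _ := [isSub for c0_fun].
HB.instance Definition _ := [Choice of C0 by <:].
HB.instance Definition _ := [SubChoice_isSubLmodule of C0 by <:].

Implicit Types (f g : C0) (a : R[i]).

Let c0_vanish f (e : R[i]) : 0 < e -> finite_set [set x | e <= `|f x|].
Proof. by have /asboolP := c0_funP f; apply. Qed.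

Let c0E f g a x : (a *: f + g) x = a * f x + g x.
Proof. by []. Qed.
Let c0D f g x : (f + g) x = f x + g x.
Proof. by []. Qed.
Let c0B f g x : (f - g) x = f x - g x.
Proof. by []. Qed.

Let c0_ext f g : f =1 g -> f = g.
Proof. by move=> fg; apply/val_inj/funext. Qed.

Let c0_bounded f : exists M, forall x, `|f x| <= M.
Proof.
have /(finite_image (fun x => `|f x|))/finite_seqP[s fs] := c0_vanish f ltr01.
exists (1 + \sum_(y <- s) `|y|) => x.
have [fx|fx] := boolP (1 <= `|f x|); last first.
  rewrite ler_wpDr ?sumr_ge0// ltW// real_ltNge ?normr_real//.
have : [set `|f x| | x in [set x | 1 <= `|f x|]] `|f x| by exists x.
rewrite fs /= => xs; rewrite ler_wpDl// (big_rem _ xs)/= normr_id lerDl.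
exact: sumr_ge0.
Qed.

Definition c0_norm f : R[i] := (sup (range (fun x => complex.Re `|f x|)))%:C%C.

Let c0_le_norm f x : `|f x| <= c0_norm f.
Proof.
rewrite /c0_norm -[leLHS]RRe_real ?normr_real// lecR; apply: ub_le_sup.
  have [M fM] := c0_bounded f; exists (complex.Re M) => _ [y _ <-].
  by have := fM y; rewrite lecE => /andP[].
by exists x.
Qed.

Let c0_norm_le f (M : R[i]) : 0 <= M -> (forall x, `|f x| <= M) -> c0_norm f <= M.
Proof.
move=> M0 fM; rewrite /c0_norm -(RRe_real (ger0_real M0)) lecR.
have [X0|/nonemptyPn X0] := pselect (range (fun x => complex.Re `|f x|) !=set0).
  by apply: ge_sup => // _ [y _ <-]; have := fM y; rewrite lecE => /andP[].
by rewrite X0 sup0; move: M0; rewrite lecE => /andP[].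
Qed.

Let c0_norm_ge0 f : 0 <= c0_norm f.
Proof.
have [[x]|X0] := pselect (inhabited X).
  exact: le_trans (c0_le_norm f x).
rewrite /c0_norm.
have -> : range (fun x => complex.Re `|f x|) = set0.
  by apply/seteqP; split=> // y [x]; have := X0 (inhabits x).
by rewrite sup0.
Qed.

Let c0_normD f g : c0_norm (f + g) <= c0_norm f + c0_norm g.
Proof.
apply: c0_norm_le => [|x]; first by rewrite addr_ge0.
by rewrite c0D (le_trans (ler_normD _ _))// lerD.
Qed.

Let c0_normZ a f : c0_norm (a *: f) = `|a| * c0_norm f.
Proof.
have le b h : c0_norm (b *: h) <= `|b| * c0_norm h.
  apply: c0_norm_le => [|x]; first by rewrite mulr_ge0.
  by rewrite (_ : (b *: h) x = b * h x)// normrM ler_wpM2l.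
apply/eqP; rewrite eq_le le /=.
have [->|a0] := eqVneq a 0; first by rewrite normr0 mul0r.
rewrite -ler_pdivlMl ?normr_gt0// -normfV.
by rewrite -[f in leLHS]scale1r -(mulVf a0) -scalerA.
Qed.

Let c0_norm0_eq0 f : c0_norm f = 0 -> f = 0.
Proof.
move=> f0; apply: c0_ext => x; apply/eqP; rewrite -normr_le0 -f0.
exact: c0_le_norm.
Qed.

HB.instance Definition _ :=
  @Lmodule_isNormed.Build R[i] C0 c0_norm c0_normD c0_normZ c0_norm0_eq0.

Lemma c0_normr_ub f x : `|f x| <= `|f|.
Proof. exact: c0_le_norm. Qed.

Lemma c0_normr_le f (M : R[i]) : 0 <= M -> (forall x, `|f x| <= M) -> `|f| <= M.
Proof. exact: c0_norm_le. Qed.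

Let c0_cauchy_pt (F : set_system C0) (x : X) : ProperFilter F -> cauchy F ->
  exists l : R[i], forall e : R[i], 0 < e ->
    \forall f \near F, `|(f : C0) x - l| <= e.
Proof.
move=> FF /cauchy_ballP Fc.
have part (p : R[i] -> R) : (forall y z, p (y - z) = p y - p z) ->
    (forall y, `|p y|%:C%C <= `|y|) ->
    exists l : R, forall e : R, 0 < e -> \forall f \near F, `|l - p ((f : C0) x)| <= e.
  move=> pB ple; pose G := (fun f : C0 => p (f x)) @ F.
  have : cauchy G.
    apply/cauchy_ballP => e e0; rewrite near_map2.
    have eC : 0 < e%:C%C :> R[i] by rewrite ltcR.
    apply: filterS (Fc _ eC) => -[f g] /=.
    rewrite -[ball f _ g]/(ball_ _ _ _ _) -[ball (p _) _ _]/(ball_ _ _ _ _) /=.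
    rewrite -(ltcR _ e) => fg; rewrite -pB (le_lt_trans (ple _))//.
    exact: le_lt_trans (c0_le_norm (f - g) x) fg.
  move=> /R_complete /cvg_ex[l /cvgrPdist_le Gl]; exists l => e e0.
  exact: (Gl e e0).
have [y z||l1 Hl1] := part (@complex.Re R).
- by case: y z => [? ?] [].
- exact: normc_ge_Re.
have [y z||l2 Hl2] := part (@complex.Im R).
- by case: y z => [? ?] [].
- move=> [u v]; rewrite normc_def lecR/= -(sqrtr_sqr v) ler_sqrt ?lerDr ?sqr_ge0//.
  by rewrite addr_ge0 ?sqr_ge0.
exists (l1 +i* l2)%C => e e0; pose e' := complex.Re e / 2.
have e'0 : 0 < e'.
  by move: e0; rewrite ltcE => /andP[_ e0]; rewrite divr_gt0.
near=> f.
have -> : f x - (l1 +i* l2)%C =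
    (complex.Re (f x) - l1)%:C%C + 'i%C * (complex.Im (f x) - l2)%:C%C.
  by case: (f x) => u v; simpc.
have ni : `|'i%C : R[i]| = 1 by rewrite normc_def/= expr0n expr1n add0r sqrtr1.
have nC (r : R) : `|r%:C%C : R[i]| = `|r|%:C%C.
  by rewrite normc_def/= expr0n addr0 sqrtr_sqr.
rewrite (le_trans (ler_normD _ _))// normrM ni mul1r !nC -rmorphD/=.
rewrite -(RRe_real (gtr0_real e0)) lecR [leRHS](splitr (complex.Re e)).
by rewrite lerD// distrC; near: f; [exact: Hl1|exact: Hl2].
Unshelve. all: by end_near. Qed.

Let c0_complete (F : set_system C0) : ProperFilter F -> cauchy F -> cvg F.
Proof.
move=> FF Fc; have /choice[l Hl] := fun x => c0_cauchy_pt x FF Fc.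
have Fl (e : R[i]) : 0 < e -> \forall f \near F, forall x, `|(f : C0) x - l x| <= e.
  move=> e0; have e2 : 0 < e / 2 by rewrite divr_gt0.
  have /cauchy_ballP/(_ _ e2)/nearP_dep := Fc.
  apply: filterS => f Ff x.
  have [g [fg gl]] : exists g : C0, ball f (e / 2) g /\ `|g x - l x| <= e / 2.
    near F => g; exists g; split; near: g => //; exact: Hl.
  rewrite -(subrKA (g x)) (splitr e) (le_trans (ler_normD _ _))// lerD//.
  by rewrite (le_trans (c0_le_norm (f - g) x))// ltW.
have l0 : l \in c0_pred.
  apply/asboolP => e e0; have e2 : 0 < e / 2 by rewrite divr_gt0.
  have [f fl] := filter_ex (Fl _ e2).
  apply: sub_finite_set (c0_vanish f e2) => x /= ex.
  rewrite -(lerD2r (e / 2)) -splitr (le_trans ex)//.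
  rewrite -[l x](subrK (f x)) addrC (le_trans (ler_normD _ _))// lerD2l.
  by rewrite distrC.
apply/cvg_ex; exists (MkC0 l0); apply/cvgrPdist_le => e e0.
apply: filterS (Fl _ e0) => f fl; apply: c0_norm_le => [|x]; first exact: ltW.
by rewrite c0B distrC.
Unshelve. all: by end_near. Qed.

HB.instance Definition _ := Uniform_isComplete.Build C0 c0_complete.

Let c0_mul_subproof f g : (fun x => f x * g x) \in c0_pred.
Proof.
apply/asboolP => e e0; have M1 : 0 < c0_norm g + 1 by rewrite ltr_wpDl.
apply: sub_finite_set (c0_vanish f (divr_gt0 e0 M1)) => x /= ex.
rewrite ler_pdivrMr// (le_trans ex)// normrM ler_wpM2l//.
by rewrite ler_wpDr.
Qed.
Definition c0_mul f g : C0 := MkC0 (c0_mul_subproof f g).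

Let c0_star_subproof f : (fun x => Num.conj (f x)) \in c0_pred.
Proof.
apply/asboolP => e e0; apply: sub_finite_set (c0_vanish f e0) => x /=.
by rewrite norm_conjC.
Qed.
Definition c0_star f : C0 := MkC0 (c0_star_subproof f).

Let c0_mulA f g h : c0_mul f (c0_mul g h) = c0_mul (c0_mul f g) h.
Proof. by apply: c0_ext => x /=; rewrite mulrA. Qed.
Let c0_mulDl a f g h :
  c0_mul (a *: f + g) h = a *: c0_mul f h + c0_mul g h.
Proof.
apply: c0_ext => x.
by rewrite -[LHS]/((a * f x + g x) * h x) mulrDl -mulrA.
Qed.
Let c0_mulDr a f g h :
  c0_mul h (a *: f + g) = a *: c0_mul h f + c0_mul h g.
Proof.
apply: c0_ext => x.
by rewrite -[LHS]/(h x * (a * f x + g x)) mulrDr mulrCA.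
Qed.
Let c0_star_semilinear a f g :
  c0_star (a *: f + g) = Num.conj a *: c0_star f + c0_star g.
Proof.
apply: c0_ext => x.
by rewrite -[LHS]/(Num.conj (a * f x + g x)) rmorphD rmorphM.
Qed.
Let c0_star_mul f g : c0_star (c0_mul f g) = c0_mul (c0_star g) (c0_star f).
Proof. by apply: c0_ext => x; rewrite /= rmorphM mulrC. Qed.
Let c0_starK f : c0_star (c0_star f) = f.
Proof. by apply: c0_ext => x; rewrite /= conjCK. Qed.

HB.instance Definition _ := isStarAlgebra.Build R[i] C0
  c0_mulA c0_mulDl c0_mulDr c0_star_semilinear c0_star_mul c0_starK.

Let c0_norm_mul (f g : C0) : `|f ⋅ g| <= `|f| * `|g|.
Proof.
apply: c0_norm_le => [|x]; first by rewrite mulr_ge0.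
by rewrite /= normrM ler_pM// c0_le_norm.
Qed.

Let c0_norm_star (f : C0) : `|star f ⋅ f| = `|f| ^+ 2.
Proof.
have E x : `|(star f ⋅ f) x| = `|f x| ^+ 2.
  by rewrite /= normrM norm_conjC expr2.
apply/eqP; rewrite eq_le; apply/andP; split.
  apply: c0_norm_le => [|x]; first by rewrite exprn_ge0.
  by rewrite E lerXn2r ?nnegrE// c0_le_norm.
rewrite -[leRHS]sqrtCK lerXn2r ?nnegrE ?sqrtC_ge0//.
apply: c0_norm_le => [|x]; first by rewrite sqrtC_ge0.
rewrite -(@ler_pXn2r _ 2) ?nnegrE ?sqrtC_ge0// sqrtCK -E.
exact: c0_le_norm.
Qed.

HB.instance Definition _ :=
  isCStarAlgebra.Build R C0 c0_norm_mul c0_norm_star.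

Let chi_subproof (x : X) : (fun y => (`[< y = x >])%:R : R[i]) \in c0_pred.
Proof.
apply/asboolP => e e0; apply: (sub_finite_set _ (finite_set1 x)) => y /=.
by case: asboolP => //= _; rewrite normr0 (lt_geF e0).
Qed.
Definition chi (x : X) : C0 := MkC0 (chi_subproof x).

End C0.

Section StrictTopology.
Context {R : realType}.
Implicit Types A B : cstarType R.

Definition strict_cvg A (F : set_system (multiplier A)) (T : multiplier A) :
    Prop :=
  forall x, mulL S x @[S --> F] --> mulL T x /\
            mulR S x @[S --> F] --> mulR T x.

(* The norm of M(A) is the operator norm of the left centralizer. *)
Definition mult_unit_ball A : set (multiplier A) :=
  [set T | forall x, `|mulL T x| <= `|x|].

(* Strict continuity on the unit ball, phrased with filters (equivalently,
   nets): for maps defined on A, with the topology induced from M(A)... *)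
Definition strict A B (f : A -> multiplier B) : Prop :=
  forall (F : set_system A) (a : A), ProperFilter F ->
    F [set x | `|x| <= 1] -> `|a| <= 1 ->
    strict_cvg (embM x @[x --> F]) (embM a) ->
    strict_cvg (f x @[x --> F]) (f a).

(* ... and for maps defined on M(A). *)
Definition mult_strict A B (f : multiplier A -> multiplier B) : Prop :=
  forall (F : set_system (multiplier A)) (T : multiplier A), ProperFilter F ->
    F (@mult_unit_ball A) -> mult_unit_ball T ->
    strict_cvg F T -> strict_cvg (f S @[S --> F]) (f T).

(* The extension of a strict *-homomorphism A -> M(B) to M(A). Here and below,
   [xget] is used for definite descriptions: the listed properties determine
   the object uniquely, and the default value 0 plays no role. *)
Definition strict_ext A B (f : A -> multiplier B) :
    multiplier A -> multiplier B :=
  xget (fun=> 0) [set f' | [/\ starhom f', mult_strict f' &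
                            forall a, f' (embM a) = f a]].

End StrictTopology.

Section TensorProducts.
Context {R : realType}.
Implicit Types A B : cstarType R.

Definition linearly_independent (V : lmodType R[i]) n (v : 'I_n -> V) : Prop :=
  forall k : 'I_n -> R[i], \sum_i k i *: v i = 0 -> forall i, k i = 0.

(* t : A x B -> T exhibits the C*-algebra T as a completion of the algebraic
   tensor product of A and B with respect to a C*-cross norm. The clause
   [cstar_tensor_inj] says that the algebraic tensor product embeds in T. *)
Record is_cstar_tensor A B (T : cstarType R) (t : A -> B -> T) : Prop := {
  cstar_tensor_linearl : forall b, linear (t^~ b);
  cstar_tensor_linearr : forall a, linear (t a);
  cstar_tensor_mul : forall a a' b b',
    t (a ⋅ a') (b ⋅ b') = t a b ⋅ t a' b';
  cstar_tensor_star : forall a b, t (star a) (star b) = star (t a b);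
  cstar_tensor_inj : forall n (a : 'I_n -> A) (b : 'I_n -> B),
    linearly_independent b -> \sum_i t (a i) (b i) = 0 -> forall i, a i = 0;
  cstar_tensor_norm : forall a b, `|t a b| = `|a| * `|b|;
  cstar_tensor_dense :
    dense [set x : T | exists n (a : 'I_n -> A) (b : 'I_n -> B),
                         x = \sum_i t (a i) (b i)]
}.

(* A minimal tensor product of A and B, unique up to canonical isomorphism: the
   completion for the least C*-cross norm, i.e. for the spatial norm. *)
Record min_tensor A B := MinTensor {
  min_tensor_sort :> cstarType R;
  tens : A -> B -> min_tensor_sort;
  tensP : is_cstar_tensor tens;
  tens_min : forall (T : cstarType R) (t : A -> B -> T), is_cstar_tensor t ->
    forall n (a : 'I_n -> A) (b : 'I_n -> B),
      `|\sum_i tens (a i) (b i)| <= `|\sum_i t (a i) (b i)|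
}.

(* S \otimes T in M(A \otimes B) *)
Definition mtens A B (AB : min_tensor A B)
    (S : multiplier A) (T : multiplier B) : multiplier AB :=
  xget 0 [set m | forall a b,
    mulL m (tens AB a b) = tens AB (mulL S a) (mulL T b) /\
    mulR m (tens AB a b) = tens AB (mulR S a) (mulR T b)].

(* f \otimes g : M(A \otimes B) -> M(A' \otimes B'), for strict
   *-homomorphisms f : A -> M(A') and g : B -> M(B'), already extended to
   multipliers. *)
Definition hom_tens A B A' B' (AB : min_tensor A B) (AB' : min_tensor A' B')
    (f : A -> multiplier A') (g : B -> multiplier B') :
    multiplier AB -> multiplier AB' :=
  xget (fun=> 0) [set h | [/\ starhom h, mult_strict h &
    forall a b, h (embM (tens AB a b)) = mtens AB' (f a) (g b)]].

(* The slice map id \otimes w : M(A \otimes B) -> M(A), for w in B^*. *)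
Definition slice A B (AB : min_tensor A B) (w : B -> R[i]) :
    multiplier AB -> multiplier A :=
  xget (fun=> 0) [set h | [/\ linear h, mult_strict h &
    forall a b, h (embM (tens AB a b)) = w b *: embM a]].

(* The associativity isomorphism
   M(A \otimes (B \otimes D)) -> M((A \otimes B) \otimes D). *)
Definition massoc A B D (AB : min_tensor A B) (BD : min_tensor B D)
    (AB_D : min_tensor AB D) (A_BD : min_tensor A BD) :
    multiplier A_BD -> multiplier AB_D :=
  xget (fun=> 0) [set h | [/\ starhom h, mult_strict h &
    forall a b d, h (embM (tens A_BD a (tens BD b d))) =
                  embM (tens AB_D (tens AB a b) d)]].

End TensorProducts.

Arguments hom_tens {R A B A' B'} AB AB' f g.
Arguments slice {R A B} AB w.
Arguments massoc {R A B D AB BD} AB_D A_BD.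

Section PartialCoactions.
Context {R : realType} {A C : cstarType R}.
Variables (CA : min_tensor C A) (AA : min_tensor A A)
  (CA_A : min_tensor CA A) (C_AA : min_tensor C AA).
Variables (Delta : A -> multiplier AA) (eps : A -> R[i]).

(* id \otimes Delta : M(C \otimes A) -> M((C \otimes A) \otimes A) *)
Definition id_tens_comult (T : multiplier CA) : multiplier CA_A :=
  massoc CA_A C_AA (hom_tens CA C_AA embM Delta T).

Definition partial_coaction (delta : C -> multiplier CA) : Prop :=
  [/\ starhom delta, strict delta,
      forall c a, exists x : CA, delta c ⋅ mtens CA mone (embM a) = embM x
    & forall c, hom_tens CA CA_A delta embM (delta c) =
        mtens CA_A (strict_ext delta mone) mone
          ⋅ id_tens_comult (delta c)].

Definition counital (delta : C -> multiplier CA) : Prop :=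
  forall c, slice CA eps (delta c) = embM c.

(* w |> T *)
Definition coact (delta : C -> multiplier CA) (w : A -> R[i])
    (T : multiplier C) : multiplier C :=
  slice CA w (strict_ext delta T).

End PartialCoactions.

Section FunctionAlgebras.
Context {R : realType} (G : groupType).
Notation A := (C0 R G).

Definition ev (g : G) : A -> R[i] := fun f => f g.

Definition C0_counit : A -> R[i] := ev 1%g.

(* Delta f is multiplication by the function (g, h) |-> f (g h); since the
   chi g (x) chi h span a dense subspace, this determines it. *)
Definition C0_comult (AA : min_tensor A A) (f : A) : multiplier AA :=
  xget 0 [set m | forall g h,
    mulL m (tens AA (chi R g) (chi R h)) =
      f (g * h)%g *: tens AA (chi R g) (chi R h) /\
    mulR m (tens AA (chi R g) (chi R h)) =
      f (g * h)%g *: tens AA (chi R g) (chi R h)].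

(* The image in M(C \otimes C_0(G)) of a bounded function u : G -> C, i.e.
   pointwise multiplication by u. *)
Definition Cb_mult (C : cstarType R) (CA : min_tensor C A) (u : G -> C) :
    multiplier CA :=
  xget 0 [set m | forall c g,
    mulL m (tens CA c (chi R g)) = tens CA (u g ⋅ c) (chi R g) /\
    mulR m (tens CA c (chi R g)) = tens CA (c ⋅ u g) (chi R g)].

End FunctionAlgebras.

Section PartialActions.
Context {R : realType} {G : groupType} {C : cstarType R}.

Definition closed_ideal (I : set C) : Prop :=
  [/\ closed I, I 0, forall (a : R[i]) x y, I x -> I y -> I (a *: x + y)
    & forall x y, I x -> I (x ⋅ y) /\ I (y ⋅ x)].

Definition starisom_on (I J : set C) (f : C -> C) : Prop :=
  [/\ set_bij I J f,
      forall (a : R[i]) x y, I x -> I y -> f (a *: x + y) = a *: f x + f y,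
      forall x y, I x -> I y -> f (x ⋅ y) = f x ⋅ f y
    & forall x, I x -> f (star x) = star (f x)].

(* The partially defined map with domain D and values given by f. *)
Definition partial_map (D : set C) (f : C -> C) : C -> option C :=
  fun x => if `[< D x >] then Some (f x) else None.

Definition pcomp (f g : C -> option C) : C -> option C :=
  fun x => obind f (g x).

(* theta g only matters on D g^-1. *)
Definition partial_action (D : G -> set C) (theta : G -> C -> C) : Prop :=
  let th g := partial_map (D g^-1%g) (theta g) in
  [/\ forall g, closed_ideal (D g),
      forall g, starisom_on (D g^-1%g) (D g) (theta g),
      D 1%g = setT /\ (forall c, theta 1%g c = c),
      forall g h, pcomp (th g^-1%g) (pcomp (th g) (th h)) =
                  pcomp (th g^-1%g) (th (g * h)%g)
    & forall g h, pcomp (th g) (pcomp (th h) (th h^-1%g)) =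
                  pcomp (th (g * h)%g) (th h^-1%g)].

Definition central_projection (p : multiplier C) : Prop :=
  [/\ star p = p, p ⋅ p = p & forall T, p ⋅ T = T ⋅ p].

Definition corner (p : multiplier C) : set C := range (mulL p).

Definition disconnected_partial_action (p : G -> multiplier C)
    (theta : G -> C -> C) : Prop :=
  (forall g, central_projection (p g)) /\
  partial_action (fun g => corner (p g)) theta.

End PartialActions.

(* Main.v *)
Require Import Defs.
From mathcomp Require Import all_boot all_order all_algebra.
From mathcomp Require Import complex.
From mathcomp Require Import all_classical all_reals.
From mathcomp Require Import topology normedtype.

(* For any C*-tensor norm, C \otimes C_0(G) is the algebra C_0(G; C), so a multiplier
   of it is a bounded family (m_g) of multipliers of C and (id \otimes ev_g) reads off
   the g-th entry. Writing a_g(c) for the g-th entry of delta(c) and p_g for that of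
   delta(1), the coaction identity becomes a_g a_h = p_g a_{gh} and counitality becomes
   a_e = id. In particular a_g a_{g^-1} = p_g, which forces p_g to be central and a_g
   to restrict to an isomorphism p_{g^-1} C -> p_g C with inverse a_{g^-1}. Conversely
   c |-> theta_g(p_{g^-1} c) satisfies the same identities.

   The extensions to multiplier algebras that occur in the definitions exist and are
   unique because every C*-algebra has a bounded approximate unit and every
   *-homomorphism is bounded. Both are obtained without spectral theory from the
   inequality |z| <= |z + a^2 z| for self-adjoint a. *)

Set Implicit Arguments.
Unset Strict Implicit.
Unset Printing Implicit Defensive.

Import Order.TTheory GRing.Theory Num.Theory.
Import numFieldNormedType.Exports.

Local Open Scope classical_set_scope.
Local Open Scope ring_scope.

(** * Elementary C*-algebra inequalities *)

Section Scalars.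
Context {R : realType}.
Implicit Types x y e : R[i].

(** Every object in the statement (the extension of [delta], slices, [id ⊗ Delta], associativity,
    [S ⊗ T]) is picked by [xget], so nothing is known about it until something is shown to meet its
    description and the description is seen to leave no choice. Candidates are obtained by
    prescribing entries at the points of [G] or [G × G] under a bound uniform in the point.
    Uniqueness is checked on the summands at single points and spreads from there by density and
    strict continuity. Strict continuity is available on bounded sets only, hence norm bounds
    accompany every construction; their constants 2 and 4 are what the elementary arguments give,
    and any uniform constant serves. For the converse direction the obstacle is that the composition
    axioms equate partial maps: the information on domains has to be turned into an identity between
    everywhere defined maps. *)

Lemma complex_archi e : 0 < e -> exists n : nat, n.+1%:R^-1 <= e.
Proof.
move=> e0; have r0 : 0 < complex.Re e by move: e0; rewrite ltcE => /andP[].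
have [n /ltW] := ltr_add_invr r0.
rewrite add0r => h; exists n; rewrite -(RRe_real (gtr0_real e0)).
by rewrite -(rmorph_nat (real_complex R)) -fmorphV lecR.
Qed.

Lemma le_of_eps x y : (forall e, 0 < e -> x <= y + e) -> x <= y.
Proof.
(* The order on [R[i]] compares only numbers with equal imaginary parts; the instance [e = 1]
   already yields that equality. *)
case: x y => [a b] [c d] h; have := h 1 ltr01.
rewrite lecE /= addr0 => /andP[/eqP -> _]; rewrite lecE /= eqxx /=.
apply/ler_addgt0Pr => e e0; have := h e%:C%C; rewrite ltcR => /(_ e0).
by rewrite lecE => /andP[_].
Qed.

Lemma exprn_small (q e : R[i]) : 0 <= q -> q <= 2^-1 -> 0 < e -> exists n, q ^+ n <= e.
Proof.
move=> q0 q2 /complex_archi[n ne]; exists n.+1; apply: le_trans ne.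
apply: (@le_trans _ _ (2^-1 ^+ n.+1)); first by rewrite lerXn2r ?nnegrE ?invr_ge0 ?ler0n.
rewrite exprVn lef_pV2 ?posrE ?exprn_gt0// -natrX ler_nat.
exact: ltnW (ltn_expl _ _).
Qed.

(** The bound of a multiplier comes as an arbitrary complex number; its modulus is a bound as well,
    and is nonnegative. *)
Lemma le_normr_scale (V W : normedZmodType R[i]) (v : V) (w : W) (k : R[i]) :
  `|v| <= k * `|w| -> `|v| <= `|k| * `|w|.
Proof.
move=> h; rewrite -[`|w|]normr_id -normrM (le_trans h)//.
by rewrite real_ler_norm// ger0_real// (le_trans _ h).
Qed.

Lemma half_ge0 : 0 <= 2^-1 :> R[i]. Proof. by rewrite invr_ge0 ler0n. Qed.
Lemma half_le1 : 2^-1 <= 1 :> R[i]. Proof. by rewrite invf_le1 ?ltr0n// ler1n. Qed.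

Lemma half2 : 2^-1 + 2^-1 = 1 :> R[i].
Proof. by rewrite [RHS](splitr 1) !mul1r. Qed.

Lemma conji : Num.conj ('i%C : R[i]) = - 'i%C.
Proof. by apply/eqP; rewrite eq_complex /= oppr0 !eqxx. Qed.

End Scalars.

Section LinearFunctions.
Context {K : pzRingType} {V W : lmodType K}.
Variables (f : V -> W) (fl : linear f).

Lemma linfD x y : f (x + y) = f x + f y.
Proof. by have := fl 1 x y; rewrite !scale1r. Qed.
Lemma linf0 : f 0 = 0.
Proof. by apply: (@addrI _ (f 0)); rewrite -linfD !addr0. Qed.
Lemma linfZ a x : f (a *: x) = a *: f x.
Proof. by have := fl a x 0; rewrite !addr0 linf0 addr0. Qed.
Lemma linfN x : f (- x) = - f x.
Proof. by rewrite -scaleN1r linfZ scaleN1r. Qed.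
Lemma linfB x y : f (x - y) = f x - f y.
Proof. by rewrite linfD linfN. Qed.
Lemma linf_sum I (r : seq I) (P : pred I) F :
  f (\sum_(i <- r | P i) F i) = \sum_(i <- r | P i) f (F i).
Proof. by elim/big_rec2: _ => [|i y1 y2 _ <-]; rewrite ?linf0// linfD. Qed.
End LinearFunctions.

Section StarAlgebra.
Context {K : numClosedFieldType} {V : starAlgType K}.
Implicit Types x y z : V.

Lemma smul_linl z : linear (fun x => x ⋅ z).
Proof. by move=> a x y; rewrite smulDl. Qed.
Lemma smul_linr z : linear (fun x => z ⋅ x).
Proof. by move=> a x y; rewrite smulDr. Qed.
Lemma smul_addl x y z : (x + y) ⋅ z = x ⋅ z + y ⋅ z.
Proof. exact: (linfD (smul_linl z)). Qed.
Lemma smul_addr x y z : z ⋅ (x + y) = z ⋅ x + z ⋅ y.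
Proof. exact: (linfD (smul_linr z)). Qed.
Lemma smul_subl x y z : (x - y) ⋅ z = x ⋅ z - y ⋅ z.
Proof. exact: (linfB (smul_linl z)). Qed.
Lemma smul_subr x y z : z ⋅ (x - y) = z ⋅ x - z ⋅ y.
Proof. exact: (linfB (smul_linr z)). Qed.
Lemma smul_scalel a x z : (a *: x) ⋅ z = a *: (x ⋅ z).
Proof. exact: (linfZ (smul_linl z)). Qed.
Lemma smul_scaler a x z : z ⋅ (a *: x) = a *: (z ⋅ x).
Proof. exact: (linfZ (smul_linr z)). Qed.
Lemma smul_oppl x z : (- x) ⋅ z = - (x ⋅ z).
Proof. exact: (linfN (smul_linl z)). Qed.
Lemma smul_0l z : 0 ⋅ z = 0.
Proof. exact: (linf0 (smul_linl z)). Qed.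
Lemma smul_0r z : z ⋅ 0 = 0.
Proof. exact: (linf0 (smul_linr z)). Qed.

Lemma starD x y : star (x + y) = star x + star y.
Proof. by have := star_semilinear 1 x y; rewrite !scale1r rmorph1 scale1r. Qed.
Lemma star_0 : star (0 : V) = 0.
Proof. by apply: (@addrI _ (star 0)); rewrite -starD !addr0. Qed.
Lemma starZ a x : star (a *: x) = Num.conj a *: star x.
Proof. by have := star_semilinear a x 0; rewrite !addr0 star_0 addr0. Qed.
Lemma starN x : star (- x) = - star x.
Proof. by rewrite -scaleN1r starZ rmorphN1 scaleN1r. Qed.
Lemma starB x y : star (x - y) = star x - star y.
Proof. by rewrite starD starN. Qed.
End StarAlgebra.

Section CStarBasics.
Context {R : realType} {A : cstarType R}.
Implicit Types x y z a : A.

Lemma cstar_norm_r x : `|x ⋅ star x| = `|x| ^+ 2.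
Proof. by have := norm_star_smul (star x); rewrite starK norm_star. Qed.

Lemma cstar_eq0 x : star x ⋅ x = 0 -> x = 0.
Proof.
move=> h; have : `|x| ^+ 2 == 0 by rewrite -norm_star_smul h normr0.
by rewrite expf_eq0 /= normr_eq0 => /eqP.
Qed.

Lemma smul_faithfull x : (forall y, x ⋅ y = 0) -> x = 0.
Proof.
move=> h; have : star (star x) ⋅ star x = 0 by rewrite starK h.
by move=> /cstar_eq0 e; rewrite -(starK x) e star0.
Qed.

Lemma smul_faithfulr x : (forall y, y ⋅ x = 0) -> x = 0.
Proof. by move=> h; apply: cstar_eq0. Qed.

Lemma smul_eql x y : (forall z, x ⋅ z = y ⋅ z) -> x = y.
Proof.
move=> h; apply/eqP; rewrite -subr_eq0; apply/eqP/smul_faithfull => z.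
by rewrite smul_subl h subrr.
Qed.

(** Testing against [star x] gives [|x|^2 <= k |x|] by the C*-identity. *)
Lemma norm_le_mull (k : R[i]) x : 0 <= k ->
  (forall y, `|x ⋅ y| <= k * `|y|) -> `|x| <= k.
Proof.
move=> k0 h; have [->|x0] := eqVneq x 0; first by rewrite normr0.
rewrite -(ler_pM2r (_ : 0 < `|x|)) ?normr_gt0// -expr2 -cstar_norm_r.
by rewrite -[X in _ * X]norm_star.
Qed.

Lemma norm_sqr_le (k : R[i]) x : 0 <= k -> `|star x ⋅ x| <= k ^+ 2 -> `|x| <= k.
Proof. by move=> k0; rewrite norm_star_smul ler_pXn2r// nnegrE. Qed.

(* [z + i a z] and [z - i a z] have the same norm by the C*-identity, and their
   sum is [2 z]. *)
Lemma norm_resolvent a z : star a = a -> `|z| <= `|z + 'i%C *: (a ⋅ z)|.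
Proof.
move=> sa.
have e : `|z - 'i%C *: (a ⋅ z)| = `|z + 'i%C *: (a ⋅ z)|.
  apply/eqP; rewrite -(@eqrXn2 _ 2) ?normr_ge0// -!norm_star_smul.
  rewrite starB starD !starZ conji !star_smul sa !scaleNr opprK.
  rewrite !smul_subl !smul_subr !smul_addl !smul_addr !smul_scalel !smul_scaler.
  rewrite !smulA; apply/eqP; congr (`| _ |).
rewrite -(ler_pM2l (_ : 0 < 2))// -[leLHS](ger0_norm (_ : 0 <= 2 * `|z|)) ?mulr_ge0//.
rewrite ger0_norm ?mulr_ge0// -{1}(ger0_norm (_ : 0 <= 2 :> R[i]))// -normrZ.
rewrite [_ *: z](_ : _ = (z + 'i%C *: (a ⋅ z)) + (z - 'i%C *: (a ⋅ z))); last first.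
  by rewrite addrACA subrr addr0 scaler_nat mulr2n.
by rewrite (le_trans (ler_normD _ _))// e mulr_natl mulr2n.
Qed.

(** [1 + a^2] factors as [(1 - i a)(1 + i a)], and [norm_resolvent] applies to [a] and to [- a]. *)
Lemma norm_accretive a z : star a = a -> `|z| <= `|z + a ⋅ (a ⋅ z)|.
Proof.
move=> sa; apply: le_trans (norm_resolvent z sa) _.
have sNa : star (- a) = - a by rewrite starN sa.
apply: le_trans (norm_resolvent _ sNa) _.
rewrite !smul_oppl smul_addr smul_scaler opprD scalerDr !scalerN scalerA.
by rewrite -expr2 sqr_i scaleN1r opprK addrA addrK.
Qed.

(* With [b = a^2], [|(1 - b) z| <= |(1 + b)(1 - b) z| = |(1 - b^2) z|] by
   [norm_accretive]; now replace [a] by [b] and iterate. *)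
Lemma norm_one_sub_sqr a z : star a = a -> `|a| <= 2^-1 ->
  `|z - a ⋅ (a ⋅ z)| <= `|z|.
Proof.
move=> sa a2.
have step k : forall b y, star b = b -> `|b| <= 2^-1 ->
    `|y - b ⋅ (b ⋅ y)| <= (1 + `|b| ^+ (2 ^ k.+1)) * `|y|.
  elim: k => [|k IH] b y sb b2.
    rewrite (le_trans (ler_normB _ _))// mulrDl mul1r lerD2l expn1 smulA.
    by rewrite (le_trans (norm_smul_le _ _))// ler_wpM2r// expr2 norm_smul_le.
  have sbb : star (b ⋅ b) = b ⋅ b by rewrite star_smul sb.
  have nbb : `|b ⋅ b| <= `|b| ^+ 2 by rewrite expr2 norm_smul_le.
  apply: le_trans (norm_accretive _ sb) _.
  have -> : y - b ⋅ (b ⋅ y) + b ⋅ (b ⋅ (y - b ⋅ (b ⋅ y)))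
     = y - (b ⋅ b) ⋅ ((b ⋅ b) ⋅ y).
    by rewrite !smul_subr !smulA addrA subrK.
  apply: le_trans (IH _ _ sbb _) _.
    rewrite (le_trans nbb)// expr2 (le_trans (_ : _ <= 2^-1 * 2^-1))//.
      by rewrite ler_pM.
    by rewrite ler_piMl ?half_ge0 ?half_le1.
  rewrite ler_wpM2r// lerD2l [in leRHS]expnS exprM lerXn2r// ?nnegrE//.
  by rewrite exprn_ge0.
(* Let [k] tend to infinity in [step]: since [|a| <= 1/2], the excess [|a| ^+ (2 ^ k.+1)] tends to
   0. *)
apply: le_of_eps => e e0; have [z0|z0] := eqVneq `|z| 0.
  have := step 0 a z sa a2; rewrite z0 mulr0 => h.
  by rewrite (le_trans h)// add0r ltW.
have zp : 0 < `|z| by rewrite lt_def z0 normr_ge0.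
have [n Hn] := exprn_small (normr_ge0 a) a2 (divr_gt0 e0 zp).
apply: le_trans (step n a z sa a2) _.
rewrite mulrDl mul1r lerD2l -ler_pdivlMr//; apply: le_trans Hn.
rewrite ler_wiXn2l//; last by rewrite (leq_trans _ (ltnW (ltn_expl _ _))).
by rewrite (le_trans a2) ?half_le1.
Qed.

End CStarBasics.

(** * Approximate units *)

Section ApproximateIdentity.
Context {R : realType} {A : cstarType R}.
Implicit Types x y z a u : A.

(* [E] is [1 - (1/n) \sum_(k < n) (1 - a^2)^k]: since [1 - a^2] is a
   contraction, the mean telescopes against [a^2]. *)
Lemma ergodic_mean a n : star a = a -> `|a| <= 2^-1 ->
  exists E : A, [/\ star E = E, a ⋅ E = E ⋅ a, `|E| <= 2
    & forall z, `|(a ⋅ a) ⋅ (z - E ⋅ z)| <= 2 / n.+1%:R * `|z|].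
Proof.
move=> sa a2; pose b := a ⋅ a.
(* [r k] is [1 - (1 - b)^k], expanded recursively because [A] may have no unit. *)
pose r := fix r k : A := if k is k'.+1 then b + r k' - b ⋅ r k' else 0.
have rS k : r k.+1 = b + r k - b ⋅ r k by [].
have ar k : a ⋅ r k = r k ⋅ a.
  elim: k => [|k IH]; first by rewrite /= smul_0l smul_0r.
  rewrite rS smul_subr smul_subl smul_addr smul_addl IH /b !smulA.
  by rewrite -(smulA (a ⋅ a) (r k) a) -IH !smulA.
have br k : b ⋅ r k = r k ⋅ b by rewrite /b -smulA ar smulA ar smulA.
have sb : star b = b by rewrite star_smul sa.
have sr k : star (r k) = r k.
  elim: k => [|k IH]; first exact: star_0.
  by rewrite rS starB starD star_smul IH sb br.
have rz k z : z - r k.+1 ⋅ z = (z - r k ⋅ z) - b ⋅ (z - r k ⋅ z).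
  rewrite rS smul_subl smul_addl smul_subr smulA !opprB opprD [RHS]addrACA addrA.
  by rewrite [RHS]addrAC !addrA.
have r1 k z : `|z - r k ⋅ z| <= `|z|.
  elim: k => [|k IH]; first by rewrite /= smul_0l subr0.
  by rewrite rz (le_trans _ IH)// /b -smulA norm_one_sub_sqr.
have r2 k z : `|r k ⋅ z| <= 2 * `|z|.
  rewrite -[r k ⋅ z](subKr z) (le_trans (ler_normB _ _))// mulr_natl mulr2n.
  by rewrite lerD2l.
have tele k z : \sum_(i < k) b ⋅ (z - r i ⋅ z) = r k ⋅ z.
  elim: k => [|k IH]; first by rewrite big_ord0 smul_0l.
  by rewrite big_ord_recr IH -[RHS](subKr z) rz opprB addrCA subKr addrC.
have n0 : n.+1%:R != 0 :> R[i] by rewrite pnatr_eq0.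
have nE : `|n.+1%:R^-1 : R[i]| = n.+1%:R^-1 by rewrite ger0_norm ?invr_ge0 ?ler0n.
pose E := n.+1%:R^-1 *: \sum_(k < n.+1) r k.
have zE z : z - E ⋅ z = n.+1%:R^-1 *: \sum_(k < n.+1) (z - r k ⋅ z).
  rewrite sumrB sumr_const card_ord -[z *+ _]scaler_nat scalerBr scalerA mulVf// scale1r.
  by rewrite smul_scalel (linf_sum (smul_linl z)).
have E1 z : `|z - E ⋅ z| <= `|z|.
  rewrite zE normrZ nE mulrC ler_pdivrMr ?ltr0n// (le_trans (ler_norm_sum _ _ _))//.
  apply: le_trans (ler_sum _ (fun (i : 'I_n.+1) _ => r1 i z)) _.
  by rewrite sumr_const card_ord mulr_natr.
exists E; split.
- rewrite starZ; congr (_ *: _).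
    by rewrite fmorphV /= rmorph_nat.
  have sl : forall s : seq 'I_n.+1, star (\sum_(k <- s) r k) = \sum_(k <- s) r k.
    by elim=> [|k s IH]; rewrite ?big_nil ?star_0// !big_cons starD IH sr.
  exact: sl.
- rewrite smul_scalel smul_scaler (linf_sum (smul_linl a)) (linf_sum (smul_linr a)).
  by congr (_ *: _); apply: eq_bigr => k _; rewrite ar.
- apply: norm_le_mull => [|z]; first exact: ler0n.
  rewrite -[E ⋅ z](subKr z) (le_trans (ler_normB _ _))// mulr_natl mulr2n.
  by rewrite lerD2l.
move=> z; rewrite zE smul_scaler (linf_sum (smul_linr _)) tele normrZ nE.
by rewrite [leRHS]mulrAC [leRHS]mulrC ler_wpM2l// invr_ge0 ler0n.
Qed.

(** Scale [x ⋅ star x] to an [a] with [|a| <= 1/2]. The [E] of [ergodic_mean] nearly fixes [a^2],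
    hence [a] by the C*-identity, hence [x] by the C*-identity once more. *)
Lemma approx_unit_one x (e : R[i]) : 0 < e ->
  exists u, [/\ star u = u, `|u| <= 2 & `|x - u ⋅ x| <= e].
Proof.
(* This gives [t |x|^2 <= 1/2]; the summand 1 keeps the denominator positive when [x = 0]. *)
move=> e0; pose t : R[i] := (2 * (`|x| ^+ 2 + 1))^-1.
have t1 : 0 < `|x| ^+ 2 + 1 by rewrite ltr_wpDl ?exprn_ge0.
have t0 : 0 < t by rewrite invr_gt0 mulr_gt0// ltr0n.
pose a := t *: (x ⋅ star x).
have tr : Num.conj t = t by rewrite conj_Creal// ger0_real// ltW.
have sa : star a = a by rewrite starZ tr star_smul starK.
have a2 : `|a| <= 2^-1.
  rewrite normrZ cstar_norm_r ger0_norm ?(ltW t0)// /t invfM -mulrA.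
  rewrite ler_piMr ?half_ge0// mulrC ler_pdivrMr// mul1r.
  by rewrite lerDl.
(* [h] will bound [|a - E a|]. Multiplying by [1 - E] on the right costs a factor 3, so
   [3 h / t = e^2] bounds [|x - E x|^2], and [|a - E a|^2 <= 3 * 2 / n.+1] asks for
   [1 / n.+1 <= h^2 / 6]. *)
pose h := e ^+ 2 * t / 3.
have h0 : 0 < h by rewrite divr_gt0 ?ltr0n// mulr_gt0// exprn_gt0.
have h60 : 0 < h ^+ 2 / 6 by rewrite divr_gt0 ?ltr0n// exprn_gt0.
have [n nh] := complex_archi h60.
have [E [sE aE E2 Ea]] := ergodic_mean n sa a2.
pose y := a - E ⋅ a.
have ya : y = a - a ⋅ E by rewrite /y aE.
have mE z : `|z - z ⋅ E| <= 3 * `|z|.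
  rewrite (le_trans (ler_normB _ _))// -[3%:R]/(1 + 2)%:R natrD mulrDl mul1r lerD2l.
  by rewrite mulrC (le_trans (norm_smul_le _ _))// ler_wpM2l.
pose q := a ⋅ a - (a ⋅ a) ⋅ E.
have q2 : `|q| <= 2 / n.+1%:R.
  apply: norm_le_mull => [|z]; first by rewrite divr_ge0 ?ler0n.
  by rewrite /q smul_subl -(smulA _ E z) -smul_subr.
have yh : `|y| <= h.
  apply: norm_sqr_le; first exact: ltW.
  have -> : star y ⋅ y = q - q ⋅ E.
    rewrite {1}ya starB star_smul sa sE -/y ya /q.
    have aEa : a ⋅ E ⋅ a = a ⋅ a ⋅ E by rewrite -smulA -aE smulA.
    by rewrite !smul_subl !smul_subr !smulA aEa.
  apply: (le_trans (mE _)).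
  apply: (@le_trans _ _ (3 * (2 / n.+1%:R))); first by rewrite ler_wpM2l ?ler0n.
  by rewrite mulrA -natrM mulrC -ler_pdivlMr ?ltr0n.
exists E; split=> //; rewrite -(ler_pXn2r (_ : 0 < 2)%N) ?nnegrE ?(ltW e0)//.
rewrite -cstar_norm_r.
have -> : (x - E ⋅ x) ⋅ star (x - E ⋅ x) = t^-1 *: (y - y ⋅ E).
  have -> : y = t *: ((x - E ⋅ x) ⋅ star x).
    by rewrite /y /a smul_scaler -scalerBr smul_subl smulA.
  rewrite smul_scalel -scalerBr scalerA mulVf ?gt_eqF// scale1r.
  by rewrite starB star_smul sE smul_subr smulA.
have tV0 : 0 < t^-1 by rewrite invr_gt0.
rewrite normrZ gtr0_norm// mulrC ler_pdivrMr//.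
rewrite (le_trans (mE _))// -ler_pdivlMl ?ltr0n// mulrC.
by rewrite (le_trans yh).
Qed.

(* Iterating [approx_unit_one] gives [w] with [w x] close to [x] for all [x \in s],
   but of uncontrolled norm; then an approximate unit for [w] itself works. *)
Lemma approx_unit_seq (s : seq A) (e : R[i]) : 0 < e ->
  exists u, [/\ star u = u, `|u| <= 2 & forall x, x \in s -> `|x - u ⋅ x| <= e].
Proof.
move=> e0.
have [w wP] : exists w, forall x, x \in s -> `|x - w ⋅ x| <= e / 4.
  have : 0 < e / 4 by rewrite divr_gt0 ?ltr0n.
  elim: s (e / 4) => [|x s IH] d d0; first by exists 0.
  (* The new element is [1 - (1 - v)(1 - w)]: [v] repairs the error that [w] leaves at [x], while
     the elements of [s] lose at most the factor [|1 - v| <= 3], which the tolerance [d / 3]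
     absorbs. *)
  have [w wP] := IH (d / 3) (divr_gt0 d0 (ltr0n _ 3)).
  have [v [_ v2 vP]] := approx_unit_one (x - w ⋅ x) d0.
  exists (w + v - v ⋅ w) => y.
  have -> : y - (w + v - v ⋅ w) ⋅ y = (y - w ⋅ y) - v ⋅ (y - w ⋅ y).
    by rewrite smul_subl smul_addl smul_subr smulA -[w ⋅ y + _ - _]addrA opprD addrA.
  rewrite inE => /orP[/eqP ->//|/wP ys].
  rewrite (le_trans (ler_normB _ _))//.
  apply: (@le_trans _ _ (3 * `|y - w ⋅ y|)).
    rewrite -[3%:R]/(1 + 2)%:R natrD mulrDl mul1r lerD2l.
    by rewrite (le_trans (norm_smul_le _ _))// ler_wpM2r.
  by rewrite mulrC -ler_pdivlMr ?ltr0n.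
pose M := 1 + \sum_(x <- s) `|x|.
have M0 : 0 < M by rewrite ltr_wpDr ?sumr_ge0// => i _; exact: normr_ge0.
have eM : 0 < e / 4 / M by rewrite !divr_gt0 ?ltr0n.
have [u [su u2 uw]] := approx_unit_one w eM.
exists u; split=> // x xs.
have xM : `|x| <= M.
  by rewrite ler_wpDl// (big_rem _ xs)/= lerDl sumr_ge0// => i _; exact: normr_ge0.
(* The three terms cost [e / 4], [e / 4] and [2 * (e / 4)]. *)
have -> : x - u ⋅ x = (x - w ⋅ x) + (w - u ⋅ w) ⋅ x - u ⋅ (x - w ⋅ x).
  rewrite smul_subl smul_subr smulA.
  by rewrite addrA subrK opprB addrA subrK.
have e4 : e / 4 = e / 2 / 2 by rewrite -mulrA -invfM -natrM.
rewrite (splitr e) (le_trans (ler_normB _ _))// lerD//.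
  rewrite [leRHS]splitr.
  rewrite -e4.
  rewrite (le_trans (ler_normD _ _))// lerD ?wP//.
  rewrite (le_trans (norm_smul_le _ _))//.
  rewrite (le_trans (ler_pM _ _ uw xM))//.
  by rewrite divfK// gt_eqF.
rewrite (le_trans (norm_smul_le _ _))// (le_trans (ler_pM _ _ u2 (wP _ xs)))//.
by rewrite e4 mulrC divfK ?pnatr_eq0.
Qed.

(** Basic sets of the approximate unit, seen as a filter: the index is a finite list of elements
    with a tolerance. The bound 2 is the one from [ergodic_mean]. *)
Definition approx_unit_set (p : seq A * R[i]) : set A :=
  [set u | [/\ `|u| <= 2, forall x, x \in p.1 -> `|x - u ⋅ x| <= p.2
         & forall x, x \in p.1 -> `|x - x ⋅ u| <= p.2]].

Definition approx_unit : set_system A :=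
  filter_from [set p : seq A * R[i] | 0 < p.2] approx_unit_set.

Global Instance approx_unit_filter : ProperFilter approx_unit.
Proof.
apply: filter_from_proper; last first.
  (* As [u] is self-adjoint, approximating [star x] from the left approximates [x] from the
     right. *)
  move=> -[s e] /= e0; have [u [su u2 uP]] := approx_unit_seq (s ++ map star s) e0.
  exists u; split=> // x xs; first by rewrite uP// mem_cat xs.
  rewrite -norm_star starB star_smul su uP// mem_cat; apply/orP; right.
  exact: map_f.
apply: filter_from_filter; first by exists ([::], 1) => /=.
move=> -[s e] [s' e'] /= e0 e'0; exists (s ++ s', Num.min e e').
  by rewrite /= /Num.min; case: ifP.
have me : Num.min e e' <= e.
  by rewrite /Num.min; case: ifPn => // h; rewrite real_leNgt ?gtr0_real.
have me' : Num.min e e' <= e' by rewrite /Num.min; case: ifPn => // /ltW.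
move=> u /= [u2 ul ur]; split; split=> // x xs.
- by apply: le_trans me; apply: ul; rewrite mem_cat xs.
- by apply: le_trans me; apply: ur; rewrite mem_cat xs.
- by apply: le_trans me'; apply: ul; rewrite mem_cat xs orbT.
- by apply: le_trans me'; apply: ur; rewrite mem_cat xs orbT.
Qed.

Lemma approx_unit_bound : approx_unit [set u | `|u| <= 2].
Proof. by exists ([::], 1) => //= u []. Qed.

Lemma approx_unit_cvgl x : u ⋅ x @[u --> approx_unit] --> x.
Proof.
apply/cvgrPdist_le => e e0; exists ([:: x], e) => //= u [_ h _].
by apply: h; rewrite inE.
Qed.

Lemma approx_unit_cvgr x : x ⋅ u @[u --> approx_unit] --> x.
Proof.
apply/cvgrPdist_le => e e0; exists ([:: x], e) => //= u [_ _ h].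
by apply: h; rewrite inE.
Qed.

End ApproximateIdentity.

(** * Boundedness of *-homomorphisms into multiplier algebras *)

Section Convergence.
Context {R : realType}.
Local Notation K := R[i].

Lemma cvg_of_dist_le (V W : normedModType K) T (F : set_system T) {FF : Filter F}
    (h : T -> V) (l : V) (h' : T -> W) (l' : W) (k : K) :
  h' t @[t --> F] --> l' -> (\forall t \near F, `|l - h t| <= k * `|l' - h' t|) ->
  h t @[t --> F] --> l.
Proof.
move=> /cvgrPdist_le hl' hb; apply/cvgrPdist_le => e e0.
have k1 : 0 < `|k| + 1 by rewrite ltr_wpDl.
have := hl' _ (divr_gt0 e0 k1); apply: filterS2 hb => t hb hd.
apply: (@le_trans _ _ (`|k| * `|l' - h' t|)).
  exact: le_normr_scale.
rewrite (le_trans (ler_wpM2l _ hd))// mulrCA ler_piMr ?ltW//.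
by rewrite ltr_pdivrMr// mul1r ltrDl.
Qed.

Lemma linear_cvg (V W : normedModType K) (f : V -> W) (k : K) T (F : set_system T)
    {FF : Filter F} (h : T -> V) (l : V) :
  linear f -> (forall x, `|f x| <= k * `|x|) ->
  h t @[t --> F] --> l -> f (h t) @[t --> F] --> f l.
Proof.
move=> fl fk hl; apply: (cvg_of_dist_le (k := k) hl).
by apply: nearW => t; rewrite -linfB.
Qed.

Lemma cvg_add (V : normedModType K) T (F : set_system T) {FF : Filter F}
    (f g : T -> V) (a b : V) :
  f t @[t --> F] --> a -> g t @[t --> F] --> b -> f t + g t @[t --> F] --> a + b.
Proof. by move=> fa gb; exact: (cvgD fa gb). Qed.

Lemma cvg_uniq (V : normedModType K) T (F : set_system T) {FF : ProperFilter F}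
    (h : T -> V) (l l' : V) :
  h t @[t --> F] --> l -> h t @[t --> F] --> l' -> l = l'.
Proof. exact: (cvg_unique (@norm_hausdorff _ V)). Qed.

Lemma cvg_norm_le (V : normedModType K) T (F : set_system T) {FF : ProperFilter F}
    (h : T -> V) (l : V) (k : K) :
  (\forall t \near F, `|h t| <= k) -> h t @[t --> F] --> l -> `|l| <= k.
Proof.
move=> hk /cvgrPdist_le hl; apply: le_of_eps => e /hl he.
have [t [h1 h2]] := filter_ex (filterI hk he).
by rewrite -[l](subrK (h t)) (le_trans (ler_normD _ _))// addrC lerD.
Qed.

Lemma cauchy_map_cvg (V : completeNormedModType K) T (F : set_system T)
    {FF : ProperFilter F} (h : T -> V) :
  (forall e, 0 < e -> exists x, \forall t \near F, `|x - h t| <= e) ->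
  exists l : V, h t @[t --> F] --> l.
Proof.
move=> hc; suff : cvg (h t @[t --> F]) by move=> /cvg_ex.
apply: cauchy_cvg; apply: cauchy_exP => e e0.
have [x hx] := hc _ (divr_gt0 e0 (ltr0n _ 2)).
exists x; apply: filterS hx => t; rewrite -ball_normE /= => /le_lt_trans; apply.
by rewrite ltr_pdivrMr ?ltr0n// ltr_pMr// ltr1n.
Qed.

Lemma geometric_cvg (V : completeNormedModType K) (u : nat -> V) :
  (forall n, `|u n.+1 - u n| <= 2^-1 ^+ n) -> exists l : V, u n @[n --> \oo] --> l.
Proof.
move=> hu; apply: cauchy_map_cvg => e e0.
have [N hN] := exprn_small half_ge0 (lexx _) (divr_gt0 e0 (ltr0n _ 2)).
exists (u N); exists N => //= n Nn; rewrite -(subnKC Nn) distrC.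
(* The right-hand side is the exact sum of the geometric bounds from [N] to [N + k - 1], which lets
   the induction close. *)
have h k : `|u (N + k)%N - u N| <= 2 * 2^-1 ^+ N - 2^-1 ^+ (N + k) * 2.
  elim: k => [|k IH]; first by rewrite addn0 subrr normr0 mulrC subrr.
  rewrite addnS -[X in `|X|](subrKA (u (N + k)%N)) (le_trans (ler_normD _ _))//.
  rewrite (le_trans (lerD (hu _) IH))// exprSr mulfVK ?pnatr_eq0//.
  by rewrite mulrDr mulr1 opprD !addrA addrC addrA addKr.
apply: le_trans (h _) _; rewrite (@le_trans _ _ (2 * 2^-1 ^+ N))//.
  by rewrite gerBl mulr_ge0// exprn_ge0 ?half_ge0.
by rewrite mulrC -ler_pdivlMr ?ltr0n.
Qed.

Lemma star_cvg (A : cstarType R) T (F : set_system T) {FF : Filter F}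
    (h : T -> A) (l : A) :
  h t @[t --> F] --> l -> star (h t) @[t --> F] --> star l.
Proof.
move=> hl; apply: (cvg_of_dist_le (k := 1) hl).
by apply: nearW => t; rewrite -starB norm_star mul1r.
Qed.

Lemma smul_cvgl (A : cstarType R) T (F : set_system T) {FF : Filter F}
    (h : T -> A) (l x : A) :
  h t @[t --> F] --> l -> h t ⋅ x @[t --> F] --> l ⋅ x.
Proof.
move=> hl; apply: (@linear_cvg A A (fun y => y ⋅ x) `|x| _ _ _ _ _ (smul_linl x) _ hl).
by move=> y; rewrite mulrC norm_smul_le.
Qed.

Lemma smul_cvgr (A : cstarType R) T (F : set_system T) {FF : Filter F}
    (h : T -> A) (l x : A) :
  h t @[t --> F] --> l -> x ⋅ h t @[t --> F] --> x ⋅ l.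
Proof.
move=> hl; apply: (@linear_cvg A A (fun y => x ⋅ y) `|x| _ _ _ _ _ (smul_linr x) _ hl).
by move=> y; rewrite norm_smul_le.
Qed.

End Convergence.

Section MultiplierAlgebra.
Context {R : realType} {A : cstarType R}.
Implicit Types (S T : multiplier A) (x y : A).

Lemma mulLD S T x : mulL (S + T) x = mulL S x + mulL T x.
Proof. by rewrite -[LHS]/(1 *: mulL S x + mulL T x) scale1r. Qed.
Lemma mulRD S T x : mulR (S + T) x = mulR S x + mulR T x.
Proof. by rewrite -[LHS]/(1 *: mulR S x + mulR T x) scale1r. Qed.
Lemma mulLZ c T x : mulL (c *: T) x = c *: mulL T x.
Proof. by rewrite -[LHS]/(c *: mulL T x + 0) addr0. Qed.
Lemma mulRZ c T x : mulR (c *: T) x = c *: mulR T x.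
Proof. by rewrite -[LHS]/(c *: mulR T x + 0) addr0. Qed.
Lemma mulLN T x : mulL (- T) x = - mulL T x.
Proof. by rewrite -scaleN1r mulLZ scaleN1r. Qed.
Lemma mulRN T x : mulR (- T) x = - mulR T x.
Proof. by rewrite -scaleN1r mulRZ scaleN1r. Qed.
Lemma mulLM S T x : mulL (S ⋅ T) x = mulL S (mulL T x). Proof. by []. Qed.
Lemma mulL_star T x : mulL (star T) x = star (mulR T (star x)). Proof. by []. Qed.
Lemma mulR_star T x : mulR (star T) x = star (mulL T (star x)). Proof. by []. Qed.
Lemma smul_mone T : T ⋅ mone = T. Proof. exact: multiplierP. Qed.
Lemma mone_smul T : mone ⋅ T = T. Proof. exact: multiplierP. Qed.
Lemma star_mone : star (mone : multiplier A) = mone.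
Proof. by apply: multiplierP => x /=; rewrite starK. Qed.

(** The left centralizer determines the right one through [mulRL], because [A] acts faithfully on
    itself. *)
Lemma multiplier_eqL S T : mulL S =1 mulL T -> S = T.
Proof.
move=> e; apply: multiplierP => // x; apply: smul_eql => y.
by rewrite !mulRL e.
Qed.

Lemma embM_inj : injective (@embM R A).
Proof.
move=> x y /(congr1 (@mulL _ _)) /= e; apply: smul_eql => z.
by rewrite (congr1 (@^~ z) e).
Qed.

Lemma embM_starhom : starhom (@embM R A).
Proof.
split=> [c x y|x y|x]; apply: multiplier_eqL => z.
- by rewrite mulLD mulLZ /= smulDl.
- by rewrite /= smulA.
- by rewrite /= star_smul starK.
Qed.

Lemma smul_embM T x : T ⋅ embM x = embM (mulL T x).
Proof. by apply: multiplier_eqL => y /=; rewrite mulL_smul. Qed.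
Lemma mulL_bd T : exists2 k : R[i], 0 <= k & forall x, `|mulL T x| <= k * `|x|.
Proof.
have [M HM] := mulL_bounded T; exists `|M| => // x.
exact: le_normr_scale.
Qed.

Lemma mulR_bd_of T (k : R[i]) : 0 <= k -> (forall x, `|mulL T x| <= k * `|x|) ->
  forall x, `|mulR T x| <= k * `|x|.
Proof.
move=> k0 hk x; apply: norm_le_mull => [|y]; first by rewrite mulr_ge0.
rewrite mulRL (le_trans (norm_smul_le _ _))// [k * _]mulrC -mulrA.
by rewrite ler_wpM2l.
Qed.

Lemma mulL_sqr T y : `|mulL T y| ^+ 2 = `|star y ⋅ mulL (star T ⋅ T) y|.
Proof.
by rewrite -norm_star_smul mulLM -mulRL mulR_star starK.
Qed.

Lemma unitary_mulL T y : star T ⋅ T = mone -> `|mulL T y| = `|y|.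
Proof.
move=> e; apply/eqP; rewrite -(@eqrXn2 _ 2) ?normr_ge0// mulL_sqr e /=.
by rewrite norm_star_smul.
Qed.

(* [S + i T] and its adjoint are isometries, with mean [S]. *)
Lemma unitary_re S T y : star S = S -> star T = T -> S ⋅ T = T ⋅ S ->
  S ⋅ S + T ⋅ T = mone -> `|mulL S y| <= `|y|.
Proof.
move=> sS sT cST e1.
pose U := S + 'i%C *: T; pose V := S - 'i%C *: T.
have sU : star U = V by rewrite starD starZ sS sT conji scaleNr.
have sV : star V = U by rewrite -sU starK.
have ii : 'i%C * 'i%C = -1 :> R[i] by rewrite -expr2 sqr_i.
have UV : U ⋅ V = mone.
  rewrite smul_addl !smul_subr !smul_scalel !smul_scaler cST scalerA ii scaleN1r.
  by rewrite opprK addrA subrK.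
have VU : V ⋅ U = mone.
  rewrite smul_subl !smul_addr !smul_scalel !smul_scaler cST scalerA ii scaleN1r.
  by rewrite opprD opprK addrA addrK.
have nU : `|mulL U y| = `|y| by rewrite unitary_mulL// sU.
have nV : `|mulL V y| = `|y| by rewrite unitary_mulL// sV.
have := ler_normD (mulL U y) (mulL V y).
by rewrite nU nV !mulLD addrACA mulLN subrr addr0 -!mulr2n normrMn lerMn2r.
Qed.

End MultiplierAlgebra.

Section HomBounded.
Context {R : realType} {A B : cstarType R}.

(* [1 - v] is a square root of [1 - a^2]. *)
Lemma sqrt_one_sub_sqr (a : A) : star a = a -> `|a| <= 2^-1 ->
  exists v, [/\ star v = v, a ⋅ v = v ⋅ a & v + v = a ⋅ a + v ⋅ v].
Proof.
move=> sa a2; have h0 := half_ge0 (R := R).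
have q4 : 2^-1 * 2^-1 + 2^-1 * 2^-1 = 2^-1 :> R[i].
  by rewrite -mulrDl half2 mul1r.
have n2 : `|2^-1 : R[i]| = 2^-1 by rewrite ger0_norm.
(* Fixed point iteration for [v = (a^2 + v^2) / 2], that is [(1 - v)^2 = 1 - a^2]. The iterates stay
   in the ball of radius [1/2], where each step halves the distance of consecutive iterates. *)
pose w := fix w n : A := if n is n'.+1 then 2^-1 *: (a ⋅ a + w n' ⋅ w n') else 0.
have wS n : w n.+1 = 2^-1 *: (a ⋅ a + w n ⋅ w n) by [].
have w2 n : `|w n| <= 2^-1.
  elim: n => [|n IH]; first by rewrite normr0.
  rewrite wS normrZ n2 ler_piMr// (le_trans (ler_normD _ _))//.
  rewrite (@le_trans _ _ 2^-1) ?half_le1// -q4 lerD//.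
    by rewrite (le_trans (norm_smul_le _ _))// ler_pM.
  by rewrite (le_trans (norm_smul_le _ _))// ler_pM.
have sw n : star (w n) = w n.
  elim: n => [|n IH]; first exact: star_0.
  by rewrite wS starZ starD !star_smul IH sa fmorphV /= rmorph_nat.
have aw n : a ⋅ w n = w n ⋅ a.
  elim: n => [|n IH]; first by rewrite /= smul_0l smul_0r.
  rewrite wS smul_scaler smul_scalel smul_addl smul_addr; congr (_ *: (_ + _)).
    by rewrite smulA.
  by rewrite smulA IH -smulA IH smulA.
have dw n : `|w n.+1 - w n| <= 2^-1 ^+ n.
  elim: n => [|n IH].
    by rewrite subr0 (le_trans (w2 _)) ?half_le1.
  rewrite (wS n.+1) {2}(wS n) -scalerBr opprD addrACA subrr add0r normrZ n2 exprS.
  rewrite ler_wpM2l//.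
  have -> : w n.+1 ⋅ w n.+1 - w n ⋅ w n =
      w n.+1 ⋅ (w n.+1 - w n) + (w n.+1 - w n) ⋅ w n.
    by rewrite smul_subr smul_subl addrA subrK.
  rewrite (le_trans (ler_normD _ _))//.
  apply: (@le_trans _ _ (2^-1 * `|w n.+1 - w n| + `|w n.+1 - w n| * 2^-1)).
    rewrite lerD// (le_trans (norm_smul_le _ _))//.
      by rewrite ler_wpM2r.
    by rewrite ler_wpM2l.
  rewrite [_ * 2^-1]mulrC -mulrDl half2 mul1r//.
have [v wv] := geometric_cvg dw.
exists v; split.
- apply: (cvg_uniq (star_cvg wv)); rewrite (_ : (fun n => _) = w)//.
  exact/funext.
- apply: (cvg_uniq (smul_cvgr (x := a) wv)).
  rewrite (_ : (fun n => _) = (fun n => w n ⋅ a)); last exact/funext.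
  exact: smul_cvgl.
have wSv : w n.+1 @[n --> \oo] --> v.
  by move=> P /wv [N _ hN]; exists N => // n /= Nn; apply: (hN n.+1); exact: leqW.
apply: (cvg_uniq (cvg_add wSv wSv)).
rewrite (_ : (fun n => _) = (fun n => a ⋅ a + w n ⋅ w n)); last first.
  by apply/funext => n; rewrite wS -scalerDl half2 scale1r.
have kv : `|v| <= 2^-1 by apply: (cvg_norm_le _ wv); apply: nearW.
suff wwv : w n ⋅ w n @[n --> \oo] --> v ⋅ v by exact: cvg_add (cvg_cst _) wwv.
apply: (cvg_of_dist_le (k := 1) wv); apply: nearW => n.
have -> : v ⋅ v - w n ⋅ w n = v ⋅ (v - w n) + (v - w n) ⋅ w n.
  by rewrite smul_subr smul_subl addrA subrK.
rewrite (le_trans (ler_normD _ _))//.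
apply: (@le_trans _ _ (2^-1 * `|v - w n| + `|v - w n| * 2^-1)).
  rewrite lerD// (le_trans (norm_smul_le _ _))//.
    by rewrite ler_wpM2r.
  by rewrite ler_wpM2l.
by rewrite [_ * 2^-1]mulrC -mulrDl half2 mul1r.
Qed.

(* The constant 1 would do, but 2 is enough here and easier to reach. *)
Lemma starhom_bounded (f : A -> multiplier B) : starhom f ->
  forall x y, `|mulL (f x) y| <= 2 * `|x| * `|y|.
Proof.
move=> [fl fM fS].
(* [f a] and [1 - f v] play sine and cosine: they are self-adjoint, commute, and have squares with
   sum 1, so [unitary_re] applies. The square root is taken in [A], where the norm of [a] is
   known. *)
have small a y : star a = a -> `|a| <= 2^-1 -> `|mulL (f a) y| <= `|y|.
  move=> sa a2; have [v [sv av ve]] := sqrt_one_sub_sqr sa a2.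
  apply: (@unitary_re _ _ _ (mone - f v)); rewrite -?fS ?sa//.
  - by rewrite starB star_mone -fS sv.
  - by rewrite smul_subr smul_subl mone_smul smul_mone -!fM av.
  have e : f v + f v = f (a ⋅ a) + f (v ⋅ v) by rewrite -!(linfD fl) ve.
  rewrite smul_subr !smul_subl !mone_smul smul_mone -!fM opprB.
  by rewrite [X in _ + X]addrACA -opprD e opprD addrACA subrr addr0 addrCA subrr addr0.
have sa_bd a y : star a = a -> `|mulL (f a) y| <= 2 * `|a| * `|y|.
  move=> sa; have [->|a0] := eqVneq a 0.
    by rewrite (linf0 fl) -[mulL 0 y]/(0 : B) !normr0 mulr0 mul0r.
  have na : 0 < 2 * `|a| by rewrite mulr_gt0 ?ltr0n// normr_gt0.
  pose t := (2 * `|a|)^-1; have t0 : 0 < t by rewrite invr_gt0.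
  have := @small (t *: a) y.
  rewrite starZ conj_Creal ?gtr0_real// sa => /(_ erefl).
  rewrite normrZ (gtr0_norm t0) (linfZ fl) mulLZ normrZ (gtr0_norm t0).
  move=> h; rewrite -ler_pdivrMl//; apply: h.
  by rewrite /t invfM -mulrA mulVf ?normr_eq0// mulr1.
move=> x y.
(* For general [x] pass to [star x ⋅ x]: [|f(x) y|^2 <= |y| |f(star x ⋅ x) y| <= 2 |x|^2 |y|^2]. *)
rewrite -(@ler_pXn2r _ 2) ?nnegrE ?mulr_ge0// mulL_sqr -fS -fM.
rewrite (le_trans (norm_smul_le _ _))// norm_star.
rewrite (le_trans (ler_wpM2l _ (sa_bd _ _ _)))// ?star_smul ?starK//.
rewrite norm_star_smul mulrCA -[`|y| * `|y|]expr2 !exprMn -!mulrA.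
by rewrite ler_peMl ?ler1n ?mulr_ge0 ?exprn_ge0 ?ler0n.
Qed.

End HomBounded.

(** * Strict convergence and strict extensions *)

Section Strict.
Context {R : realType}.
Local Notation K := R[i].
Implicit Types A B : cstarType R.

Lemma cvg_scale (V : normedModType K) T (F : set_system T) {FF : Filter F}
    (c : K) (h : T -> V) (l : V) :
  h t @[t --> F] --> l -> c *: h t @[t --> F] --> c *: l.
Proof.
move=> hl; apply: (@linear_cvg _ V V (fun x => c *: x) `|c|) hl => [a x y|x].
  by rewrite scalerDr !scalerA mulrC.
by rewrite normrZ.
Qed.

Lemma strict_cvgL A Z (F : set_system Z) (S : Z -> multiplier A) T :
  strict_cvg (S z @[z --> F]) T -> forall x, mulL (S z) x @[z --> F] --> mulL T x.
Proof. by move=> h x; exact: (h x).1. Qed.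

Lemma strict_cvgR A Z (F : set_system Z) (S : Z -> multiplier A) T :
  strict_cvg (S z @[z --> F]) T -> forall x, mulR (S z) x @[z --> F] --> mulR T x.
Proof. by move=> h x; exact: (h x).2. Qed.

Lemma strict_cvg_uniq A (F : set_system (multiplier A)) {FF : ProperFilter F} S T :
  strict_cvg F S -> strict_cvg F T -> S = T.
Proof.
move=> FS FT; apply: multiplier_eqL => x.
exact: (cvg_uniq (FS x).1 (FT x).1).
Qed.

Lemma strict_cvg_bound A Z (F : set_system Z) {FF : ProperFilter F}
    (S : Z -> multiplier A) T (k : K) :
  (\forall z \near F, forall x, `|mulL (S z) x| <= k * `|x|) ->
  strict_cvg (S z @[z --> F]) T -> forall x, `|mulL T x| <= k * `|x|.
Proof.
move=> hk hS x; apply: (cvg_norm_le _ (strict_cvgL hS (x := x))); apply: filterS hk => z; exact.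
Qed.

Lemma strict_cvg_comp A Z Z' (F : set_system Z) (F' : set_system Z') (g : Z' -> Z)
    (S : Z -> multiplier A) T :
  g z @[z --> F'] `=>` F -> strict_cvg (S z @[z --> F]) T ->
  strict_cvg (S (g z) @[z --> F']) T.
Proof.
move=> gF ST x; split=> P /= xP; first exact: (gF _ ((ST x).1 P xP)).
exact: (gF _ ((ST x).2 P xP)).
Qed.

Lemma strict_cvg_star A Z (F : set_system Z) {FF : Filter F}
    (S : Z -> multiplier A) T :
  strict_cvg (S z @[z --> F]) T -> strict_cvg (star (S z) @[z --> F]) (star T).
Proof. by move=> h x; split; apply: star_cvg; apply h. Qed.

Lemma cvg_ext (V : normedModType K) T (F : set_system T) {FF : Filter F}
    (h h' : T -> V) (l : V) :
  h =1 h' -> h t @[t --> F] --> l -> h' t @[t --> F] --> l.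
Proof. by move=> /funext ->. Qed.

Lemma strict_cvg_ext A Z (F : set_system Z) {FF : Filter F}
    (S S' : Z -> multiplier A) T :
  S =1 S' -> strict_cvg (S z @[z --> F]) T -> strict_cvg (S' z @[z --> F]) T.
Proof. by move=> /funext ->. Qed.

Lemma strict_cvg_lin A Z (F : set_system Z) {FF : Filter F} (c : K)
    (S S' : Z -> multiplier A) T T' :
  strict_cvg (S z @[z --> F]) T -> strict_cvg (S' z @[z --> F]) T' ->
  strict_cvg (c *: S z + S' z @[z --> F]) (c *: T + T').
Proof.
move=> ST ST' x; split.
  rewrite mulLD mulLZ.
  apply: (@cvg_ext _ _ F _ (fun z => c *: mulL (S z) x + mulL (S' z) x)
    (fun z => mulL (c *: S z + S' z) x)) => [z|]; first by rewrite mulLD mulLZ.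
  by apply: cvg_add; [apply: cvg_scale|]; exact: strict_cvgL.
rewrite mulRD mulRZ.
apply: (@cvg_ext _ _ F _ (fun z => c *: mulR (S z) x + mulR (S' z) x)
  (fun z => mulR (c *: S z + S' z) x)) => [z|]; first by rewrite mulRD mulRZ.
by apply: cvg_add; [apply: cvg_scale|]; exact: strict_cvgR.
Qed.

Lemma strict_cvg_cst A Z (F : set_system Z) {FF : Filter F} (T : multiplier A) :
  strict_cvg (T @[z --> F]) T.
Proof. by move=> x; split; exact: cvg_cst. Qed.

Lemma strict_cvg_scale A Z (F : set_system Z) {FF : Filter F} (c : K)
    (S : Z -> multiplier A) T :
  strict_cvg (S z @[z --> F]) T -> strict_cvg (c *: S z @[z --> F]) (c *: T).
Proof.
move=> ST.
have : strict_cvg (c *: S z + 0 @[z --> F]) (c *: T + 0).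
  exact: strict_cvg_lin (strict_cvg_cst 0).
rewrite addr0.
by apply: strict_cvg_ext => z; rewrite addr0.
Qed.

(** Strictness speaks of the unit ball only; by linearity a bounded net can be scaled into it and
    back. *)
Lemma mult_strict_cvg A B (h : multiplier A -> multiplier B) Z (F : set_system Z)
    {FF : ProperFilter F} (S : Z -> multiplier A) T (k : K) :
  linear h -> mult_strict h ->
  (\forall z \near F, forall x, `|mulL (S z) x| <= k * `|x|) ->
  strict_cvg (S z @[z --> F]) T -> strict_cvg (h (S z) @[z --> F]) (h T).
Proof.
move=> hl hs hk ST.
have k1 : 0 < `|k| + 1 by rewrite ltr_wpDl.
pose c := (`|k| + 1)^-1; have c0 : 0 < c by rewrite invr_gt0.
have unit S' : (forall x, `|mulL S' x| <= k * `|x|) -> mult_unit_ball (c *: S').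
  move=> S'k x; rewrite mulLZ normrZ gtr0_norm// ler_pdivrMl//.
  apply: (@le_trans _ _ (`|k| * `|x|)).
    exact: le_normr_scale.
  by rewrite ler_wpM2r// lerDl.
have cS : strict_cvg (h (c *: S z) @[z --> F]) (h (c *: T)).
  apply: (hs (c *: S z @[z --> F]) (c *: T)).
  - by apply: filterS hk => z; exact: unit.
  - by apply: unit; apply: strict_cvg_bound ST.
  - exact: strict_cvg_scale.
have : strict_cvg (c^-1 *: h (c *: S z) @[z --> F]) (c^-1 *: h (c *: T)).
  exact: strict_cvg_scale.
rewrite -(linfZ hl) scalerA mulVf ?gt_eqF// scale1r.
apply: strict_cvg_ext => z.
by rewrite -(linfZ hl) scalerA mulVf ?gt_eqF// scale1r.
Qed.

Lemma strict_hom_cvg A B (f : A -> multiplier B) Z (F : set_system Z)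
    {FF : ProperFilter F} (a : Z -> A) (a0 : A) (k : K) :
  linear f -> strict f -> (\forall z \near F, `|a z| <= k) ->
  strict_cvg (embM (a z) @[z --> F]) (embM a0) ->
  strict_cvg (f (a z) @[z --> F]) (f a0).
Proof.
move=> fl fs hk aa.
have k1 : 0 < `|k| + 1 by rewrite ltr_wpDl.
pose c := (`|k| + 1)^-1; have c0 : 0 < c by rewrite invr_gt0.
have unit b : `|b| <= k -> `|c *: b| <= 1.
  move=> bk; rewrite normrZ gtr0_norm// ler_pdivrMl// mulr1.
  by rewrite ler_wpDr// (le_trans bk)// real_ler_norm// ger0_real// (le_trans _ bk).
have [el _ _] := embM_starhom (A := A).
(* Balls are strictly closed, so the limit inherits the bound of the net. *)
have a0k : `|a0| <= k.
  have [z zk] := filter_ex hk.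
  apply: norm_le_mull; first by rewrite (le_trans _ zk).
  apply: (strict_cvg_bound (S := fun z => embM (a z)) _ aa).
  by apply: filterS hk => y yk x /=; rewrite (le_trans (norm_smul_le _ _))// ler_wpM2r.
have cS : strict_cvg (f (c *: a z) @[z --> F]) (f (c *: a0)).
  apply: (fs (c *: a z @[z --> F]) (c *: a0)).
  - by apply: filterS hk => z; exact: unit.
  - exact: unit.
  - rewrite (linfZ el).
    apply: (strict_cvg_ext (S := fun z => c *: embM (a z)) (S' := fun z => embM (c *: a z))).
      by move=> z; rewrite (linfZ el).
    exact: strict_cvg_scale.
have : strict_cvg (c^-1 *: f (c *: a z) @[z --> F]) (c^-1 *: f (c *: a0)).
  exact: strict_cvg_scale.
rewrite -(linfZ fl) scalerA mulVf ?gt_eqF// scale1r.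
apply: strict_cvg_ext => z.
by rewrite -(linfZ fl) scalerA mulVf ?gt_eqF// scale1r.
Qed.

(** Strict density of [A] in [M(A)]: [(T u) x = T (u x)] and [x (T u) = (x T) u], where [u x] and
    [(x T) u] converge in norm. *)
Lemma approx_unit_mult A (T : multiplier A) :
  strict_cvg (embM (mulL T u) @[u --> approx_unit]) T.
Proof.
move=> x; split.
  apply: (@cvg_ext _ _ approx_unit _ (fun u => mulL T (u ⋅ x))
    (fun u => mulL (embM (mulL T u)) x)).
    by move=> u /=; rewrite mulL_smul.
  have [k _ hk] := mulL_bd T.
  by apply: (linear_cvg (mulL_linear T) hk); exact: approx_unit_cvgl.
apply: (@cvg_ext _ _ approx_unit _ (fun u => mulR T x ⋅ u) (fun u => mulR (embM (mulL T u)) x)).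
  by move=> u /=; rewrite mulRL.
exact: approx_unit_cvgr.
Qed.

Lemma approx_unit_mult_bound A (T : multiplier A) (k : K) : 0 <= k ->
  (forall x, `|mulL T x| <= k * `|x|) ->
  \forall u \near approx_unit, `|mulL T u| <= 2 * k.
Proof.
move=> k0 hk; apply: filterS (approx_unit_bound (A := A)) => u /= u2.
by rewrite (le_trans (hk _))// mulrC ler_wpM2r.
Qed.

Lemma strict_cvg_embM A Z (F : set_system Z) {FF : Filter F} (a : Z -> A) (a0 : A) :
  a z @[z --> F] --> a0 -> strict_cvg (embM (a z) @[z --> F]) (embM a0).
Proof. by move=> h x; split; [exact: smul_cvgl|exact: smul_cvgr]. Qed.

(** The uniqueness principle behind the [xget] descriptions of maps. Agreement passes from
    norm-dense elements to [A] along a bounded sequence, then to [M(A)] along [approx_unit_mult]. *)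
Lemma mult_strict_eq A B (h h' : multiplier A -> multiplier B) :
  linear h -> linear h' -> mult_strict h -> mult_strict h' ->
  (forall x e, 0 < e -> exists2 y, h (embM y) = h' (embM y) & `|x - y| <= e) ->
  h =1 h'.
Proof.
move=> hl h'l hs h's D.
have eqA x : h (embM x) = h' (embM x).
  have /choice[y hy] : forall n : nat, exists y,
      h (embM y) = h' (embM y) /\ `|x - y| <= n.+1%:R^-1.
    move=> n; have n0 : 0 < n.+1%:R^-1 :> K by rewrite invr_gt0 ltr0n.
    by have [y ? ?] := D x _ n0; exists y.
  have yx : y n @[n --> \oo] --> x.
    apply/cvgrPdist_le => e /complex_archi[N Ne]; exists N => // n /= Nn.
    rewrite (le_trans (hy n).2)// (le_trans _ Ne)// lef_pV2 ?posrE ?ltr0n//.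
    by rewrite ler_nat.
  have bd : \forall n \near \oo, forall z, `|mulL (embM (y n)) z| <= (`|x| + 1) * `|z|.
    apply: nearW => n z /=; rewrite (le_trans (norm_smul_le _ _))// ler_wpM2r//.
    rewrite -[y n](subKr x) (le_trans (ler_normB _ _))// lerD2l.
    by rewrite (le_trans (hy n).2)// invf_le1 ?ltr0n// ler1n.
  have yxs : strict_cvg (embM (y n) @[n --> \oo]) (embM x) by exact: strict_cvg_embM.
  have c1 : strict_cvg (h (embM (y n)) @[n --> \oo]) (h (embM x)).
    exact: mult_strict_cvg hl hs bd yxs.
  have c2 : strict_cvg (h' (embM (y n)) @[n --> \oo]) (h' (embM x)).
    exact: mult_strict_cvg h'l h's bd yxs.
  apply: strict_cvg_uniq c1 _.
  by apply: strict_cvg_ext c2 => n; rewrite (hy n).1.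
move=> T; have [k k0 hk] := mulL_bd T.
have bd : \forall u \near approx_unit, forall z, `|mulL (embM (mulL T u)) z| <= (2 * k) * `|z|.
  apply: filterS (approx_unit_mult_bound k0 hk) => u uk z /=.
  by rewrite (le_trans (norm_smul_le _ _))// ler_wpM2r.
have Tu := @approx_unit_mult A T.
have c1 : strict_cvg (h (embM (mulL T u)) @[u --> approx_unit]) (h T).
  exact: mult_strict_cvg hl hs bd Tu.
have c2 : strict_cvg (h' (embM (mulL T u)) @[u --> approx_unit]) (h' T).
  exact: mult_strict_cvg h'l h's bd Tu.
apply: strict_cvg_uniq c1 _.
by apply: strict_cvg_ext c2 => u; rewrite eqA.
Qed.

(** The identities defining a double centralizer survive pointwise limits, and [k] bounds the limit:
    bounded sets of [M(B)] are strictly complete. *)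
Lemma strict_complete B Z (F : set_system Z) {FF : ProperFilter F}
    (S : Z -> multiplier B) (k : K) : 0 <= k ->
  (\forall z \near F, forall y, `|mulL (S z) y| <= k * `|y|) ->
  (forall y, exists l : B, mulL (S z) y @[z --> F] --> l) ->
  (forall y, exists l : B, mulR (S z) y @[z --> F] --> l) ->
  exists T, strict_cvg (S z @[z --> F]) T.
Proof.
move=> k0 hk /choice[L hL] /choice[Q hQ].
have hk' : \forall z \near F, forall y, `|mulR (S z) y| <= k * `|y|.
  by apply: filterS hk => z; exact: mulR_bd_of.
have Ll : linear L.
  move=> a x y; apply: cvg_uniq (hL _) _.
  apply: (@cvg_ext _ _ F _ (fun z => a *: mulL (S z) x + mulL (S z) y)).
    by move=> z; rewrite mulL_linear.
  by apply: cvg_add => //; exact: cvg_scale.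
have Ql : linear Q.
  move=> a x y; apply: cvg_uniq (hQ _) _.
  apply: (@cvg_ext _ _ F _ (fun z => a *: mulR (S z) x + mulR (S z) y)).
    by move=> z; rewrite mulR_linear.
  by apply: cvg_add => //; exact: cvg_scale.
have Lb y : `|L y| <= k * `|y|.
  by apply: (cvg_norm_le _ (hL y)); apply: filterS hk => z; exact.
have Qb y : `|Q y| <= k * `|y|.
  by apply: (cvg_norm_le _ (hQ y)); apply: filterS hk' => z; exact.
have LM x y : L (x ⋅ y) = L x ⋅ y.
  apply: cvg_uniq (hL _) _; apply: (@cvg_ext _ _ F _ (fun z => mulL (S z) x ⋅ y)).
    by move=> z; rewrite mulL_smul.
  exact: smul_cvgl.
have QM x y : Q (x ⋅ y) = x ⋅ Q y.
  apply: cvg_uniq (hQ _) _; apply: (@cvg_ext _ _ F _ (fun z => x ⋅ mulR (S z) y)).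
    by move=> z; rewrite mulR_smul.
  exact: smul_cvgr.
have QL x y : Q x ⋅ y = x ⋅ L y.
  apply: (@cvg_uniq _ _ _ F _ (fun z => mulR (S z) x ⋅ y)); first exact: smul_cvgl.
  apply: (@cvg_ext _ _ F _ (fun z => x ⋅ mulL (S z) y)).
    by move=> z; rewrite mulRL.
  exact: smul_cvgr.
exists (Multiplier Ll Ql (ex_intro _ k Lb) (ex_intro _ k Qb) LM QM QL).
by move=> x; split; [exact: hL|exact: hQ].
Qed.

End Strict.

(** * Extension of a strict homomorphism to multipliers *)

Section StrictExtension.
Context {R : realType} {A B : cstarType R}.
Local Notation K := R[i].
Variables (f : A -> multiplier B).
Hypotheses (fhom : starhom f) (fstrict : strict f).

Let fl : linear f. Proof. by case: fhom. Qed.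
Let fM x y : f (x ⋅ y) = f x ⋅ f y. Proof. by case: fhom. Qed.
Let fS x : f (star x) = star (f x). Proof. by case: fhom. Qed.
Let fb x y : `|mulL (f x) y| <= 2 * `|x| * `|y|.
Proof. exact: starhom_bounded fhom x y. Qed.

Let fbr x y : `|mulR (f x) y| <= 2 * `|x| * `|y|.
Proof. by apply: mulR_bd_of => [|z]; [rewrite mulr_ge0|exact: fb]. Qed.

Let f_cvgL Z (F : set_system Z) {FF : Filter F} (a : Z -> A) a0 y :
  a z @[z --> F] --> a0 -> mulL (f (a z)) y @[z --> F] --> mulL (f a0) y.
Proof.
move=> h; apply: (@linear_cvg _ A B (fun x => mulL (f x) y) (2 * `|y|)) h.
  by move=> c x x'; rewrite fl mulLD mulLZ.
by move=> x; rewrite mulrAC.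
Qed.

Let f_cvgR Z (F : set_system Z) {FF : Filter F} (a : Z -> A) a0 y :
  a z @[z --> F] --> a0 -> mulR (f (a z)) y @[z --> F] --> mulR (f a0) y.
Proof.
move=> h; apply: (@linear_cvg _ A B (fun x => mulR (f x) y) (2 * `|y|)) h.
  by move=> c x x'; rewrite fl mulRD mulRZ.
by move=> x; rewrite mulrAC.
Qed.

(** The limit [T] of [mulL T u] may lie outside [A], where strictness of [f] says nothing. The
    difference of two independent approximants tends strictly to 0, which is in [A]; hence the
    images form a strictly Cauchy net. *)
Let ext_ex (T : multiplier A) : exists T' : multiplier B,
  strict_cvg (f (mulL T u) @[u --> approx_unit]) T'.
Proof.
have [k k0 hk] := mulL_bd T.
have ub := approx_unit_mult_bound k0 hk.
have diff0 : strict_cvg (f (mulL T p.1 - mulL T p.2) @[p --> (approx_unit, approx_unit)]) (f 0).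
  apply: (strict_hom_cvg (k := 2 * k + 2 * k) fl fstrict).
    exists ([set u | `|mulL T u| <= 2 * k], [set u | `|mulL T u| <= 2 * k]) => //=.
    move=> [u u'] /= [h h']; rewrite (le_trans (ler_normB _ _))//; exact: lerD.
  have [el _ _] := embM_starhom (A := A).
  have c1 : strict_cvg (embM (mulL T p.1) @[p --> (@approx_unit _ A, @approx_unit _ A)]) T.
    by apply: strict_cvg_comp (@approx_unit_mult _ A T); exact: cvg_fst.
  have c2 : strict_cvg (embM (mulL T p.2) @[p --> (@approx_unit _ A, @approx_unit _ A)]) T.
    by apply: strict_cvg_comp (@approx_unit_mult _ A T); exact: cvg_snd.
  rewrite (linf0 el) -(addNr T) -scaleN1r.
  apply: (strict_cvg_ext (S := fun p => -1 *: embM (mulL T p.2) + embM (mulL T p.1))).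
    by move=> p; rewrite (linfB el) scaleN1r addrC.
  exact: strict_cvg_lin.
have f0L y : mulL (f 0) y = 0 by rewrite (linf0 fl).
have f0R y : mulR (f 0) y = 0 by rewrite (linf0 fl).
apply: (strict_complete (k := 4 * k)); first by rewrite mulr_ge0.
- apply: filterS ub => u uk y; rewrite (le_trans (fb _ _))// ler_wpM2r//.
  by rewrite -[4]/(2 * 2)%:R natrM -mulrA ler_wpM2l.
- move=> y; apply: cauchy_map_cvg => e e0.
  have := strict_cvgL diff0 (x := y); rewrite f0L => /cvgrPdist_le/(_ e e0).
  move=> [[P Q] /= [Pa Qa] PQ]; have [u Pu] := filter_ex Pa.
  exists (mulL (f (mulL T u)) y); apply: filterS Qa => u' Qu'.
  have := PQ (u, u') (conj Pu Qu'); rewrite /= sub0r normrN.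
  by rewrite (linfB fl) mulLD mulLN.
move=> y; apply: cauchy_map_cvg => e e0.
have := strict_cvgR diff0 (x := y); rewrite f0R => /cvgrPdist_le/(_ e e0).
move=> [[P Q] /= [Pa Qa] PQ]; have [u Pu] := filter_ex Pa.
exists (mulR (f (mulL T u)) y); apply: filterS Qa => u' Qu'.
have := PQ (u, u') (conj Pu Qu'); rewrite /= sub0r normrN.
by rewrite (linfB fl) mulRD mulRN.
Qed.

Let E := projT1 (choice ext_ex).
Let EP T : strict_cvg (f (mulL T u) @[u --> approx_unit]) (E T).
Proof. exact: (projT2 (choice ext_ex) T). Qed.

Let E_bound T k : 0 <= k -> (forall x, `|mulL T x| <= k * `|x|) ->
  forall y, `|mulL (E T) y| <= 4 * k * `|y|.
Proof.
move=> k0 hk; apply: strict_cvg_bound (EP T).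
apply: filterS (approx_unit_mult_bound k0 hk) => u uk y.
rewrite (le_trans (fb _ _))// ler_wpM2r//.
by rewrite -[4]/(2 * 2)%:R natrM -mulrA ler_wpM2l.
Qed.

Let E_embM a : E (embM a) = f a.
Proof.
apply: strict_cvg_uniq (EP _) _ => y; split.
  by apply: f_cvgL; exact: approx_unit_cvgr.
by apply: f_cvgR; exact: approx_unit_cvgr.
Qed.

Let E_linear : linear E.
Proof.
move=> c S T; apply: strict_cvg_uniq (EP _) _.
apply: (strict_cvg_ext (S := fun u => c *: f (mulL S u) + f (mulL T u))).
  by move=> u; rewrite -fl mulLD mulLZ.
exact: strict_cvg_lin.
Qed.

Let E_mulL T a y : mulL (E T) (mulL (f a) y) = mulL (f (mulL T a)) y.
Proof.
have [k k0 hk] := mulL_bd T.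
apply: (cvg_uniq (strict_cvgL (EP T) (x := mulL (f a) y))).
apply: (@cvg_ext _ _ _ approx_unit _ (fun u => mulL (f (mulL T (u ⋅ a))) y)).
  by move=> u; rewrite mulL_smul fM.
apply: f_cvgL; apply: (linear_cvg (mulL_linear T) hk); exact: approx_unit_cvgl.
Qed.

Let E_mul S T : E (S ⋅ T) = E S ⋅ E T.
Proof.
apply: multiplier_eqL => y; rewrite mulLM.
have [k k0 hk] := mulL_bd (E S).
apply: (cvg_uniq (strict_cvgL (EP _) (x := y))).
apply: (@cvg_ext _ _ _ approx_unit _ (fun u => mulL (E S) (mulL (f (mulL T u)) y))).
  by move=> u; rewrite E_mulL.
by apply: (linear_cvg (mulL_linear _) hk); exact: strict_cvgL (EP T) y.
Qed.

Let E_star T : E (star T) = star (E T).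
Proof.
have [k k0 hk] := mulL_bd T.
have [el eM eS] := embM_starhom (A := A).
have hk' := mulR_bd_of k0 hk.
(* [mulL (star T) u] and [star (mulL T u)] both approximate [star T]; their difference tends to 0
   inside [A], where strictness of [f] applies. *)
have d0 : strict_cvg (f (mulL (star T) u - star (mulL T u)) @[u --> approx_unit]) (f 0).
  apply: (strict_hom_cvg (k := 2 * k + 2 * k) fl fstrict).
    apply: filterS (approx_unit_bound (A := A)) => u u2.
    rewrite (le_trans (ler_normB _ _))// norm_star lerD//.
      rewrite mulL_star norm_star (le_trans (hk' _))// norm_star mulrC.
      by rewrite ler_wpM2r.
    by rewrite (le_trans (hk _))// mulrC ler_wpM2r.
  rewrite (linf0 el) -(addNr (star T)) -scaleN1r.
  apply: (strict_cvg_ext (S := fun u => -1 *: star (embM (mulL T u)) + embM (mulL (star T) u))).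
    by move=> u; rewrite (linfB el) scaleN1r addrC eS.
  apply: strict_cvg_lin; last exact: approx_unit_mult.
  exact: strict_cvg_star (@approx_unit_mult _ A T).
have c2 : strict_cvg (1 *: f (mulL (star T) u - star (mulL T u)) + star (f (mulL T u))
    @[u --> approx_unit]) (1 *: f 0 + star (E T)).
  by apply: strict_cvg_lin => //; apply: strict_cvg_star; exact: EP.
rewrite (linf0 fl) scaler0 add0r in c2.
apply: strict_cvg_uniq (EP _) _; apply: strict_cvg_ext c2 => u.
by rewrite scale1r -fS -(linfD fl) subrK.
Qed.

Let E_one_l T : E T = E T ⋅ E mone.
Proof. by rewrite -E_mul smul_mone. Qed.

(** As [E S = E S ⋅ E mone], the vector [y] may be replaced by [E mone y], and this by [f(u) y] for
    one fixed [u]. Then [E S (f(u) y) = f(S u) y] converges because [S u] converges in norm;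
    [E_bound] controls the replacement uniformly along the net. *)
Let E_cvgL Z (F : set_system Z) {FF : ProperFilter F} (S : Z -> multiplier A) T k y :
  0 <= k -> (\forall z \near F, forall x, `|mulL (S z) x| <= k * `|x|) ->
  strict_cvg (S z @[z --> F]) T -> mulL (E (S z)) y @[z --> F] --> mulL (E T) y.
Proof.
move=> k0 hk ST; have Tk : forall x, `|mulL T x| <= k * `|x| by exact: strict_cvg_bound hk ST.
apply/cvgrPdist_le => e e0.
pose d := e / 2 / (4 * k + 4 * k + 1).
have d0 : 0 < 4 * k + 4 * k + 1 by rewrite ltr_wpDl// addr_ge0 ?mulr_ge0.
have dd : 0 < d by rewrite !divr_gt0 ?ltr0n.
have := strict_cvgL (EP mone) (x := y).
move=> /cvgrPdist_le/(_ _ dd) hu; have [u {}hu] := filter_ex hu.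
have fSu : mulL (f (mulL (S z) u)) y @[z --> F] --> mulL (f (mulL T u)) y.
  by apply: f_cvgL; exact: strict_cvgL ST u.
move: fSu => /cvgrPdist_le/(_ _ (divr_gt0 e0 (ltr0n _ 2))).
apply: filterS2 hk => z hk hz.
set w := mulL (E mone) y - mulL (f u) y in hu.
have Ew S' : mulL (E S') y = mulL (E S') w + mulL (f (mulL S' u)) y.
  rewrite {1}E_one_l mulLM -E_mulL -[in RHS](linfD (mulL_linear _)).
  by rewrite /w subrK.
rewrite (Ew T) (Ew (S z)) opprD addrACA (splitr e) (le_trans (ler_normD _ _))// lerD//.
rewrite (le_trans (ler_normB _ _))//.
apply: (@le_trans _ _ ((4 * k + 4 * k + 1) * `|w|)).
  rewrite mulrDl mul1r ler_wpDr// mulrDl lerD//.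
  - exact: (E_bound k0 Tk).
  - exact: (E_bound k0 hk).
by rewrite mulrC -ler_pdivlMr.
Qed.

Let E_strict : mult_strict E.
Proof.
move=> F T FF Fb Tb FT y.
have hk : \forall S \near F, forall x, `|mulL S x| <= 1 * `|x|.
  by apply: filterS Fb => S Sb x; rewrite mul1r.
have hk' : \forall S \near F, forall x, `|mulL (star S) x| <= 1 * `|x|.
  apply: filterS hk => S Sb x.
  by rewrite mulL_star norm_star (le_trans (mulR_bd_of ler01 Sb _))// norm_star.
split; first exact: (@E_cvgL _ F _ id T 1 y ler01).
have FT' : strict_cvg (star S @[S --> F]) (star T) by exact: (@strict_cvg_star _ _ _ _ _ id).
apply: (@cvg_ext _ _ _ F _ (fun S => star (mulL (E (star S)) (star y))) (fun S => mulR (E S) y)).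
  by move=> S; rewrite E_star mulL_star !starK.
rewrite -[mulR _ _]starK -[y in mulR _ y]starK -mulL_star -E_star.
by apply: star_cvg; exact: E_cvgL hk' FT'.
Qed.

Lemma strict_extP :
  [/\ starhom (strict_ext f), mult_strict (strict_ext f),
      forall a, strict_ext f (embM a) = f a
    & forall T k, 0 <= k -> (forall x, `|mulL T x| <= k * `|x|) ->
        forall y, `|mulL (strict_ext f T) y| <= 4 * k * `|y|].
Proof.
have Ehom : starhom E by split.
have [[hl hM hS] hs he] : [/\ starhom (strict_ext f), mult_strict (strict_ext f)
    & forall a, strict_ext f (embM a) = f a].
  by rewrite /strict_ext; apply: (@xgetPex _ (fun=> 0) [set f' | [/\ starhom f', mult_strict f' &
                            forall a, f' (embM a) = f a]]); exists E.
(* The norm bound is not part of the description of [strict_ext f]; it is transported from [E] by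
   uniqueness. *)
have -> : strict_ext f = E.
  apply/funext; apply: mult_strict_eq => // x e e0; exists x.
    by rewrite he E_embM.
  by rewrite subrr normr0 ltW.
by split.
Qed.

End StrictExtension.

(** * C*-algebras of functions vanishing at infinity *)

Section C0Sum.
Context {R : realType}.
Local Notation K := R[i].

Lemma dense_cvg (V W : normedModType K) Z (F : set_system Z) {FF : Filter F}
    (f : Z -> V -> W) (g : V -> W) (k : K) : 0 <= k ->
  (forall z, linear (f z)) -> linear g ->
  (\forall z \near F, forall x, `|f z x| <= k * `|x|) ->
  (forall x, `|g x| <= k * `|x|) ->
  (forall x e, 0 < e -> exists2 y, `|x - y| <= e & f z y @[z --> F] --> g y) ->
  forall x, f z x @[z --> F] --> g x.
Proof.
move=> k0 fl gl fk gk D x; apply/cvgrPdist_le => e e0.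
pose d := e / 2 / (k + k + 1).
have d1 : 0 < k + k + 1 by rewrite ltr_wpDl// addr_ge0.
have d0 : 0 < d by rewrite !divr_gt0 ?ltr0n.
have [y xy /cvgrPdist_le/(_ _ (divr_gt0 e0 (ltr0n _ 2)))] := D x d d0.
apply: filterS2 fk => z fk fy.
rewrite -[x](subrK y) (linfD gl) (linfD (fl z)) opprD addrACA [leRHS]splitr.
rewrite (le_trans (ler_normD _ _))// lerD// (le_trans (ler_normB _ _))//.
apply: (@le_trans _ _ ((k + k + 1) * `|x - y|)); last by rewrite mulrC -ler_pdivlMr.
by rewrite mulrDl mul1r ler_wpDr// mulrDl lerD.
Qed.

Lemma dense_linear_eq (V W : normedModType K) (f g : V -> W) (k l : K) :
  linear f -> linear g -> (forall x, `|f x| <= k * `|x|) ->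
  (forall x, `|g x| <= l * `|x|) ->
  (forall x e, 0 < e -> exists2 y, f y = g y & `|x - y| <= e) -> f =1 g.
Proof.
move=> fl gl fk gl' D x; apply/eqP; rewrite -subr_eq0 -normr_le0.
apply: le_of_eps => e e0.
have k1 : 0 < `|k| + `|l| + 1 by rewrite ltr_wpDl ?addr_ge0.
have [y fgy xy] := D x _ (divr_gt0 e0 k1).
have -> : f x - g x = f (x - y) - g (x - y).
  by rewrite (linfB fl) (linfB gl) fgy opprB addrA subrK.
rewrite add0r (le_trans (ler_normB _ _))//.
apply: (@le_trans _ _ ((`|k| + `|l| + 1) * `|x - y|)).
  by rewrite mulrDl mul1r ler_wpDr// mulrDl lerD// le_normr_scale.
by rewrite mulrC -ler_pdivlMr.
Qed.

(* [i] exhibits [T] as the C*-algebra C_0(X; B) of functions on the discrete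
   space [X], [i x] being the embedding of the functions supported at [x]. *)
Record c0_sum (B T : cstarType R) (X : eqType) (i : X -> B -> T) : Prop := {
  c0_lin : forall x, linear (i x);
  c0_smul : forall x b b', i x (b ⋅ b') = i x b ⋅ i x b';
  c0_starE : forall x b, i x (star b) = star (i x b);
  c0_orth : forall x y b b', x != y -> i x b ⋅ i y b' = 0;
  c0_normE : forall x b, `|i x b| = `|b|;
  c0_dense : forall t e, 0 < e ->
    exists s : seq (X * B), `|t - \sum_(p <- s) i p.1 p.2| <= e
}.

(** The value at [x] is characterised by how it multiplies the summand at [x]; its algebraic
    properties then follow from uniqueness. [mcoord] treats multipliers in the same way. *)
Definition c0coord (B T : cstarType R) (X : eqType) (i : X -> B -> T) x t : B :=
  xget 0 [set c | forall b, t ⋅ i x b = i x (c ⋅ b) /\ i x b ⋅ t = i x (b ⋅ c)].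

Definition mcoord (B T : cstarType R) (X : eqType) (i : X -> B -> T) x
    (m : multiplier T) : multiplier B :=
  xget 0 [set n | forall b, mulL m (i x b) = i x (mulL n b) /\
                            mulR m (i x b) = i x (mulR n b)].

Section Coordinates.
Variables (B T : cstarType R) (X : eqType) (i : X -> B -> T).
Hypothesis H : c0_sum i.
Implicit Types (b c : B) (t : T) (x y : X).

Let il x := c0_lin H x.

Lemma c0_inj x : injective (i x).
Proof.
move=> b c e; apply/eqP; rewrite -subr_eq0 -normr_eq0 -(c0_normE H x) (linfB (il x)) e.
by rewrite subrr normr0.
Qed.

Let coord_bound x t c : (forall b, t ⋅ i x b = i x (c ⋅ b)) -> `|c| <= `|t|.
Proof.
move=> h; apply: norm_le_mull => // b; rewrite -(c0_normE H x) -h.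
by rewrite (le_trans (norm_smul_le _ _))// (c0_normE H).
Qed.

Let c0_cvg Z (F : set_system Z) {FF : Filter F} x (b : Z -> B) b0 :
  b z @[z --> F] --> b0 -> i x (b z) @[z --> F] --> i x b0.
Proof.
by apply: (linear_cvg (k := 1)) => // y; rewrite mul1r (c0_normE H).
Qed.

(** Clear for finite sums; by [coord_bound] the coordinates of finite sums converging to [t] form a
    Cauchy sequence. *)
Let coord_ex x t : exists c, forall b, t ⋅ i x b = i x (c ⋅ b) /\ i x b ⋅ t = i x (b ⋅ c).
Proof.
have fin (s : seq (X * B)) : exists c, forall b,
    (\sum_(p <- s) i p.1 p.2) ⋅ i x b = i x (c ⋅ b) /\
    i x b ⋅ (\sum_(p <- s) i p.1 p.2) = i x (b ⋅ c).
  elim: s => [|[y d] s [c IH]].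
    by exists 0 => b; rewrite big_nil !smul_0l !smul_0r (linf0 (il x)).
  have [->|yx] := eqVneq y x.
    exists (d + c) => b; have [h1 h2] := IH b.
    by rewrite big_cons /= smul_addl h1 smul_addr h2 -!(c0_smul H) -!(linfD (il x))
      smul_addl smul_addr.
  exists c => b; have [h1 h2] := IH b.
  by rewrite big_cons /= smul_addl h1 smul_addr h2 !(c0_orth H) ?add0r// eq_sym.
have n0 n : 0 < n.+1%:R^-1 :> K by rewrite invr_gt0 ltr0n.
have /choice[s hs] := fun n => c0_dense H t (n0 n).
have /choice[c hc] := fun n => fin (s n).
pose S n := \sum_(p <- s n) i p.1 p.2.
have St : S n @[n --> \oo] --> t.
  apply/cvgrPdist_le => e /complex_archi[N Ne]; exists N => // n /= Nn.
  rewrite (le_trans (hs n))// (le_trans _ Ne)// lef_pV2 ?posrE ?ltr0n//.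
  by rewrite ler_nat.
have [c0 hc0] : exists c0 : B, c n @[n --> \oo] --> c0.
  apply: cauchy_map_cvg => e e0.
  have /cvgrPdist_le/(_ _ (divr_gt0 e0 (ltr0n _ 2)))[N _ hN] := St.
  exists (c N); exists N => // n Nn.
  apply: (@le_trans _ _ `|S N - S n|).
    apply: (@coord_bound x) => b.
    by rewrite !smul_subl (hc N b).1 (hc n b).1 (linfB (il x)).
  rewrite -(subrKA t) [leRHS]splitr (le_trans (ler_normD _ _))// lerD//.
    by rewrite distrC; apply: hN => /=.
  exact: hN.
exists c0 => b; split.
  apply: (@cvg_uniq _ _ _ \oo _ (fun n => S n ⋅ i x b)); first exact: smul_cvgl.
  apply: (@cvg_ext _ _ _ \oo _ (fun n => i x (c n ⋅ b))).
    by move=> n; rewrite (hc n b).1.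
  by apply: c0_cvg; exact: smul_cvgl.
apply: (@cvg_uniq _ _ _ \oo _ (fun n => i x b ⋅ S n)); first exact: smul_cvgr.
apply: (@cvg_ext _ _ _ \oo _ (fun n => i x (b ⋅ c n))).
  by move=> n; rewrite (hc n b).2.
by apply: c0_cvg; exact: smul_cvgr.
Qed.

Let coordP x t b : t ⋅ i x b = i x (c0coord i x t ⋅ b) /\ i x b ⋅ t = i x (b ⋅ c0coord i x t).
Proof. exact: (xgetPex 0 (coord_ex x t) b). Qed.

Lemma coordEl x t b : t ⋅ i x b = i x (c0coord i x t ⋅ b).
Proof. by case: (coordP x t b). Qed.
Lemma coordEr x t b : i x b ⋅ t = i x (b ⋅ c0coord i x t).
Proof. by case: (coordP x t b). Qed.

Lemma coord_unique x t c : (forall b, t ⋅ i x b = i x (c ⋅ b)) -> c0coord i x t = c.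
Proof. by move=> h; apply: smul_eql => b; apply: (@c0_inj x); rewrite -coordEl h. Qed.

Lemma coord_linear x : linear (c0coord i x).
Proof.
move=> a t t'; apply: coord_unique => b.
by rewrite !smulDl !coordEl il.
Qed.

Lemma coord_smul x t t' : c0coord i x (t ⋅ t') = c0coord i x t ⋅ c0coord i x t'.
Proof. by apply: coord_unique => b; rewrite -!smulA !coordEl. Qed.

Lemma coord_star x t : c0coord i x (star t) = star (c0coord i x t).
Proof.
apply: coord_unique => b.
by rewrite -[b in LHS]starK (c0_starE H) -star_smul coordEr -(c0_starE H) star_smul starK.
Qed.

Lemma coord_norm x t : `|c0coord i x t| <= `|t|.
Proof. by apply: (@coord_bound x) => b; exact: coordEl. Qed.

Lemma coord_in x b : c0coord i x (i x b) = b.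
Proof. by apply: coord_unique => c; rewrite (c0_smul H). Qed.

Lemma coord_out x y b : x != y -> c0coord i x (i y b) = 0.
Proof.
by move=> xy; apply: coord_unique => c; rewrite (c0_orth H) 1?eq_sym// smul_0l (linf0 (il x)).
Qed.

Lemma coord_cvg Z (F : set_system Z) {FF : Filter F} x (t : Z -> T) t0 :
  t z @[z --> F] --> t0 -> c0coord i x (t z) @[z --> F] --> c0coord i x t0.
Proof.
apply: (linear_cvg (coord_linear x) (k := 1)) => // y.
by rewrite mul1r coord_norm.
Qed.

Lemma coord_sum_uniq (xs : seq X) (v : X -> B) x : uniq xs ->
  c0coord i x (\sum_(y <- xs) i y (v y)) = if x \in xs then v x else 0.
Proof.
rewrite (linf_sum (coord_linear x)); elim: xs => [|y xs IH]; first by rewrite big_nil.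
rewrite big_cons inE /= => /andP[yxs /IH ->].
have [->|xy] := eqVneq x y; first by rewrite coord_in (negbTE yxs) addr0.
by rewrite coord_out// add0r.
Qed.

(* The C*-identity raises [(\sum_x i x (v x))] to the power [2^k] while the
   triangle inequality costs only a factor [size xs]. *)
Lemma norm_sum_le (xs : seq X) (v : X -> B) (M : K) : uniq xs -> 0 <= M ->
  (forall x, x \in xs -> `|v x| <= M) -> `|\sum_(x <- xs) i x (v x)| <= M.
Proof.
move=> uxs M0 vM.
pose S v := \sum_(x <- xs) i x (v x).
have step k : forall (v : X -> B) M, 0 <= M -> (forall x, x \in xs -> `|v x| <= M) ->
    `|S v| ^+ (2 ^ k) <= (size xs)%:R * M ^+ (2 ^ k).
  elim: k => [|k IH] w N N0 wN.
    rewrite !expr1 (le_trans (ler_norm_sum _ _ _))//.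
    have : \sum_(x <- xs) `|i x (w x)| <= \sum_(x <- xs) N.
      rewrite big_seq [leRHS]big_seq; apply: ler_sum => x xxs.
      by rewrite (c0_normE H) wN.
    move/le_trans; apply.
    by rewrite big_const_seq count_predT iter_addr_0 mulr_natl.
  rewrite expnS !exprM -norm_star_smul.
  have -> : star (S w) ⋅ S w = S (fun x => star (w x) ⋅ w x).
    rewrite {2}/S (linf_sum (smul_linr _)) big_seq [in RHS]/S [RHS]big_seq.
    apply: eq_bigr => x xxs.
    by rewrite coordEl coord_star coord_sum_uniq// xxs.
  apply: IH; first exact: exprn_ge0.
  by move=> x /wN h; rewrite norm_star_smul lerXn2r ?nnegrE.
have [M00|Mn0] := eqVneq M 0.
  by have := step 0 v M M0 vM; rewrite M00 !expr1 mulr0.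
have Mp : 0 < M by rewrite lt_def Mn0.
apply: contraT; rewrite -real_ltNge ?ger0_real// -/(S v) => SM.
(* Bernoulli: [(|S v| / M)^(2^N) = (1 + d)^(2^N) >= 1 + d 2^N] eventually exceeds [size xs], against
   [step]. *)
pose d := `|S v| / M - 1.
have d0 : 0 < d by rewrite subr_gt0 ltr_pdivlMr// mul1r.
have bern N : 1 + d *+ N <= (1 + d) ^+ N.
  elim: N => [|N IH]; first by rewrite mulr0n addr0.
  rewrite exprS (le_trans _ (ler_wpM2l _ IH))//; last by rewrite addr_ge0 ?ltW.
  rewrite mulrDl mul1r mulrDr mulr1 mulrSr addrA lerD2l lerDl.
  by rewrite mulr_ge0 ?mulrn_wge0// ltW.
have n1 : 0 < (size xs).+1%:R :> K by rewrite ltr0n.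
have [N Nd] := complex_archi (divr_gt0 d0 n1).
have := step N v M M0 vM; rewrite -ler_pdivrMr ?exprn_gt0// -expr_div_n.
have -> : `|S v| / M = 1 + d by rewrite addrC subrK.
move=> h; have := le_trans (bern _) h.
suff h' : (size xs).+1%:R <= d *+ (2 ^ N).
  move=> /(le_trans (lerD (lexx 1) h')); rewrite nat1r ler_nat.
  by rewrite ltnNge leqnSn.
rewrite ler_pdivlMr// in Nd; rewrite -(ler_pM2l (_ : 0 < N.+1%:R^-1)) ?invr_gt0 ?ltr0n//.
rewrite (le_trans Nd)// -[d *+ _]mulr_natl mulrA ler_peMl ?(ltW d0)//.
by rewrite ler_pdivlMl ?ltr0n// mulr1 ler_nat ltn_expl.
Qed.

(** With [coord_norm] this makes the norm of [T] the supremum norm. A finite sum near [t] may visit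
    a point several times; [ue] collects its terms so that [norm_sum_le] applies. *)
Lemma c0_norm_le (t : T) (M : K) : 0 <= M ->
  (forall x, `|c0coord i x t| <= M) -> `|t| <= M.
Proof.
move=> M0 tM; apply: le_of_eps => e e0; have e2 := divr_gt0 e0 (ltr0n _ 2).
have [s hs] := c0_dense H t e2.
set u := \sum_(p <- s) _ in hs.
have uM x : `|c0coord i x u| <= M + e / 2.
  rewrite -[u](subrK t) (linfD (coord_linear x)) addrC (le_trans (ler_normD _ _))// lerD//.
  by rewrite (le_trans (coord_norm _ _))// distrC.
pose xs := undup (map fst s).
have ue : u = \sum_(x <- xs) i x (c0coord i x u).
  have gen (l : seq (X * B)) : {subset map fst l <= xs} ->
      \sum_(p <- l) i p.1 p.2 = \sum_(x <- xs) i x (c0coord i x (\sum_(p <- l) i p.1 p.2)).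
    elim: l => [_|[y b] l IH lxs].
      rewrite big_nil; under eq_bigr do rewrite (linf0 (coord_linear _)) (linf0 (il _)).
      by rewrite big1.
    rewrite big_cons {1}IH; last by move=> z zl; apply: lxs; rewrite inE zl orbT.
    under [RHS]eq_bigr do rewrite (linfD (coord_linear _)) (linfD (il _)).
    rewrite big_split /=; congr (_ + _).
    have yxs : y \in xs by apply: lxs; rewrite inE eqxx.
    rewrite (bigD1_seq y) ?undup_uniq//= coord_in big1 ?addr0// => z zy.
    by rewrite coord_out ?(linf0 (il _)).
  by apply: gen => y; rewrite mem_undup.
rewrite -[t](subrK u) addrC (le_trans (ler_normD _ _))// [e in leRHS]splitr addrA.
by rewrite lerD// ue norm_sum_le ?undup_uniq// ?addr_ge0 ?(ltW e2).
Qed.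

Lemma coord_inj t t' : (forall x, c0coord i x t = c0coord i x t') -> t = t'.
Proof.
move=> h; apply/eqP; rewrite -subr_eq0 -normr_le0; apply: c0_norm_le => // x.
by rewrite (linfB (coord_linear x)) h subrr normr0.
Qed.

Lemma coord_vanish t (e : K) : 0 < e ->
  exists xs : seq X, forall x, x \notin xs -> `|c0coord i x t| <= e.
Proof.
move=> e0; have [s hs] := c0_dense H t e0.
exists (map fst s) => x xs; rewrite (le_trans _ hs)//.
suff e1 : c0coord i x (\sum_(p <- s) i p.1 p.2) = 0.
  by rewrite -[X in `|X| <= _]subr0 -e1 -(linfB (coord_linear x)) coord_norm.
elim: s xs {hs} => [|[y b] s IH]; first by rewrite big_nil (linf0 (coord_linear x)).
rewrite /= inE negb_or => /andP[xy /IH h].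
by rewrite big_cons (linfD (coord_linear x)) h coord_out// addr0.
Qed.

(** Truncations of [v] to finite sets are Cauchy for the supremum norm. With [coord_inj] and
    [coord_vanish] this identifies [T] with all of [C_0(X; B)]. *)
Lemma coord_surj (v : X -> B) :
  (forall e, 0 < e -> exists xs : seq X, forall x, x \notin xs -> `|v x| <= e) ->
  exists t, forall x, c0coord i x t = v x.
Proof.
move=> v0; have n0 n : 0 < n.+1%:R^-1 :> K by rewrite invr_gt0 ltr0n.
have /choice[xs hxs] : forall n : nat, exists xs : seq X,
    uniq xs /\ forall x, x \notin xs -> `|v x| <= n.+1%:R^-1.
  move=> n; have [xs h] := v0 _ (n0 n); exists (undup xs).
  by rewrite undup_uniq; split=> // x; rewrite mem_undup; exact: h.
pose S n := \sum_(x <- xs n) i x (v x).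
have cS n x : `|v x - c0coord i x (S n)| <= n.+1%:R^-1.
  have [u h] := hxs n; rewrite coord_sum_uniq//.
  case: ifPn => [_|/h h']; first by rewrite subrr normr0 ltW.
  by rewrite subr0.
have [t St] : exists t : T, S n @[n --> \oo] --> t.
  apply: cauchy_map_cvg => e e0.
  have [N Ne] := complex_archi (divr_gt0 e0 (ltr0n _ 2)).
  exists (S N); exists N => // n /= Nn; apply: c0_norm_le; first exact: ltW.
  move=> x; rewrite (linfB (coord_linear x)) -(subrKA (v x)) [leRHS]splitr.
  rewrite (le_trans (ler_normD _ _))// lerD//.
    by rewrite distrC (le_trans (cS _ _)).
  rewrite (le_trans (cS _ _))// (le_trans _ Ne)// lef_pV2 ?posrE ?ltr0n//.
  by rewrite ler_nat.
exists t => x; apply: (@cvg_uniq _ _ _ \oo _ (fun n => c0coord i x (S n))).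
  exact: coord_cvg.
apply/cvgrPdist_le => e /complex_archi[N Ne]; exists N => // n /= Nn.
rewrite (le_trans (cS _ _))// (le_trans _ Ne)// lef_pV2 ?posrE ?ltr0n//.
by rewrite ler_nat.
Qed.

End Coordinates.
End C0Sum.

(** * Multipliers of [C_0(X; B)] as bounded families *)

Section C0SumMultipliers.
Context {R : realType}.
Local Notation K := R[i].
Variables (B T : cstarType R) (X : eqType) (i : X -> B -> T).
Hypothesis H : c0_sum i.
Implicit Types (b c : B) (t : T) (x y : X) (m : multiplier T).

Let il x := c0_lin H x.

(** A multiplier preserves each summand: [i y c ⋅ m ⋅ i x b] lies both in the summand at [y] and in
    the one at [x], so it vanishes when [x] and [y] differ. *)
Let mulL_supp x m b : mulL m (i x b) = i x (c0coord i x (mulL m (i x b))).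
Proof.
apply: (coord_inj H) => y; have [->|yx] := eqVneq y x; first by rewrite coord_in.
rewrite (coord_out H)//; apply: smul_faithfulr => c.
apply: (c0_inj H (x := y)); rewrite -(coordEr H) -mulRL (coordEl H) (linf0 (il y)).
have e : i x (c0coord i x (mulR m (i y c)) ⋅ b) = i y (c ⋅ c0coord i y (mulL m (i x b))).
  by rewrite -(coordEr H) -mulRL (coordEl H).
by have := congr1 (c0coord i x) e; rewrite (coord_in H) (coord_out H) 1?eq_sym// => ->;
  rewrite (linf0 (il x)).
Qed.

Let mulR_supp x m b : mulR m (i x b) = i x (c0coord i x (mulR m (i x b))).
Proof.
apply: (coord_inj H) => y; have [->|yx] := eqVneq y x; first by rewrite coord_in.
rewrite (coord_out H)//; apply: smul_faithfull => c.
apply: (c0_inj H (x := y)); rewrite -(coordEl H) mulRL (coordEr H) (linf0 (il y)).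
have e : i x (b ⋅ c0coord i x (mulL m (i y c))) = i y (c0coord i y (mulR m (i x b)) ⋅ c).
  by rewrite -(coordEl H) mulRL (coordEr H).
by have := congr1 (c0coord i x) e; rewrite (coord_in H) (coord_out H) 1?eq_sym// => ->;
  rewrite (linf0 (il x)).
Qed.

Let mcoord_ex x m : exists n : multiplier B,
  forall b, mulL m (i x b) = i x (mulL n b) /\ mulR m (i x b) = i x (mulR n b).
Proof.
pose L b := c0coord i x (mulL m (i x b)); pose Q b := c0coord i x (mulR m (i x b)).
have Ll : linear L by move=> a b c; rewrite /L il mulL_linear (coord_linear H).
have Ql : linear Q by move=> a b c; rewrite /Q il mulR_linear (coord_linear H).
have [k k0 hk] := mulL_bd m.
have Lb b : `|L b| <= k * `|b|.
  by rewrite (le_trans (coord_norm H _ _))// -(c0_normE H x b).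
have Qb b : `|Q b| <= k * `|b|.
  by rewrite (le_trans (coord_norm H _ _))// -(c0_normE H x b) (mulR_bd_of k0 hk).
have LM b c : L (b ⋅ c) = L b ⋅ c.
  by rewrite /L (c0_smul H) mulL_smul (coord_smul H) (coord_in H).
have QM b c : Q (b ⋅ c) = b ⋅ Q c.
  by rewrite /Q (c0_smul H) mulR_smul (coord_smul H) (coord_in H).
have QL b c : Q b ⋅ c = b ⋅ L c.
  apply: (c0_inj H (x := x)).
  by rewrite !(c0_smul H) -mulR_supp -mulL_supp mulRL.
exists (Multiplier Ll Ql (ex_intro _ k Lb) (ex_intro _ k Qb) LM QM QL) => b /=.
by split; [exact: mulL_supp|exact: mulR_supp].
Qed.

Lemma mcoordL x m b : mulL m (i x b) = i x (mulL (mcoord i x m) b).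
Proof. exact: (xgetPex 0 (mcoord_ex x m) b).1. Qed.

Lemma mcoordR x m b : mulR m (i x b) = i x (mulR (mcoord i x m) b).
Proof. exact: (xgetPex 0 (mcoord_ex x m) b).2. Qed.

Lemma mcoord_unique x m (n : multiplier B) :
  (forall b, mulL m (i x b) = i x (mulL n b)) -> mcoord i x m = n.
Proof.
by move=> h; apply: multiplier_eqL => b; apply: (c0_inj H (x := x)); rewrite -mcoordL h.
Qed.

Lemma coord_mulL x m t : c0coord i x (mulL m t) = mulL (mcoord i x m) (c0coord i x t).
Proof.
apply: (coord_unique H) => b.
by rewrite -!mulL_smul (coordEl H) mcoordL.
Qed.

Lemma mcoord_linear x : linear (mcoord i x).
Proof.
move=> a m n; apply: mcoord_unique => b.
by rewrite !mulLD !mulLZ !mcoordL il.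
Qed.

Lemma mcoord_starhom x : starhom (mcoord i x).
Proof.
split=> [|m n|m]; first exact: mcoord_linear.
  by apply: mcoord_unique => b; rewrite !mulLM !mcoordL.
apply: mcoord_unique => b.
by rewrite !mulL_star -(c0_starE H) mcoordR (c0_starE H).
Qed.

Lemma mcoord_embM x t : mcoord i x (embM t) = embM (c0coord i x t).
Proof. by apply: mcoord_unique => b /=; exact: (coordEl H). Qed.

Lemma mcoord_inj m n : (forall x, mcoord i x m = mcoord i x n) -> m = n.
Proof.
move=> h; apply: multiplier_eqL => t; apply: (coord_inj H) => x.
by rewrite !coord_mulL h.
Qed.

Lemma mcoord_bound x m (k : K) : (forall t, `|mulL m t| <= k * `|t|) ->
  forall b, `|mulL (mcoord i x m) b| <= k * `|b|.
Proof. by move=> hk b; rewrite -(c0_normE H x) -mcoordL (le_trans (hk _))// (c0_normE H). Qed.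

Lemma mcoord_unit_ball x m : mult_unit_ball m -> mult_unit_ball (mcoord i x m).
Proof.
move=> mb b; have h t : `|mulL m t| <= 1 * `|t| by rewrite mul1r; exact: mb.
by have := mcoord_bound x h b; rewrite mul1r.
Qed.

Lemma bound_mcoord m (k : K) : 0 <= k ->
  (forall x b, `|mulL (mcoord i x m) b| <= k * `|b|) -> forall t, `|mulL m t| <= k * `|t|.
Proof.
move=> k0 hk t; apply: (c0_norm_le H); first by rewrite mulr_ge0.
move=> x; rewrite coord_mulL (le_trans (hk _ _))// ler_wpM2l//; exact: coord_norm.
Qed.

Lemma mcoord_surj (u : X -> multiplier B) (k : K) : 0 <= k ->
  (forall x b, `|mulL (u x) b| <= k * `|b|) -> exists m, forall x, mcoord i x m = u x.
Proof.
move=> k0 hk; have hk' x := mulR_bd_of k0 (hk x).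
(* Uniformly bounded maps applied pointwise preserve vanishing at infinity. *)
have van (v : X -> B -> B) (t : T) : (forall x b, `|v x b| <= k * `|b|) ->
    exists t', forall x, c0coord i x t' = v x (c0coord i x t).
  move=> hv; apply: (coord_surj H) => e e0.
  have k1 : 0 < k + 1 by rewrite ltr_wpDl.
  have [xs h] := coord_vanish H t (divr_gt0 e0 k1).
  exists xs => x /h; rewrite ler_pdivlMr// => h'.
  rewrite (le_trans (hv _ _))// (le_trans _ h')// mulrC ler_wpM2l//.
  by rewrite lerDl.
have /choice[L hL] := fun t => van (fun x => mulL (u x)) t hk.
have /choice[Q hQ] := fun t => van (fun x => mulR (u x)) t hk'.
have Ll : linear L.
  move=> a t t'; apply: (coord_inj H) => x.
  by rewrite (coord_linear H) !hL (coord_linear H) mulL_linear.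
have Ql : linear Q.
  move=> a t t'; apply: (coord_inj H) => x.
  by rewrite (coord_linear H) !hQ (coord_linear H) mulR_linear.
have Lb t : `|L t| <= k * `|t|.
  apply: (c0_norm_le H); first by rewrite mulr_ge0.
  move=> x; rewrite hL (le_trans (hk _ _))// ler_wpM2l//; exact: coord_norm.
have Qb t : `|Q t| <= k * `|t|.
  apply: (c0_norm_le H); first by rewrite mulr_ge0.
  move=> x; rewrite hQ (le_trans (hk' _ _))// ler_wpM2l//; exact: coord_norm.
have LM t t' : L (t ⋅ t') = L t ⋅ t'.
  by apply: (coord_inj H) => x; rewrite hL !(coord_smul H) hL mulL_smul.
have QM t t' : Q (t ⋅ t') = t ⋅ Q t'.
  by apply: (coord_inj H) => x; rewrite hQ !(coord_smul H) hQ mulR_smul.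
have QL t t' : Q t ⋅ t' = t ⋅ L t'.
  by apply: (coord_inj H) => x; rewrite !(coord_smul H) hL hQ mulRL.
exists (Multiplier Ll Ql (ex_intro _ k Lb) (ex_intro _ k Qb) LM QM QL) => x.
apply: mcoord_unique => b /=; apply: (coord_inj H) => y; rewrite hL.
have [->|yx] := eqVneq y x; first by rewrite !(coord_in H).
by rewrite !(coord_out H)// (linf0 (mulL_linear _)).
Qed.

Lemma mcoord_strict_cvg x Z (F : set_system Z) {FF : Filter F}
    (S : Z -> multiplier T) m :
  strict_cvg (S z @[z --> F]) m -> strict_cvg (mcoord i x (S z) @[z --> F]) (mcoord i x m).
Proof.
move=> Sm b; split.
  rewrite -(coord_in H x (mulL _ b)) -mcoordL.
  apply: (@cvg_ext _ _ _ F _ (fun z => c0coord i x (mulL (S z) (i x b)))).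
    by move=> z; rewrite mcoordL (coord_in H).
  by apply: (coord_cvg H); exact: strict_cvgL.
rewrite -(coord_in H x (mulR _ b)) -mcoordR.
apply: (@cvg_ext _ _ _ F _ (fun z => c0coord i x (mulR (S z) (i x b)))).
  by move=> z; rewrite mcoordR (coord_in H).
by apply: (coord_cvg H); exact: strict_cvgR.
Qed.

Lemma mcoord_mult_strict x : mult_strict (mcoord i x).
Proof.
move=> F m FF _ _ Fm.
exact: (@mcoord_strict_cvg x _ F _ id m Fm).
Qed.

Let cvg_fin Z (F : set_system Z) {FF : Filter F} (f : Z -> T -> T) (g : T -> T)
    (s : seq (X * B)) : (forall z, linear (f z)) -> linear g ->
  (forall x b, f z (i x b) @[z --> F] --> g (i x b)) ->
  f z (\sum_(p <- s) i p.1 p.2) @[z --> F] --> g (\sum_(p <- s) i p.1 p.2).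
Proof.
move=> fl gl h; elim: s => [|p s IH].
  rewrite big_nil (linf0 gl); apply: (@cvg_ext _ _ _ F _ (fun=> 0)).
    by move=> z; rewrite (linf0 (fl z)).
  exact: cvg_cst.
rewrite big_cons (linfD gl).
apply: (@cvg_ext _ _ _ F _ (fun z => f z (i p.1 p.2) + f z (\sum_(p <- s) i p.1 p.2))).
  by move=> z; rewrite (linfD (fl z)).
exact: cvg_add.
Qed.

(** On bounded nets strict convergence is entrywise: the bound [k] allows testing on finite sums,
    each of which involves finitely many entries. *)
Lemma strict_cvg_mcoord Z (F : set_system Z) {FF : Filter F}
    (S : Z -> multiplier T) m (k : K) : 0 <= k ->
  (\forall z \near F, forall t, `|mulL (S z) t| <= k * `|t|) ->
  (forall t, `|mulL m t| <= k * `|t|) ->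
  (forall x, strict_cvg (mcoord i x (S z) @[z --> F]) (mcoord i x m)) ->
  strict_cvg (S z @[z --> F]) m.
Proof.
move=> k0 hk mk Sm t; have ic x (h : Z -> B) l : h z @[z --> F] --> l ->
    i x (h z) @[z --> F] --> i x l.
  by apply: (linear_cvg (k := 1)) => // b; rewrite mul1r (c0_normE H).
split.
  apply: (dense_cvg (f := fun z => mulL (S z)) k0 _ (mulL_linear m) hk mk).
    by move=> z; exact: mulL_linear.
  move=> x e e0; have [s hs] := c0_dense H x e0.
  exists (\sum_(p <- s) i p.1 p.2) => //; apply: (cvg_fin (f := fun z => mulL (S z)) (g := mulL m)).
  - by move=> z; exact: mulL_linear.
  - exact: mulL_linear.
  move=> y b; rewrite mcoordL.
  apply: (@cvg_ext _ _ _ F _ (fun z => i y (mulL (mcoord i y (S z)) b))).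
    by move=> z; rewrite mcoordL.
  by apply: ic; exact: strict_cvgL (Sm y) b.
have hk' : \forall z \near F, forall t, `|mulR (S z) t| <= k * `|t|.
  by apply: filterS hk => z; exact: mulR_bd_of.
apply: (dense_cvg (f := fun z => mulR (S z)) k0 _ (mulR_linear m) hk' (mulR_bd_of k0 mk)).
  by move=> z; exact: mulR_linear.
move=> x e e0; have [s hs] := c0_dense H x e0.
exists (\sum_(p <- s) i p.1 p.2) => //; apply: (cvg_fin (f := fun z => mulR (S z)) (g := mulR m)).
- by move=> z; exact: mulR_linear.
- exact: mulR_linear.
move=> y b; rewrite mcoordR.
apply: (@cvg_ext _ _ _ F _ (fun z => i y (mulR (mcoord i y (S z)) b))).
  by move=> z; rewrite mcoordR.
by apply: ic; exact: strict_cvgR (Sm y) b.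
Qed.

End C0SumMultipliers.

(** * Maps between such algebras, and tensor products with [C_0(X)] *)

Section C0SumMaps.
Context {R : realType}.
Local Notation K := R[i].

Lemma mult_strict_c0_eq (B T A : cstarType R) (X : eqType) (i : X -> B -> T)
    (h h' : multiplier T -> multiplier A) : c0_sum i ->
  linear h -> linear h' -> mult_strict h -> mult_strict h' ->
  (forall x b, h (embM (i x b)) = h' (embM (i x b))) -> h = h'.
Proof.
move=> H hl h'l hs h's hh'; apply/funext; apply: mult_strict_eq => // t e e0.
have [s hs'] := c0_dense H t e0; exists (\sum_(p <- s) i p.1 p.2) => //.
have [el _ _] := embM_starhom (A := T).
rewrite (linf_sum el) (linf_sum hl) (linf_sum h'l).
by apply: eq_bigr => p _; exact: hh'.
Qed.

(** Produces the candidates for [hom_tens] and [massoc] from their entries [d y]. The constant [q]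
    has to be uniform in [y], for the entries to form a multiplier and for strictness to be testable
    entrywise. *)
Lemma c0_family_hom (T T' B' : cstarType R) (Y : eqType) (j : Y -> B' -> T')
    (d : Y -> multiplier T -> multiplier B') (q : K) : c0_sum j -> 0 <= q ->
  (forall y, starhom (d y)) -> (forall y, mult_strict (d y)) ->
  (forall y m k, 0 <= k -> (forall t, `|mulL m t| <= k * `|t|) ->
     forall b, `|mulL (d y m) b| <= q * k * `|b|) ->
  exists h : multiplier T -> multiplier T',
    [/\ starhom h, mult_strict h & forall y m, mcoord j y (h m) = d y m].
Proof.
move=> H q0 dhom ds db.
have /choice[h hh] : forall m, exists m', forall y, mcoord j y m' = d y m.
  move=> m; have [k k0 hk] := mulL_bd m.
  by apply: (mcoord_surj H (k := q * k)); [rewrite mulr_ge0|move=> y; exact: db].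
have jh y := mcoord_starhom H y.
exists h; split=> //.
  split=> [a m n|m n|m]; apply: (mcoord_inj H) => y; rewrite hh.
  - by have [dl _ _] := dhom y; rewrite dl (mcoord_linear H) !hh.
  - by have [_ dM _] := dhom y; have [_ jM _] := jh y; rewrite dM jM !hh.
  - by have [_ _ dS] := dhom y; have [_ _ jS] := jh y; rewrite dS jS !hh.
move=> F m FF Fb mb Fm.
have b1 n : mult_unit_ball n -> forall t, `|mulL (h n) t| <= q * 1 * `|t|.
  move=> nb; apply: (bound_mcoord H); first by rewrite mulr1.
  by move=> y b; rewrite hh; apply: db => // t; rewrite mul1r.
apply: (@strict_cvg_mcoord _ _ _ _ _ H _ F _ h _ (q * 1)).
- by rewrite mulr1.
- by apply: filterS Fb => n; exact: b1.
- exact: b1.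
move=> y; rewrite hh; apply: (strict_cvg_ext (S := d y)) => [n|]; first by rewrite hh.
exact: ds.
Qed.

Section Approximation.
Variables (V : normedModType K).

(** Membership in a closed linear span: the families used below carry scalars in their index, so
    plain finite sums suffice. *)
Definition approximable (I : Type) (g : I -> V) (v : V) : Prop :=
  forall e, 0 < e -> exists s : seq I, `|v - \sum_(p <- s) g p| <= e.

Lemma approximable_closed I (g : I -> V) v :
  (forall e, 0 < e -> exists2 w, approximable g w & `|v - w| <= e) -> approximable g v.
Proof.
move=> h e e0; have e2 := divr_gt0 e0 (ltr0n _ 2).
have [w gw vw] := h _ e2; have [s hs] := gw _ e2; exists s.
by rewrite -(subrKA w) [leRHS]splitr (le_trans (ler_normD _ _))// lerD.
Qed.

Lemma approximable_sum I (g : I -> V) J (s : seq J) (v : J -> V) :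
  (forall p, approximable g (v p)) -> approximable g (\sum_(p <- s) v p).
Proof.
move=> gv; elim: s => [|p s IH] e e0.
  by exists [::]; rewrite !big_nil subrr normr0 ltW.
have e2 := divr_gt0 e0 (ltr0n _ 2).
have [s1 h1] := gv p _ e2; have [s2 h2] := IH _ e2; exists (s1 ++ s2).
rewrite big_cons big_cat /= opprD addrACA [leRHS]splitr.
by rewrite (le_trans (ler_normD _ _))// lerD.
Qed.

Lemma approximable_trans I J (g : I -> V) (g' : J -> V) v :
  approximable g v -> (forall p, approximable g' (g p)) -> approximable g' v.
Proof.
move=> gv gg'; apply: approximable_closed => e e0.
by have [s hs] := gv e e0; exists (\sum_(p <- s) g p) => //; exact: approximable_sum.
Qed.

End Approximation.

Lemma approximable_map (V W : normedModType K) I J (g : I -> V) (g' : J -> W)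
    (f : V -> W) (k : K) v : linear f -> 0 <= k -> (forall x, `|f x| <= k * `|x|) ->
  (forall p, exists q, g' q = f (g p)) -> approximable g v -> approximable g' (f v).
Proof.
move=> fl k0 fk /choice[r hr] gv e e0.
have k1 : 0 < k + 1 by rewrite ltr_wpDl.
have [s hs] := gv _ (divr_gt0 e0 k1); exists (map r s).
have -> : \sum_(q <- map r s) g' q = f (\sum_(p <- s) g p).
  by rewrite (linf_sum fl) big_map; apply: eq_bigr.
rewrite -(linfB fl) (le_trans (fk _))//.
apply: (@le_trans _ _ ((k + 1) * `|v - \sum_(p <- s) g p|)).
  by rewrite ler_wpM2r// lerDl.
by rewrite mulrC -ler_pdivlMr.
Qed.

(** Abstracts the point masses [chi x] of [C_0(X)], so that the products [chi g ⊗ chi h] in [A ⊗ A]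
    are covered too. *)
Record c0_basis (D : cstarType R) (X : eqType) (e : X -> D) : Prop := {
  basis_smul : forall x, e x ⋅ e x = e x;
  basis_orth : forall x y, x != y -> e x ⋅ e y = 0;
  basis_star : forall x, star (e x) = e x;
  basis_norm : forall x, `|e x| = 1;
  basis_dense : forall d, approximable (fun p : K * X => p.1 *: e p.2) d
}.

Lemma basis_linear_eq (D : cstarType R) (X : eqType) (e : X -> D) (W : normedModType K)
    (f g : D -> W) (k l : K) : c0_basis e -> linear f -> linear g ->
  (forall x, `|f x| <= k * `|x|) -> (forall x, `|g x| <= l * `|x|) ->
  (forall x, f (e x) = g (e x)) -> f =1 g.
Proof.
move=> He fl gl fk gk' fg; apply: (dense_linear_eq fl gl fk gk') => d r r0.
have [s hs] := basis_dense He d r0; exists (\sum_(p <- s) p.1 *: e p.2) => //.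
rewrite (linf_sum fl) (linf_sum gl); apply: eq_bigr => p _.
by rewrite (linfZ fl) (linfZ gl) fg.
Qed.

Section Tensor.
Variables (B D T : cstarType R) (t : B -> D -> T).
Hypothesis Ht : is_cstar_tensor t.

Let tl d : linear (t^~ d) := cstar_tensor_linearl Ht d.
Let tr b : linear (t b) := cstar_tensor_linearr Ht b.

Lemma tensor_zl d : t 0 d = 0. Proof. exact: linf0 (tl d). Qed.
Lemma tensor_zr b : t b 0 = 0. Proof. exact: linf0 (tr b). Qed.
Lemma tensor_scalel a b d : t (a *: b) d = a *: t b d.
Proof. exact: (linfZ (tl d)). Qed.
Lemma tensor_scaler a b d : t b (a *: d) = a *: t b d.
Proof. exact: (linfZ (tr b)). Qed.

Lemma tensor_dense u : approximable (fun p : B * D => t p.1 p.2) u.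
Proof.
move=> e e0.
have [|v [uv [n [a [b ve]]]]] := cstar_tensor_dense Ht (O := ball u e) _ (ball_open u e).
  by exists u; exact: ballxx.
exists [seq (a k, b k) | k <- enum 'I_n].
rewrite big_map big_enum /=; by apply: ltW; move: uv; rewrite -ball_normE ve.
Qed.

Lemma tensor_c0_sum (X : eqType) (e : X -> D) : c0_basis e ->
  c0_sum (fun x b => t b (e x)).
Proof.
move=> He; split.
- by move=> x; exact: tl.
- by move=> x b b'; rewrite -(cstar_tensor_mul Ht) (basis_smul He).
- by move=> x b; rewrite -(cstar_tensor_star Ht) (basis_star He).
- by move=> x y b b' xy; rewrite -(cstar_tensor_mul Ht) (basis_orth He)// tensor_zr.
- by move=> x b; rewrite (cstar_tensor_norm Ht) (basis_norm He) mulr1.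
move=> u; suff : approximable (fun p : X * B => t p.2 (e p.1)) u by exact.
apply: approximable_trans (tensor_dense u) _ => -[b d] /=.
apply: (approximable_map (f := t b) (k := `|b|)) (basis_dense He d) => //.
  by move=> x; rewrite (cstar_tensor_norm Ht).
by move=> -[a x]; exists (x, a *: b); rewrite /= tensor_scalel tensor_scaler.
Qed.

Lemma tensor_basis (X Y : eqType) (e : X -> B) (e' : Y -> D) :
  c0_basis e -> c0_basis e' -> c0_basis (fun p : X * Y => t (e p.1) (e' p.2)).
Proof.
move=> He He'; split.
- by move=> p; rewrite -(cstar_tensor_mul Ht) (basis_smul He) (basis_smul He').
- move=> [x y] [x' y']; rewrite xpair_eqE negb_and -(cstar_tensor_mul Ht) /=.
  by case/orP => h; [rewrite (basis_orth He)// tensor_zl|rewrite (basis_orth He')// tensor_zr].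
- by move=> p; rewrite -(cstar_tensor_star Ht) (basis_star He) (basis_star He').
- by move=> p; rewrite (cstar_tensor_norm Ht) (basis_norm He) (basis_norm He') mulr1.
move=> u; have := c0_dense (tensor_c0_sum He') u.
move=> /(approximable_trans (g := fun p : Y * B => t p.2 (e' p.1))); apply.
move=> [y b] /=; apply: (approximable_map (f := t^~ (e' y)) (k := 1)) (basis_dense He b) => //.
  by move=> x; rewrite (cstar_tensor_norm Ht) (basis_norm He') mulr1 mul1r.
by move=> -[a x]; exists (a, (x, y)); rewrite /= tensor_scalel.
Qed.

End Tensor.

(** Turns [(C ⊗ A) ⊗ A] into an algebra of [C]-valued functions on [G × G], comparable entry by
    entry with [C ⊗ (A ⊗ A)]. *)
Lemma c0_sum_comp (B T S : cstarType R) (X Y : eqType) (i : X -> B -> T)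
    (j : Y -> T -> S) : c0_sum i -> c0_sum j ->
  c0_sum (fun (p : X * Y) b => j p.2 (i p.1 b)).
Proof.
move=> Hi Hj; split.
- by move=> p a b c; rewrite (c0_lin Hi) (c0_lin Hj).
- by move=> p b c; rewrite (c0_smul Hi) (c0_smul Hj).
- by move=> p b; rewrite (c0_starE Hi) (c0_starE Hj).
- move=> [x y] [x' y'] b c; rewrite xpair_eqE negb_and /=.
  have [<-|yy' _] := eqVneq y y'; last by rewrite (c0_orth Hj).
  by rewrite orbF => xx'; rewrite -(c0_smul Hj) (c0_orth Hi)// (linf0 (c0_lin Hj y)).
- by move=> p b; rewrite (c0_normE Hj) (c0_normE Hi).
move=> u; have := c0_dense Hj u.
move=> /(approximable_trans (g := fun p : Y * T => j p.1 p.2)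
   (g' := fun p : X * Y * B => j p.1.2 (i p.1.1 p.2))); apply.
move=> [y v] /=; apply: (approximable_map (g := fun p : X * B => i p.1 p.2) (k := 1)).
- exact: c0_lin Hj y.
- by [].
- by move=> x; rewrite (c0_normE Hj) mul1r.
- by move=> -[x b]; exists ((x, y), b).
- exact: c0_dense Hi v.
Qed.

(** For a diagonal [m] the entries [c x *: S] are uniformly bounded, so they define a multiplier; it
    meets the description of [S ⊗ m] on the basis, hence everywhere by density. *)
Lemma mtensP (B D : cstarType R) (BD : min_tensor B D) (X : eqType) (e : X -> D)
    (S : multiplier B) (m : multiplier D) (c : X -> K) : c0_basis e ->
  (forall x, mulL m (e x) = c x *: e x) -> (forall x, mulR m (e x) = c x *: e x) ->
  forall x, mcoord (fun x b => tens BD b (e x)) x (mtens BD S m) = c x *: S.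
Proof.
move=> He mL mR; have Ht := tensP BD; have H := tensor_c0_sum Ht He.
have [k k0 hk] := mulL_bd S; have [l l0 hl] := mulL_bd m.
have cl x : `|c x| <= l.
  by have := hl (e x); rewrite mL normrZ (basis_norm He) !mulr1.
have [n hn] : exists n, forall x, mcoord (fun x b => tens BD b (e x)) x n = c x *: S.
  apply: (mcoord_surj H (k := l * k)); first by rewrite mulr_ge0.
  move=> x b; rewrite mulLZ normrZ (le_trans (ler_wpM2l _ (hk _)))//.
  by rewrite mulrA ler_wpM2r// ler_wpM2r.
have [p p0 hp] := mulL_bd n.
have nP : forall a b, mulL n (tens BD a b) = tens BD (mulL S a) (mulL m b) /\
    mulR n (tens BD a b) = tens BD (mulR S a) (mulR m b).
  move=> a b; split.
    apply: (basis_linear_eq (f := fun b => mulL n (tens BD a b))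
      (g := fun b => tens BD (mulL S a) (mulL m b)) (k := p * `|a|)
      (l := `|mulL S a| * l) He).
    - by move=> z x y; rewrite (cstar_tensor_linearr Ht) mulL_linear.
    - by move=> z x y; rewrite mulL_linear (cstar_tensor_linearr Ht).
    - by move=> x; rewrite (le_trans (hp _))// (cstar_tensor_norm Ht) mulrA.
    - by move=> x; rewrite (cstar_tensor_norm Ht) -mulrA ler_wpM2l.
    - move=> x; rewrite (mcoordL H x) hn mL (tensor_scaler Ht) mulLZ.
      by rewrite (tensor_scalel Ht).
  apply: (basis_linear_eq (f := fun b => mulR n (tens BD a b))
    (g := fun b => tens BD (mulR S a) (mulR m b)) (k := p * `|a|)
    (l := `|mulR S a| * l) He).
  - by move=> z x y; rewrite (cstar_tensor_linearr Ht) mulR_linear.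
  - by move=> z x y; rewrite mulR_linear (cstar_tensor_linearr Ht).
  - by move=> x; rewrite (le_trans (mulR_bd_of p0 hp _))// (cstar_tensor_norm Ht) mulrA.
  - move=> x; rewrite (cstar_tensor_norm Ht) -mulrA ler_wpM2l//.
    exact: mulR_bd_of.
  - move=> x; rewrite (mcoordR H x) hn mR (tensor_scaler Ht) mulRZ.
    by rewrite (tensor_scalel Ht).
have mP : [set n' : multiplier BD | forall a b,
    mulL n' (tens BD a b) = tens BD (mulL S a) (mulL m b) /\
    mulR n' (tens BD a b) = tens BD (mulR S a) (mulR m b)] (mtens BD S m).
  by apply: xgetPex; exists n.
move=> x; apply: (mcoord_unique H) => b; rewrite (mP b (e x)).1 mL mulLZ.
by rewrite (tensor_scaler Ht) (tensor_scalel Ht).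
Qed.

End C0SumMaps.

(** * Coactions of C_0(G) *)

Section C0Basis.
Context {R : realType} {X : choiceType}.
Implicit Types (f : C0 R X) (x y : X).

Lemma C0_ext f f' : (forall x, f x = f' x) -> f = f'.
Proof. by move=> e; apply/val_inj/funext. Qed.

Lemma smul_chi f x : f ⋅ chi R x = f x *: chi R x.
Proof.
apply: C0_ext => y; rewrite -[LHS]/(f y * (`[< y = x >])%:R).
rewrite -[RHS]/(f x * (`[< y = x >])%:R).
by case: asboolP => [->//|_]; rewrite !mulr0.
Qed.

Lemma chi_smul f x : chi R x ⋅ f = f x *: chi R x.
Proof.
rewrite -smul_chi; apply: C0_ext => y.
by rewrite -[LHS]/(chi R x y * f y) mulrC.
Qed.

Lemma chiE x y : chi R x y = (x == y)%:R.
Proof.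
rewrite -[LHS]/(`[< y = x >])%:R eq_sym.
by case: asboolP => [->|/eqP/negbTE ->]; rewrite ?eqxx.
Qed.

Lemma chi_basis : c0_basis (chi R (X := X)).
Proof.
split.
- by move=> x; rewrite smul_chi chiE eqxx scale1r.
- by move=> x y xy; rewrite smul_chi chiE (negbTE xy) scale0r.
- move=> x; apply: C0_ext => y.
  by rewrite -[LHS]/(Num.conj (chi R x y)) chiE rmorph_nat.
- move=> x; apply/eqP; rewrite eq_le; apply/andP; split.
    apply: c0_normr_le => // y.
    by rewrite chiE normr_nat; case: eqP.
  by have := c0_normr_ub (chi R x) x; rewrite chiE eqxx normr1.
move=> f e e0.
have /asboolP/(_ e e0)/finite_seqP[s hs] := c0_funP f.
exists [seq (f x, x) | x <- undup s]; rewrite big_map /=.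
have sumE (u : seq X) (y : X) : uniq u ->
    (\sum_(x <- u) f x *: chi R x : C0 R X) y = if y \in u then f y else 0.
  elim: u => [_|x u IH /= /andP[xu /IH {}IH]]; first by rewrite big_nil.
  rewrite big_cons -[LHS]/(f x * chi R x y + (\sum_(x <- u) f x *: chi R x : C0 R X) y).
  rewrite IH chiE inE eq_sym; have [->|yx] := eqVneq y x; last by rewrite mulr0 add0r.
  by rewrite (negbTE xu) mulr1 addr0.
apply: c0_normr_le; first exact: ltW.
move=> y; rewrite -[X in `|X|]/(f y - (\sum_(x <- undup s) f x *: chi R x : C0 R X) y).
rewrite sumE ?undup_uniq// mem_undup.
case: ifPn => [_|ys]; first by rewrite subrr normr0 ltW.
rewrite subr0; have [h|h] := boolP (e <= `|f y|).
  by have : [set x | e <= `|f x|] y by []; rewrite hs /= (negbTE ys).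
by rewrite ltW// real_ltNge ?normr_real ?gtr0_real.
Qed.

End C0Basis.

Section Coactions.
Context {R : realType} {G : groupType} {C : cstarType R}.
Local Notation A := (C0 R G).
Local Notation K := R[i].
Variables (CA : min_tensor C A) (AA : min_tensor A A)
  (CA_A : min_tensor CA A) (C_AA : min_tensor C AA).

(* The summand [(g, h)] of [(C \otimes A) \otimes A] has its first leg [g] in the inner
   tensor product, as opposed to the summand [h] of [CAA_fib]. *)
Definition CA_at (g : G) (c : C) : CA := tens CA c (chi R g).
Definition CAA_fib (h : G) (t : CA) : CA_A := tens CA_A t (chi R h).
Definition CA_A_at (p : G * G) (c : C) : CA_A := CAA_fib p.2 (CA_at p.1 c).
Definition AA_at (p : G * G) : AA := tens AA (chi R p.1) (chi R p.2).
Definition C_AA_at (p : G * G) (c : C) : C_AA := tens C_AA c (AA_at p).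

Lemma CA_sum : c0_sum CA_at.
Proof. exact: (tensor_c0_sum (tensP CA) chi_basis). Qed.
Lemma CAA_sum : c0_sum CAA_fib.
Proof. exact: (tensor_c0_sum (tensP CA_A) chi_basis). Qed.
Lemma CA_A_sum : c0_sum CA_A_at.
Proof. exact: (c0_sum_comp CA_sum CAA_sum). Qed.
Lemma AA_basis : c0_basis AA_at.
Proof. exact: (tensor_basis (tensP AA) chi_basis chi_basis). Qed.
Lemma C_AA_sum : c0_sum C_AA_at.
Proof. exact: (tensor_c0_sum (tensP C_AA) AA_basis). Qed.

Lemma coord_tens (g : G) c (f : A) : c0coord CA_at g (tens CA c f) = f g *: c.
Proof.
apply: (coord_unique CA_sum) => b.
rewrite /CA_at -(cstar_tensor_mul (tensP CA)) smul_chi.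
by rewrite (tensor_scaler (tensP CA)) smul_scalel (tensor_scalel (tensP CA)).
Qed.

Lemma mcoord_fib (p : G * G) m :
  mcoord CA_A_at p m = mcoord CA_at p.1 (mcoord CAA_fib p.2 m).
Proof.
apply: (mcoord_unique CA_A_sum) => c.
by rewrite (mcoordL CAA_sum) (mcoordL CA_sum).
Qed.

(** The pattern for the maps chosen by [xget]: a candidate meeting the description shows that the
    chosen map meets it too, and strict linear maps agreeing on the summands are equal. *)
Lemma slice_ev (g : G) : slice CA (ev g) = mcoord CA_at g.
Proof.
have Pm : [set h : multiplier CA -> multiplier C | [/\ linear h, mult_strict h &
    forall a b, h (embM (tens CA a b)) = ev g b *: embM a]] (mcoord CA_at g).
  split; [exact: mcoord_linear CA_sum g|exact: mcoord_mult_strict CA_sum g|].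
  move=> a b; rewrite (mcoord_embM CA_sum) coord_tens.
  by have [el _ _] := embM_starhom (A := C); rewrite (linfZ el).
have [sl ss se] : [set h : multiplier CA -> multiplier C | [/\ linear h, mult_strict h &
    forall a b, h (embM (tens CA a b)) = ev g b *: embM a]] (slice CA (ev g)).
  by apply: xgetPex; exists (mcoord CA_at g).
case: Pm => ml ms me.
apply: (mult_strict_c0_eq CA_sum) => // h c.
by rewrite /CA_at se me.
Qed.

Lemma comultP (f : A) (p : G * G) :
  mulL (C0_comult AA f) (AA_at p) = f (p.1 * p.2)%g *: AA_at p /\
  mulR (C0_comult AA f) (AA_at p) = f (p.1 * p.2)%g *: AA_at p.
Proof.
have HA := tensor_c0_sum (tensP AA) (chi_basis (R := R) (X := G)).
(* For fixed [h] the function [f (g * h)] of [g] is a right translate of [f], so it stays in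
   [C_0(G)]; these translates are the entries of the comultiplication. *)
have tr h : (fun g => f (g * h)%g) \in @c0_pred R G.
  apply/asboolP => e e0; have /asboolP/(_ e e0) := c0_funP f.
  move=> /(finite_image (fun x => x * h^-1)%g); apply: sub_finite_set => g /= eg.
  by exists (g * h)%g => //; rewrite mulgK.
pose F h : A := MkC0 (tr h).
have [m hm] : exists m, forall h, mcoord (fun h a => tens AA a (chi R h)) h m = embM (F h).
  apply: (mcoord_surj HA (k := `|f|)) => // h b /=.
  rewrite (le_trans (norm_smul_le _ _))// ler_wpM2r// c0_normr_le// => g.
  exact: (c0_normr_ub f (g * h)%g).
case: p => g h.
have : [set m : multiplier AA | forall g h,
    mulL m (tens AA (chi R g) (chi R h)) = f (g * h)%g *: tens AA (chi R g) (chi R h) /\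
    mulR m (tens AA (chi R g) (chi R h)) = f (g * h)%g *: tens AA (chi R g) (chi R h)]
    (C0_comult AA f).
  apply: xgetPex; exists m => g' h'.
  rewrite (mcoordL HA h') (mcoordR HA h') hm /= smul_chi chi_smul.
  by rewrite (tensor_scalel (tensP AA)).
by move=> /(_ g h).
Qed.

Lemma Cb_multP (u : G -> C) (k : K) (g : G) : (forall g, `|u g| <= k) ->
  mcoord CA_at g (Cb_mult CA u) = embM (u g).
Proof.
move=> uk; have k0 : 0 <= k by rewrite (le_trans _ (uk g)).
have [m hm] : exists m, forall h, mcoord CA_at h m = embM (u h).
  apply: (mcoord_surj CA_sum (k := k)) => // h b /=.
  by rewrite (le_trans (norm_smul_le _ _))// ler_wpM2r.
have mP : [set m : multiplier CA | forall c g,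
    mulL m (tens CA c (chi R g)) = tens CA (u g ⋅ c) (chi R g) /\
    mulR m (tens CA c (chi R g)) = tens CA (c ⋅ u g) (chi R g)] (Cb_mult CA u).
  apply: xgetPex; exists m => c h.
  by rewrite -/(CA_at h c) (mcoordL CA_sum) (mcoordR CA_sum) hm.
by apply: (mcoord_unique CA_sum) => c; rewrite /CA_at (mP c g).1.
Qed.

Lemma mtens_one_embM (S : multiplier C) (f : A) (g : G) :
  mcoord CA_at g (mtens CA S (embM f)) = f g *: S.
Proof.
apply: (mtensP _ _ (e := chi R (X := G)) (c := f)); first exact: chi_basis.
- by move=> h /=; rewrite smul_chi.
- by move=> h /=; rewrite chi_smul.
Qed.

Section Homs.
Variables (delta : C -> multiplier CA).
Hypotheses (dhom : starhom delta) (dstrict : strict delta).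

Lemma hom_tens_coaction (T : multiplier CA) (h : G) :
  mcoord CAA_fib h (hom_tens CA CA_A delta embM T) =
  strict_ext delta (mcoord CA_at h T).
Proof.
have [[El EM ES] Es Ee Eb] := strict_extP dhom dstrict.
have Ehom : starhom (strict_ext delta) by split.
pose P := [set f : multiplier CA -> multiplier CA_A | [/\ starhom f, mult_strict f &
  forall a b, f (embM (tens CA a b)) = mtens CA_A (delta a) (embM b)]].
have [H [Hhom Hs HP]] : exists H : multiplier CA -> multiplier CA_A,
    [/\ starhom H, mult_strict H
      & forall h T, mcoord CAA_fib h (H T) = strict_ext delta (mcoord CA_at h T)].
  (* 4 is the constant for [strict_ext] in [strict_extP]. *)
  apply: (c0_family_hom CAA_sum (q := 4)).
  - by [].
  - move=> g; have [ml mM mS] := mcoord_starhom CA_sum g.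
    split=> [a m n|m n|m]; first by rewrite ml El.
      by rewrite mM EM.
    by rewrite mS ES.
  - move=> g F m FF Fb mb Fm.
    apply: (Es (mcoord CA_at g n @[n --> F]) (mcoord CA_at g m)).
    + suff : F (mcoord CA_at g @^-1` @mult_unit_ball R C) by [].
      by apply: filterS Fb => n; exact: (mcoord_unit_ball CA_sum g).
    + exact: (mcoord_unit_ball CA_sum).
    + exact: (@mcoord_strict_cvg _ _ _ _ _ CA_sum g _ F _ id m Fm).
  - move=> g m k k0 hk; apply: Eb => //; exact: (mcoord_bound CA_sum).
have PH : P H.
  split=> // a b; apply: (mcoord_inj CAA_sum) => g.
  rewrite HP (mcoord_embM CA_sum) coord_tens Ee.
  have [dl _ _] := dhom; rewrite (linfZ dl); apply/esym.
  apply: (mtensP _ _ (e := chi R (X := G)) (c := b)); first exact: chi_basis.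
  - by move=> x /=; rewrite smul_chi.
  - by move=> x /=; rewrite chi_smul.
have [[tl _ _] ts te] : P (hom_tens CA CA_A delta embM) by apply: xgetPex; exists H.
case: PH Hhom => [_ _ He] [Hl _ _].
rewrite (_ : hom_tens CA CA_A delta embM = H)//.
apply: (mult_strict_c0_eq CA_sum) => // g c.
by rewrite /CA_at te He.
Qed.

End Homs.

Lemma hom_tens_comult (T : multiplier CA) (p : G * G) :
  mcoord C_AA_at p (hom_tens CA C_AA embM (C0_comult AA) T) =
  mcoord CA_at (p.1 * p.2)%g T.
Proof.
pose P := [set f : multiplier CA -> multiplier C_AA | [/\ starhom f, mult_strict f &
  forall a b, f (embM (tens CA a b)) = mtens C_AA (embM a) (C0_comult AA b)]].
have [H [Hhom Hs HP]] : exists H : multiplier CA -> multiplier C_AA,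
    [/\ starhom H, mult_strict H
      & forall p T, mcoord C_AA_at p (H T) = mcoord CA_at (p.1 * p.2)%g T].
  apply: (c0_family_hom C_AA_sum (q := 1)).
  - by [].
  - by move=> q; exact: mcoord_starhom CA_sum _.
  - by move=> q; exact: mcoord_mult_strict CA_sum _.
  - by move=> q m k k0 hk b; rewrite mul1r; exact: (mcoord_bound CA_sum).
have PH : P H.
  split=> // a b; apply: (mcoord_inj C_AA_sum) => q.
  rewrite HP (mcoord_embM CA_sum) coord_tens.
  have [el _ _] := embM_starhom (A := C); rewrite (linfZ el); apply/esym.
  apply: (mtensP _ _ (e := AA_at) (c := fun q => b (q.1 * q.2)%g)); first exact: AA_basis.
  - by move=> r; exact: (comultP b r).1.
  - by move=> r; exact: (comultP b r).2.
have [[tl _ _] ts te] : P (hom_tens CA C_AA embM (C0_comult AA)).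
  by apply: xgetPex; exists H.
case: PH Hhom => [_ _ He] [Hl _ _].
rewrite (_ : hom_tens CA C_AA embM (C0_comult AA) = H)//.
apply: (mult_strict_c0_eq CA_sum) => // g c.
by rewrite /CA_at te He.
Qed.

Lemma massocP (T : multiplier C_AA) (p : G * G) :
  mcoord CA_A_at p (massoc CA_A C_AA T) = mcoord C_AA_at p T.
Proof.
pose P := [set f : multiplier C_AA -> multiplier CA_A | [/\ starhom f, mult_strict f &
  forall a b d, f (embM (tens C_AA a (tens AA b d))) = embM (tens CA_A (tens CA a b) d)]].
have [H [Hhom Hs HP]] : exists H : multiplier C_AA -> multiplier CA_A,
    [/\ starhom H, mult_strict H
      & forall p T, mcoord CA_A_at p (H T) = mcoord C_AA_at p T].
  apply: (c0_family_hom CA_A_sum (q := 1)).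
  - by [].
  - by move=> q; exact: mcoord_starhom C_AA_sum _.
  - by move=> q; exact: mcoord_mult_strict C_AA_sum _.
  - by move=> q m k k0 hk b; rewrite mul1r; exact: (mcoord_bound C_AA_sum).
have PH : P H.
  split=> // a b d; apply: (mcoord_inj CA_A_sum) => q.
  rewrite HP (mcoord_embM C_AA_sum) (mcoord_embM CA_A_sum); congr embM.
  transitivity ((b q.1 * d q.2) *: a).
    apply: (coord_unique C_AA_sum) => c.
    rewrite /C_AA_at /AA_at -(cstar_tensor_mul (tensP C_AA)) -(cstar_tensor_mul (tensP AA)).
    rewrite !smul_chi (tensor_scalel (tensP AA)) (tensor_scaler (tensP AA)) scalerA.
    by rewrite (tensor_scaler (tensP C_AA)) smul_scalel (tensor_scalel (tensP C_AA)).
  apply/esym/(coord_unique CA_A_sum) => c.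
  rewrite /CA_A_at /CAA_fib /CA_at -(cstar_tensor_mul (tensP CA_A)).
  rewrite -(cstar_tensor_mul (tensP CA)) !smul_chi (tensor_scaler (tensP CA)).
  rewrite (tensor_scaler (tensP CA_A)) smul_scalel (tensor_scalel (tensP CA)).
  by rewrite !(tensor_scalel (tensP CA_A)) scalerA mulrC.
have [[tl _ _] ts te] : P (massoc CA_A C_AA) by apply: xgetPex; exists H.
case: PH Hhom => [_ _ He] [Hl _ _].
rewrite (_ : massoc CA_A C_AA = H)//.
apply: (mult_strict_c0_eq C_AA_sum) => // g c.
by rewrite /C_AA_at /AA_at te He.
Qed.

(** Entries at [(g, h)] are compared. The outer leg [h] is the one of [delta c] left untouched by
    [delta ⊗ id], so it is read first, and [g] is read after the second application of [delta];
    [id ⊗ Delta] reads the entry at [g * h]. *)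
Lemma coaction_identityP (delta : C -> multiplier CA) (c : C) :
  starhom delta -> strict delta ->
  (hom_tens CA CA_A delta embM (delta c) =
     mtens CA_A (strict_ext delta mone) mone
       ⋅ id_tens_comult CA_A C_AA (C0_comult AA) (delta c)) <->
  (forall g h, mcoord CA_at g (strict_ext delta (mcoord CA_at h (delta c))) =
     mcoord CA_at g (strict_ext delta mone) ⋅ mcoord CA_at (g * h)%g (delta c)).
Proof.
move=> dhom dstrict.
have L g h : mcoord CA_A_at (g, h) (hom_tens CA CA_A delta embM (delta c)) =
    mcoord CA_at g (strict_ext delta (mcoord CA_at h (delta c))).
  by rewrite mcoord_fib /= hom_tens_coaction.
have Q g h : mcoord CA_A_at (g, h) (mtens CA_A (strict_ext delta mone) mone
       ⋅ id_tens_comult CA_A C_AA (C0_comult AA) (delta c)) =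
    mcoord CA_at g (strict_ext delta mone) ⋅ mcoord CA_at (g * h)%g (delta c).
  have [_ mM _] := mcoord_starhom CA_A_sum (g, h).
  rewrite mM massocP hom_tens_comult; congr (_ ⋅ _).
  rewrite mcoord_fib /=; congr (mcoord _ _ _).
  rewrite -[RHS]scale1r.
  apply: (mtensP _ _ (e := chi R (X := G)) (c := fun=> 1)); first exact: chi_basis.
  - by move=> x /=; rewrite scale1r.
  - by move=> x /=; rewrite scale1r.
split=> [e g h|e]; first by rewrite -L e Q.
by apply: (mcoord_inj CA_A_sum) => -[g h]; rewrite L Q e.
Qed.

End Coactions.

(** * Partial actions *)

Section PartialMaps.
Context {R : realType} {C : cstarType R}.

(** Both composition axioms equate a threefold composite with a twofold one. The hypotheses spell
    out equality of domains and of values there. *)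
Lemma pcomp3_eq (D1 D2 D3 E1 E2 : set C) (f1 f2 f3 g1 g2 : C -> C) :
  (forall x, D1 x -> D2 (f1 x) -> D3 (f2 (f1 x)) ->
     [/\ E1 x, E2 (g1 x) & f3 (f2 (f1 x)) = g2 (g1 x)]) ->
  (forall x, E1 x -> E2 (g1 x) -> [/\ D1 x, D2 (f1 x) & D3 (f2 (f1 x))]) ->
  pcomp (partial_map D3 f3) (pcomp (partial_map D2 f2) (partial_map D1 f1)) =
  pcomp (partial_map E2 g2) (partial_map E1 g1).
Proof.
move=> DE ED; apply/funext => x; rewrite /pcomp /partial_map.
have [[x1 x2]|nE] := pselect (E1 x /\ E2 (g1 x)).
  have [d1 d2 d3] := ED x x1 x2; have [_ _ e] := DE x d1 d2 d3.
  by rewrite (asboolT d1) /= (asboolT d2) /= (asboolT d3) (asboolT x1) /= (asboolT x2) e.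
have -> : obind (fun y => if `[< E2 y >] then Some (g2 y) else None)
    (if `[< E1 x >] then Some (g1 x) else None) = None.
  case: asboolP => //= x1; case: asboolP => // x2; by case: nE.
case: asboolP => //= d1; case: asboolP => //= d2; case: asboolP => // d3.
by have [x1 x2 _] := DE x d1 d2 d3; case: nE.
Qed.

Lemma cornerP (p : multiplier C) c : p ⋅ p = p -> corner p c <-> mulL p c = c.
Proof.
move=> pp; split=> [[d _ <-]|<-]; last by exists c.
by rewrite -mulLM pp.
Qed.

(** Commuting with [C] suffices because [C] acts faithfully: [p] is carried across the product with
    a test element [d]. *)
Lemma central_of_mulLR (p : multiplier C) : mulL p =1 mulR p -> forall T, p ⋅ T = T ⋅ p.
Proof.
move=> pLR T; apply: multiplier_eqL => c; rewrite !mulLM; apply: smul_eql => d.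
by rewrite pLR mulRL -mulL_smul -mulRL -pLR mulL_smul.
Qed.

Lemma corner_ideal (p : multiplier C) : central_projection p -> closed_ideal (corner p).
Proof.
move=> [ps pp pc]; split.
- have -> : corner p = mulL (p - mone) @^-1` [set 0].
    have sub c : mulL (p - mone) c = mulL p c - c by rewrite mulLD mulLN.
    apply/seteqP; split=> c h.
      suff : mulL (p - mone) c = 0 by [].
      by rewrite sub (cornerP _ pp).1 ?subrr.
    have : mulL (p - mone) c = 0 by [].
    by rewrite sub => /eqP; rewrite subr_eq0 => /eqP /(cornerP _ pp).
  have [k _ hk] := mulL_bd (p - mone).
  apply: (continuous_closedP _).1.
    by move=> x; exact: (@linear_cvg _ C C _ k _ (nbhs x) _ id x (mulL_linear _) hk).
  exact: accessible_closed_set1 (hausdorff_accessible (@norm_hausdorff _ C)) _.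
- by apply/(cornerP _ pp); rewrite (linf0 (mulL_linear p)).
- move=> a x y /(cornerP _ pp) hx /(cornerP _ pp) hy; apply/(cornerP _ pp).
  by rewrite mulL_linear hx hy.
move=> x y /(cornerP _ pp) hx; split; apply/(cornerP _ pp).
  by rewrite mulL_smul hx.
have := congr1 (fun m => mulL m x) (pc (embM y)); rewrite !mulLM /= => ->.
by rewrite hx.
Qed.

End PartialMaps.

(** * From the entries of a coaction to a partial action *)

Section ActionOfCoaction.
Context {R : realType} {G : groupType} {C : cstarType R}.
Variables (p : G -> multiplier C) (a : G -> C -> C).
Hypotheses (ps : forall g, star (p g) = p g) (pp : forall g, p g ⋅ p g = p g).
Hypotheses (ahom : forall g, starhom (a g)) (a1 : forall c, a 1%g c = c).
Hypothesis (pa : forall g c, mulL (p g) (a g c) = a g c).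
Hypothesis (aa : forall g h c, a g (a h c) = mulL (p g) (a (g * h)%g c)).

Let al g : linear (a g). Proof. by case: (ahom g). Qed.

Let aV g c : a g (a g^-1%g c) = mulL (p g) c.
Proof. by rewrite aa mulgV a1. Qed.

Let aV' g c : a g^-1%g (a g c) = mulL (p g^-1%g) c.
Proof. by rewrite aa mulVg a1. Qed.

(** [mulL (p g)] is the composite [a g \o a g^-1], which commutes with [star]; since [p g] is
    self-adjoint, conjugating by [star] turns its left action into its right action. *)
Let pLR g : mulL (p g) =1 mulR (p g).
Proof.
move=> c; have [_ _ aS] := ahom g; have [_ _ aS'] := ahom g^-1%g.
by rewrite -[p g in RHS]ps mulR_star -!aV aS' aS starK.
Qed.

Lemma coaction_central g : central_projection (p g).
Proof. by split=> //; exact: central_of_mulLR. Qed.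

Let pcomm g h c : mulL (p g) (mulL (p h) c) = mulL (p h) (mulL (p g) c).
Proof. by rewrite -!mulLM; have [_ _ ->] := coaction_central g. Qed.

Let cP g c : corner (p g) c <-> mulL (p g) c = c.
Proof. exact: cornerP. Qed.

Lemma partial_action_of_coaction : disconnected_partial_action p a.
Proof.
split; first exact: coaction_central.
have stay g h c : corner (p g) c -> corner (p g) (mulL (p h) c).
  by move=> /cP e; apply/cP; rewrite pcomm e.
have ain g c : corner (p g) (a g c) by apply/cP.
have aVin g c : corner (p g) c -> a g (a g^-1%g c) = c by move=> /cP e; rewrite aV.
have aVin' g c : corner (p g^-1%g) c -> a g^-1%g (a g c) = c by move=> /cP e; rewrite aV'.
split.
- by move=> g; apply: corner_ideal; exact: coaction_central.
- move=> g; have [_ aM aS] := ahom g; split=> [|k x y _ _|x y _ _|x _] //; last exact: al.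
  split=> [x _|x y /set_mem hx /set_mem hy e|x hx].
  + exact: ain.
  + by rewrite -(aVin' g x hx) e aVin'.
  by exists (a g^-1%g x); [exact: ain|exact: aVin].
- split=> //; apply/seteqP; split=> // c _; apply/cP.
  by have := pa 1%g c; rewrite a1.
- move=> g h; apply: pcomp3_eq; rewrite invgK => x.
    (* Memberships are obtained by writing an element of a corner as [a k^-1 (a k x)] and merging
       consecutive factors by [aa]: the result is a value of [a] at the product, cut by a further
       projection that [stay] allows. *)
    move=> hx hax _; split.
    + rewrite -(aVin' h x hx) -(aVin' g _ hax) aa -invgM.
      exact: stay.
    + rewrite -(aVin' h x hx) aa -mulgA mulgV mulg1; exact: stay.
    by rewrite aV' [RHS]aa mulgA mulVg mul1g.
  move=> hx hax; split=> //.
  + rewrite -(aVin' _ _ hx) -(aVin _ _ hax) aa invgM -mulgA mulVg mulg1; exact: stay.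
  + by rewrite -(aVin' _ _ hx) aa invgM mulgA mulgV mul1g; exact: stay.
move=> g h; apply: pcomp3_eq; rewrite invgK => x.
  move=> hx _; rewrite (aVin h x hx) => hgx; split=> //.
    by rewrite -(aVin' g x hgx) aa -invgM; exact: stay.
  have gx : corner (p (g * h)%g) (a g x).
    by rewrite -(aVin h x hx) aa; exact: stay.
  by rewrite aa -mulgA mulgV mulg1 ((cP _ _).1 gx).
move=> hx hax; split=> //.
by rewrite -(aVin' _ _ hax) aa invgM mulgA mulgV mul1g; exact: stay.
Qed.

End ActionOfCoaction.

(** * From a partial action to a coaction *)

Section CoactionOfAction.
Context {R : realType} {G : groupType} {C : cstarType R}.
Local Notation K := R[i].

Lemma pcomp3_eqE (D1 D2 D3 E1 E2 : set C) (f1 f2 f3 g1 g2 : C -> C) :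
  pcomp (partial_map D3 f3) (pcomp (partial_map D2 f2) (partial_map D1 f1)) =
  pcomp (partial_map E2 g2) (partial_map E1 g1) ->
  (forall x, D1 x -> D2 (f1 x) -> D3 (f2 (f1 x)) ->
     [/\ E1 x, E2 (g1 x) & f3 (f2 (f1 x)) = g2 (g1 x)]) /\
  (forall x, E1 x -> E2 (g1 x) -> [/\ D1 x, D2 (f1 x) & D3 (f2 (f1 x))]).
Proof.
move=> /(congr1 (@^~ _)) e; split=> x.
  move=> d1 d2 d3; have := e x; rewrite /pcomp /partial_map.
  rewrite (asboolT d1) /= (asboolT d2) /= (asboolT d3).
  by case: asboolP => //= x1; case: asboolP => //= x2 [].
move=> x1 x2; have := e x; rewrite /pcomp /partial_map.
rewrite (asboolT x1) /= (asboolT x2).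
by case: asboolP => //= d1; case: asboolP => //= d2; case: asboolP.
Qed.

Variables (p : G -> multiplier C) (theta : G -> C -> C).
Hypothesis act : disconnected_partial_action p theta.

(** [theta g] extended by zero on the complementary ideal [(1 - p g^-1) C]: a *-endomorphism of all
    of [C]. *)
Definition act_ext g c : C := theta g (mulL (p g^-1%g) c).
Local Notation b := act_ext.

Let ps g : star (p g) = p g. Proof. by case: (act.1 g). Qed.
Let pp g : p g ⋅ p g = p g. Proof. by case: (act.1 g). Qed.
Let pc g T : p g ⋅ T = T ⋅ p g. Proof. by case: (act.1 g). Qed.
Let pP g c : corner (p g) c <-> mulL (p g) c = c. Proof. exact: cornerP. Qed.

Let pLR g c : mulL (p g) c = mulR (p g) c.
Proof.
apply: smul_eql => d; rewrite mulRL.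
by have := congr1 (fun m => mulL m d) (pc g (embM c)); rewrite !mulLM /= => <-; rewrite mulL_smul.
Qed.

Let pstar g c : mulL (p g) (star c) = star (mulL (p g) c).
Proof. by rewrite -{1}(ps g) mulL_star starK pLR. Qed.

Let pmulr g c d : c ⋅ mulL (p g) d = mulL (p g) (c ⋅ d).
Proof. by rewrite -mulRL -pLR mulL_smul. Qed.

Let pK g c : mulL (p g) (mulL (p g) c) = mulL (p g) c.
Proof. by rewrite -mulLM pp. Qed.

Let pin g c : corner (p g) (mulL (p g) c). Proof. by apply/pP. Qed.

Let th_fix g c : corner (p g^-1%g) c -> theta g c = b g c.
Proof. by move=> /pP e; rewrite /b e. Qed.

Let bhom g : starhom (b g).
Proof.
have [_ [_ iso _ _ _]] := act; have [_ thl thM thS] := iso g.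
split=> [k x y|x y|x]; rewrite /b.
- by rewrite mulL_linear thl.
- by rewrite -thM// mulL_smul pmulr mulL_smul pK.
- by rewrite pstar thS.
Qed.

Let bl g : linear (b g). Proof. by case: (bhom g). Qed.
Let bM g x y : b g (x ⋅ y) = b g x ⋅ b g y. Proof. by case: (bhom g). Qed.
Let bS g x : b g (star x) = star (b g x). Proof. by case: (bhom g). Qed.

Let bin g c : corner (p g) (b g c).
Proof.
have [_ [_ iso _ _ _]] := act; have [[thin _ _] _ _ _] := iso g.
exact: thin (pin _ _).
Qed.

Let th_inj g x y : corner (p g^-1%g) x -> corner (p g^-1%g) y ->
  theta g x = theta g y -> x = y.
Proof.
have [_ [_ iso _ _ _]] := act; have [[_ thi _] _ _ _] := iso g.
by move=> hx hy; apply: thi; rewrite inE.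
Qed.

Let p1 c : mulL (p 1%g) c = c.
Proof.
have [_ [_ _ [D1 _] _ _]] := act; apply/pP.
by have : [set: C] c by []; rewrite -D1.
Qed.

Lemma act_ext1 c : b 1%g c = c.
Proof. by have [_ [_ _ [_ th1] _ _]] := act; rewrite /b th1 invg1 p1. Qed.

(** The first composition axiom at [h = g^-1] gives [theta g^-1 (theta g (theta g^-1 x)) = theta
    g^-1 x]; cancel the injective [theta g^-1]. *)
Let thK g x : corner (p g) x -> theta g (theta g^-1%g x) = x.
Proof.
move=> hx; have [_ [_ _ [_ th1] /(_ g g^-1%g)/pcomp3_eqE[e _] _]] := act.
have hx' : corner (p g^-1%g^-1%g) x by rewrite invgK.
have h1 : corner (p g^-1%g) (theta g^-1%g x) by rewrite th_fix.
have h2 : corner (p g) (theta g (theta g^-1%g x)) by rewrite th_fix.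
have h2' : corner (p g^-1%g^-1%g) (theta g (theta g^-1%g x)) by rewrite invgK.
have [_ _] := e x hx' h1 h2'; rewrite mulgV th1; exact: th_inj.
Qed.

Lemma act_extV g c : b g (b g^-1%g c) = mulL (p g) c.
Proof.
rewrite -[RHS](thK (pin g c)) -(th_fix (bin g^-1%g c)).
by rewrite /b invgK.
Qed.

Let bV g c : b g^-1%g (b g c) = mulL (p g^-1%g) c.
Proof. by have := act_extV g^-1%g c; rewrite invgK. Qed.

Lemma act_ext_in g c : mulL (p g) (b g c) = b g c. Proof. exact/pP. Qed.

(** Both products lie in [p k^-1 C], where [b k] is injective. Their images agree because [q] can be
    moved from [b k c] onto [b k x], which it fixes. *)
Let coext k (q : multiplier C) c c1 x : (forall c d, c ⋅ mulL q d = mulL q c ⋅ d) ->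
  mulL (p k^-1%g) c1 = c1 -> b k c1 = mulL q (b k c) ->
  mulL (p k^-1%g) x = x -> mulL q (b k x) = b k x -> c1 ⋅ x = c ⋅ x.
Proof.
move=> qc h1 e1 hx ex.
have e2 : b k (c1 ⋅ x) = b k (c ⋅ x) by rewrite !bM e1 -qc ex.
by rewrite -hx !pmulr -!bV e2.
Qed.

(* Both sides are the image under [b (g * h)] of the component of [c] in the ideal
   where [theta g \o theta h] and [theta (g * h)] are both defined; the axioms make
   the two descriptions of this ideal agree, and [coext] shows that the component
   acts on the ideal as [c] does. *)
Lemma act_extM g h c : b g (b h c) = mulL (p g) (b (g * h)%g c).
Proof.
have [_ [_ _ _ /(_ g h)/pcomp3_eqE[LR RL] _]] := act.
rewrite invgK in LR RL.
have qc g' d d' : d ⋅ mulL (p g') d' = mulL (p g') d ⋅ d' by rewrite pmulr mulL_smul.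
have thbin g' d : corner (p g'^-1%g) d -> corner (p g') (theta g' d).
  by move=> /th_fix ->; exact: bin.
(* [y] is the part of [b h c] on which [theta g] is defined, and [c1] is its preimage under
   [theta h]. *)
pose y := mulL (p g^-1%g) (b h c); pose c1 := b h^-1%g y.
have hc1 : corner (p h^-1%g) c1 by exact: bin.
have hy : mulL (p h) y = y.
  by rewrite /y -mulLM -pc mulLM act_ext_in.
have bc1 : b h c1 = y by rewrite act_extV hy.
have tc1 : theta h c1 = y by rewrite th_fix.
have gy : corner (p g^-1%g) (theta h c1) by rewrite tc1; exact: pin.
have [ghc1 gthc1 e] := LR c1 hc1 gy (thbin _ _ gy).
have {}e : theta g (theta h c1) = theta (g * h)%g c1.
  by apply: th_inj e; rewrite invgK//; exact: thbin.
have -> : b g (b h c) = b (g * h)%g c1.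
  by rewrite -[RHS](th_fix ghc1) -e tc1.
(* Likewise for the right-hand side: [z] is the part of [b (g * h) c] inside the range of [theta g],
   and [c2] is its preimage under [theta (g * h)]. *)
pose z := mulL (p g) (b (g * h)%g c); pose c2 := b (g * h)^-1%g z.
have hc2 : corner (p (g * h)^-1%g) c2 by exact: bin.
have hz : mulL (p (g * h)%g) z = z by rewrite /z -mulLM -pc mulLM act_ext_in.
have bc2 : b (g * h)%g c2 = z by rewrite act_extV hz.
have tc2 : theta (g * h)%g c2 = z by rewrite th_fix.
have gz : corner (p g) (theta (g * h)%g c2) by rewrite tc2; exact: pin.
have [hhc2 ghc2 _] := RL c2 hc2 gz.
suff -> : c1 = c2 by rewrite bc2.
(* Test the difference [w] on [star w], which lies in the common ideal: [coext] gives
   [c1 ⋅ star w = c ⋅ star w = c2 ⋅ star w], so [w ⋅ star w = 0]. *)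
apply/eqP; rewrite -subr_eq0; apply/eqP.
set w := c1 - c2.
have hw : mulL (p h^-1%g) (star w) = star w.
  by rewrite pstar (linfB (mulL_linear _)) ((pP _ _).1 hc1) ((pP _ _).1 hhc2).
have gw : mulL (p g^-1%g) (b h (star w)) = b h (star w).
  rewrite bS pstar (linfB (bl h)) (linfB (mulL_linear _)) bc1 /y pK.
  by rewrite th_fix// in ghc2; rewrite ((pP _ _).1 ghc2).
have ghw : mulL (p (g * h)^-1%g) (star w) = star w.
  by rewrite pstar (linfB (mulL_linear _)) ((pP _ _).1 ghc1) ((pP _ _).1 hc2).
have ggw : mulL (p g) (b (g * h)%g (star w)) = b (g * h)%g (star w).
  rewrite bS pstar (linfB (bl _)) (linfB (mulL_linear _)) bc2 /z pK.
  by rewrite th_fix// in gthc1; rewrite ((pP _ _).1 gthc1).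
have w0 : w ⋅ star w = 0.
  rewrite {1}/w smul_subl.
  rewrite (@coext h (p g^-1%g) c c1 (star w))//; last exact: (pP _ _).1.
  rewrite (@coext (g * h)%g (p g) c c2 (star w))//; last exact: (pP _ _).1.
  exact: subrr.
have sw0 : star w = 0 by apply: cstar_eq0; rewrite starK.
by rewrite -[w]starK sw0 star_0.
Qed.

Lemma act_ext_bound g c : `|b g c| <= 2 * `|c|.
Proof.
have [el eM eS] := embM_starhom (A := C).
have hom : starhom (fun c => embM (b g c)).
  split=> [k x y|x y|x]; first by rewrite bl el.
    by rewrite bM eM.
  by rewrite bS eS.
apply: norm_le_mull; first by rewrite mulr_ge0.
move=> y; exact: (starhom_bounded hom).
Qed.

Variable CA : min_tensor C (C0 R G).

Definition act_coaction c : multiplier CA := Cb_mult CA (fun g => b g c).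
Local Notation delta := act_coaction.
Local Notation A := (C0 R G).

Lemma mcoord_act_coaction g c : mcoord (CA_at CA) g (delta c) = embM (b g c).
Proof. by apply: Cb_multP => h; exact: act_ext_bound. Qed.

Lemma act_coaction_starhom : starhom delta.
Proof.
have [el eM eS] := embM_starhom (A := C).
split=> [k x y|x y|x]; apply: (mcoord_inj (CA_sum CA)) => g;
  have [ml mM mS] := mcoord_starhom (CA_sum CA) g.
- by rewrite ml !mcoord_act_coaction bl el.
- by rewrite mM !mcoord_act_coaction bM eM.
- by rewrite mS !mcoord_act_coaction bS eS.
Qed.

Let b_cvg Z (F : set_system Z) {FF : Filter F} g (x : Z -> C) x0 :
  x z @[z --> F] --> x0 -> b g (x z) @[z --> F] --> b g x0.
Proof. exact: linear_cvg (bl g) (act_ext_bound g). Qed.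

(** Moves the factor [d] inside [b g]: strict convergence of [x] becomes norm convergence of the
    argument, and [b g] is norm continuous. *)
Let b_smull g x d : b g x ⋅ d = b g (x ⋅ b g^-1%g d).
Proof. by rewrite bM act_extV pmulr mulL_smul act_ext_in. Qed.

Let b_smulr g x d : d ⋅ b g x = b g (b g^-1%g d ⋅ x).
Proof. by rewrite bM act_extV -mulL_smul -pmulr act_ext_in. Qed.

Lemma act_coaction_strict : strict delta.
Proof.
move=> F x0 FF F1 x01 Fx.
have bd x : `|x| <= 1 -> forall t, `|mulL (delta x) t| <= 2 * `|t|.
  move=> x1; apply: (bound_mcoord (CA_sum CA)) => // g d.
  rewrite mcoord_act_coaction /= (le_trans (norm_smul_le _ _))// ler_wpM2r//.
  by rewrite (le_trans (act_ext_bound _ _))// ler_piMr.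
apply: (@strict_cvg_mcoord _ _ _ _ _ (CA_sum CA) _ F _ delta _ 2) => //.
- by apply: filterS F1 => x; exact: bd.
- exact: bd.
move=> g d; rewrite mcoord_act_coaction; split.
  apply: (@cvg_ext _ _ _ F _ (fun x => b g (x ⋅ b g^-1%g d))) => [x|].
    by rewrite mcoord_act_coaction /= b_smull.
  by rewrite /= b_smull; apply: b_cvg; exact: (Fx _).1.
apply: (@cvg_ext _ _ _ F _ (fun x => b g (b g^-1%g d ⋅ x))) => [x|].
  by rewrite mcoord_act_coaction /= b_smulr.
by rewrite /= b_smulr; apply: b_cvg; exact: (Fx _).2.
Qed.

(** Along the approximate unit, [b g u ⋅ d = b g (u ⋅ b g^-1 d)] tends to [b g (b g^-1 d)], which is
    [p g d]. *)
Lemma act_coaction_one g : mcoord (CA_at CA) g (strict_ext delta mone) = p g.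
Proof.
have [[El _ _] Es Ee _] := strict_extP act_coaction_starhom act_coaction_strict.
have bd : \forall u \near approx_unit, forall x, `|mulL (embM u) x| <= 2 * `|x : C|.
  apply: filterS (approx_unit_bound (A := C)) => u u2 x /=.
  by rewrite (le_trans (norm_smul_le _ _))// ler_wpM2r.
have u1 : strict_cvg (embM u @[u --> @approx_unit _ C]) mone.
  by move=> x; split; [exact: approx_unit_cvgl|exact: approx_unit_cvgr].
have Eu : strict_cvg (strict_ext delta (embM u) @[u --> @approx_unit _ C])
    (strict_ext delta mone).
  exact: mult_strict_cvg El Es bd u1.
have mEu : strict_cvg (mcoord (CA_at CA) g (strict_ext delta (embM u)) @[u --> @approx_unit _ C])
    (mcoord (CA_at CA) g (strict_ext delta mone)).
  exact: mcoord_strict_cvg (CA_sum CA) _ _ _ _ _ _ Eu.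
apply: multiplier_eqL => d.
apply: (cvg_uniq (strict_cvgL mEu (x := d))).
apply: (@cvg_ext _ _ _ approx_unit _ (fun u => b g (u ⋅ b g^-1%g d))) => [u|].
  by rewrite Ee mcoord_act_coaction /= b_smull.
by rewrite -act_extV; apply: b_cvg; exact: approx_unit_cvgl.
Qed.

Lemma act_coaction_C0 c (f : A) :
  exists x : CA, delta c ⋅ mtens CA mone (embM f) = embM x.
Proof.
have [x hx] : exists x, forall g, c0coord (CA_at CA) g x = f g *: b g c.
  apply: (coord_surj (CA_sum CA)) => e e0.
  (* Vanishing at infinity is inherited from [c ⊗ f], with values [f g *: c]; the 2 is the bound of
     [b g]. *)
  have [s hs] := coord_vanish (CA_sum CA) (tens CA c f) (divr_gt0 e0 (ltr0n _ 2)).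
  exists s => g /hs; rewrite coord_tens ler_pdivlMr ?ltr0n// => h.
  by rewrite (le_trans _ h)// !normrZ -mulrA ler_wpM2l// mulrC act_ext_bound.
exists x; apply: (mcoord_inj (CA_sum CA)) => g.
have [_ mM _] := mcoord_starhom (CA_sum CA) g.
have [el _ _] := embM_starhom (A := C).
rewrite mM mcoord_act_coaction mtens_one_embM (mcoord_embM (CA_sum CA)) hx.
by rewrite smul_scaler smul_mone (linfZ el).
Qed.

End CoactionOfAction.

(** * The two directions of the correspondence *)

Theorem proposition4p3 (R : realType) (G : groupType) (C : cstarType R)
    (CA : min_tensor C (C0 R G)) (AA : min_tensor (C0 R G) (C0 R G))
    (CA_A : min_tensor CA (C0 R G)) (C_AA : min_tensor C AA) :
  (forall delta : C -> multiplier CA,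
     partial_coaction CA_A C_AA (C0_comult AA) delta ->
     counital (C0_counit (G := G)) delta ->
     let p g := coact delta (ev g) mone in
     exists2 theta : G -> C -> C,
       forall g c, corner (p g^-1%g) c ->
         embM (theta g c) = coact delta (ev g) (embM c)
       & disconnected_partial_action p theta) /\
  (forall (p : G -> multiplier C) (theta : G -> C -> C),
     disconnected_partial_action p theta ->
     let u c g := theta g (mulL (p g^-1%g) c) in
     let delta c := Cb_mult CA (u c) in
     [/\ forall c, exists M : complex R, forall g, (`|u c g| <= M)%R,
         partial_coaction CA_A C_AA (C0_comult AA) delta
       & counital (C0_counit (G := G)) delta]).
Proof.
split.
  move=> delta [dhom dstrict dC0 did] dcou p.
  have [[El EM ES] Es Ee _] := strict_extP dhom dstrict.
  have pE g : p g = mcoord (CA_at CA) g (strict_ext delta mone).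
    by rewrite /p /coact slice_ev.
  have m_hom g := mcoord_starhom (CA_sum CA) g.
  (* A priori the entries of [delta c] are only multipliers of [C]. Multiplying by [1 ⊗ chi g]
     isolates the entry at [g], and [delta(C)(1 ⊗ A) ⊆ C ⊗ A] places it in [C]. *)
  have /choice[a ha] : forall gc : G * C, exists c',
      mcoord (CA_at CA) gc.1 (delta gc.2) = embM c'.
    move=> [g c] /=; have [x hx] := dC0 c (chi R g).
    exists (c0coord (CA_at CA) g x); rewrite -(mcoord_embM (CA_sum CA)) -hx.
    have [_ mM _] := m_hom g.
    by rewrite mM mtens_one_embM chiE eqxx scale1r smul_mone.
  pose theta g c := a (g, c).
  have th g c : mcoord (CA_at CA) g (delta c) = embM (theta g c) by exact: (ha (g, c)).
  exists theta => [g c _|]; first by rewrite /coact slice_ev Ee th.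
  have [el eM eS] := embM_starhom (A := C).
  have [dl dM dS] := dhom.
  apply: partial_action_of_coaction.
  - by move=> g; have [_ _ mS] := m_hom g; rewrite pE -mS -ES star_mone.
  - by move=> g; have [_ mM _] := m_hom g; rewrite pE -mM -EM smul_mone.
  - move=> g; have [ml mM mS] := m_hom g.
    split=> [k x y|x y|x]; apply: embM_inj; rewrite -th.
    + by rewrite dl ml !th el.
    + by rewrite dM mM !th eM.
    + by rewrite dS mS !th eS.
  - by move=> c; apply: embM_inj; rewrite -th -slice_ev; exact: dcou.
  (* The entry at [g] of [delta(1) delta(c) = delta(c)], where [delta(1)] refers to the strict
     extension. *)
  - move=> g c; apply: embM_inj; have [_ mM _] := m_hom g.
    by rewrite -smul_embM pE -!th -mM -Ee -EM mone_smul.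
  move=> g h c; have /coaction_identityP/(_ g h) := did c.
  by rewrite pE => /(_ dhom dstrict); rewrite !th Ee th smul_embM => /embM_inj.
move=> p theta act u delta.
have bd c g : `|u c g| <= 2 * `|c| by exact: act_ext_bound act g c.
have -> : delta = act_coaction p theta CA by [].
have dhom := act_coaction_starhom act CA.
have dstrict : strict (act_coaction p theta CA) := @act_coaction_strict R G C p theta act CA.
split.
- by move=> c; exists (2 * `|c|) => g; exact: bd.
- split=> [||c f|c]; [exact: dhom|exact: dstrict|exact: (act_coaction_C0 act)|].
  apply/coaction_identityP => // g h.
  have [_ _ Ee _] := strict_extP dhom dstrict.
  rewrite (act_coaction_one act) !(mcoord_act_coaction act) Ee (mcoord_act_coaction act).
  by rewrite smul_embM (act_extM act).
move=> c; rewrite /C0_counit slice_ev (mcoord_act_coaction act).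
by rewrite (act_ext1 act).
Qed.
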